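(* Let $f:\mathbb{S}^k\times\mathbb{O}\to\mathbb{S}$. Then $f$ is $\Sigma^b_1$-representable in $R\Sigma^b_1\text{-NIA}$ if and only if $f\in\mathcal{POR}$.
   Context: Let $\mathbb{B}=\{0,1\}$, $\mathbb{S}=\mathbb{B}^*$ (finite binary strings) and $\mathbb{O}=\mathbb{B}^{\mathbb{S}}$ (oracles). The first-order language $\mathcal{RL}$ has terms $t,s::= x\mid \epsilon\mid \mathtt{0}\mid\mathtt{1}\mid t\frown s\mid t\times s$ and formulas built from atoms $\mathtt{Flip}(t)$, $t=s$, $t\subseteq s$ with $\neg,\wedge,\vee,\exists,\forall$. In the standard interpretation over $\mathbb{S}$, $\frown$ is concatenation (written $ts$), $t\times s$ is $t$ concatenated with itself $|s|$ times, and $\subseteq$ is the prefix relation. Write $\mathtt{1}^t$ for $\mathtt{1}\times t$ and $t\preceq s$ for $\mathtt{1}^t\subseteq\mathtt{1}^s$. Bounded quantifiers: $\exists x\preceq t.F:=\exists x.(\mathtt{1}^x\subseteq\mathtt{1}^t\wedge F)$, $\forall x\preceq t.F:=\forall x.(\mathtt{1}^x\subseteq \mathtt{1}^t\to F)$; subword quantifiers: $\exists x\subseteq^* t.F:=\exists x.\exists w.(w\subseteq t\wedge wx\subseteq t\wedge F)$, $\forall x\subseteq^* t.F:=\forall x.(\exists w.(w\subseteq t\wedge wx\subseteq t)\to F)$. A $\Sigma^b_1$-formula is one of the form $\exists x_1\preceq t_1\cdots\exists x_n\preceq t_n.G$ where all quantifiers of $G$ are subword quantifiers. For $\sigma\in\mathbb{S}$,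 $\overline{\sigma}$ is the closed term denoting $\sigma$. For a formula $F$ (with free variables instantiated), $[\![F]\!]\subseteq\mathbb{O}$ is the set of $\omega$ such that $F$ is true in the standard structure on $\mathbb{S}$ when $\mathtt{Flip}(t)$ is interpreted as $\omega(t)=1$. The theory $R\Sigma^b_1\text{-NIA}$ has axioms (for $\mathtt{b}\in\{\mathtt0,\mathtt1\}$): $x\epsilon=x$; $x(y\mathtt b)=(xy)\mathtt b$; $x\times\epsilon=\epsilon$; $x\times y\mathtt b=(x\times y)x$; $x\subseteq\epsilon\leftrightarrow x=\epsilon$; $x\subseteq y\mathtt b\leftrightarrow x\subseteq y\vee x=y\mathtt b$; $x\mathtt b=y\mathtt b\to x=y$; $x\mathtt0\neq y\mathtt1$; $x\mathtt b\neq\epsilon$; and induction on notation $B(\epsilon)\wedge\forall x.(B(x)\to B(x\mathtt0)\wedge B(x\mathtt1))\to\forall x.B(x)$ for every $\Sigma^b_1$-formula $B$ of $\mathcal{RL}$ (possibly containing $\mathtt{Flip}$). A function $f:\mathbb{S}^k\times\mathbb{O}\to\mathbb{S}$ is $\Sigma^b_1$-representable in $R\Sigma^b_1\text{-NIA}$ if there is a $\Sigma^b_1$-formula $G(\vec x,y)$ of $\mathcal{RL}$ with $R\Sigma^b_1\text{-NIA}\vdash\forall\vec x.\exists!y.G(\vec x,y)$ and, for all $\sigma_1,\dots,\sigma_k,\tau\in\mathbb{S}$ and $\omega\in\mathbb{O}$, $f(\sigma_1,\dots,\sigma_k,\omega)=\tau$ iff $\omega\in[\![G(\overline{\sigma_1},\dots,\overline{\sigma_k},\overline\tau)]\!]$.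 $\mathcal{POR}$ is the smallest class of functions $\mathbb{S}^k\times\mathbb{O}\to\mathbb{S}$ containing $E(x,\omega)=\epsilon$, projections $P^n_i(x_1,\dots,x_n,\omega)=x_i$, successors $S_b(x,\omega)=xb$ ($b\in\mathbb B$), the conditional $C(\epsilon,y,z_0,z_1,\omega)=y$, $C(xb,y,z_0,z_1,\omega)=z_b$, and the query $Q(x,\omega)=\omega(x)$, and closed under composition $f(\vec x,\omega)=g(h_1(\vec x,\omega),\dots,h_k(\vec x,\omega),\omega)$ and bounded recursion on notation: $f(\vec x,\epsilon,\omega)=g(\vec x,\omega)$, $f(\vec x,yb,\omega)=h_b(\vec x,y,f(\vec x,y,\omega),\omega)|_{t(\vec x,y)}$ for $b\in\{0,1\}$, where $t$ is a term built from $\epsilon,0,1,\frown,\times$ and the variables $\vec x,y$, and $u|_r$ denotes $u$ truncated to length $|r|$ (i.e. $u$ itself if $|u|\le|r|$).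
   Formalization: The formal theorem assumes k ≥ 1: with the stated initial functions POR contains no function of arity 0, while the 0-ary constant ε is Σ^b_1-representable (by y = ε), so the equivalence fails at k = 0. *)

(* Defs.v *)
From mathcomp Require Import all_boot.
From Stdlib Require List.

Set Implicit Arguments.
Unset Strict Implicit.
Unset Printing Implicit Defensive.

Definition str := seq bool.
Definition oracle := str -> bool.

(** * Syntax of RL, with de Bruijn variables *)

Inductive tm : Type :=
  | Var of nat
  | Eps
  | Bit of bool
  | Cat of tm & tm
  | Rep of tm & tm.

Inductive fm : Type :=
  | Flip of tm
  | Eq of tm & tm
  | Pre of tm & tm
  | Neg of fm
  | And of fm & fm
  | Or of fm & fm
  | Ex of fm
  | All of fm.

Definition Imp (A B : fm) : fm := Or (Neg A) B.
Definition Iff (A B : fm) : fm := And (Imp A B) (Imp B A).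

Fixpoint tm_subst (s : nat -> tm) (t : tm) : tm :=
  match t with
  | Var i => s i
  | Eps => Eps
  | Bit b => Bit b
  | Cat u v => Cat (tm_subst s u) (tm_subst s v)
  | Rep u v => Rep (tm_subst s u) (tm_subst s v)
  end.

Definition tm_shift (t : tm) : tm := tm_subst (fun i => Var i.+1) t.

Definition up (s : nat -> tm) (i : nat) : tm :=
  if i is j.+1 then tm_shift (s j) else Var 0.

Fixpoint fm_subst (s : nat -> tm) (A : fm) : fm :=
  match A with
  | Flip t => Flip (tm_subst s t)
  | Eq t u => Eq (tm_subst s t) (tm_subst s u)
  | Pre t u => Pre (tm_subst s t) (tm_subst s u)
  | Neg B => Neg (fm_subst s B)
  | And B C => And (fm_subst s B) (fm_subst s C)
  | Or B C => Or (fm_subst s B) (fm_subst s C)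
  | Ex B => Ex (fm_subst (up s) B)
  | All B => All (fm_subst (up s) B)
  end.

Definition fm_shift (A : fm) : fm := fm_subst (fun i => Var i.+1) A.

(* Capture-avoiding substitution of [t] for variable 0, which is removed. *)
Definition inst (A : fm) (t : tm) : fm :=
  fm_subst (fun i => if i is j.+1 then Var j else t) A.

Fixpoint tm_vars_lt (n : nat) (t : tm) : bool :=
  match t with
  | Var i => i < n
  | Eps | Bit _ => true
  | Cat u v | Rep u v => tm_vars_lt n u && tm_vars_lt n v
  end.

Fixpoint fm_vars_lt (n : nat) (A : fm) : bool :=
  match A with
  | Flip t => tm_vars_lt n t
  | Eq t u | Pre t u => tm_vars_lt n t && tm_vars_lt n u
  | Neg B => fm_vars_lt n B
  | And B C | Or B C => fm_vars_lt n B && fm_vars_lt n C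
  | Ex B | All B => fm_vars_lt n.+1 B
  end.

(** * Bounded and subword quantifiers *)

Definition Ones (t : tm) : tm := Rep (Bit true) t.
Definition Preceq (t u : tm) : fm := Pre (Ones t) (Ones u).

(* In the quantifiers below [F] lives under the binder of x (variable 0),
   whereas the bounding term [t] lives outside it, so x does not occur in [t]. *)
Definition ExB (t : tm) (F : fm) : fm :=
  Ex (And (Preceq (Var 0) (tm_shift t)) F).

(* Variable 1 is x and variable 0 is w. *)
Definition subword_at (t : tm) : fm :=
  And (Pre (Var 0) (tm_shift (tm_shift t)))
      (Pre (Cat (Var 0) (Var 1)) (tm_shift (tm_shift t))).

Definition ExSub (t : tm) (F : fm) : fm :=
  Ex (Ex (And (subword_at t) (fm_shift F))).

Definition AllSub (t : tm) (F : fm) : fm :=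
  All (Imp (Ex (subword_at t)) F).

Inductive subword_only : fm -> Prop :=
  | SubFlip t : subword_only (Flip t)
  | SubEq t u : subword_only (Eq t u)
  | SubPre t u : subword_only (Pre t u)
  | SubNeg A : subword_only A -> subword_only (Neg A)
  | SubAnd A B : subword_only A -> subword_only B -> subword_only (And A B)
  | SubOr A B : subword_only A -> subword_only B -> subword_only (Or A B)
  | SubEx t A : subword_only A -> subword_only (ExSub t A)
  | SubAll t A : subword_only A -> subword_only (AllSub t A).

Inductive sigma1b : fm -> Prop :=
  | Sigma1bBase G : subword_only G -> sigma1b G
  | Sigma1bEx t F : sigma1b F -> sigma1b (ExB t F).

(** * Standard interpretation *)

Fixpoint tm_eval (rho : nat -> str) (t : tm) : str :=
  match t with
  | Var i => rho i
  | Eps => [::]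
  | Bit b => [:: b]
  | Cat u v => tm_eval rho u ++ tm_eval rho v
  | Rep u v => flatten (nseq (size (tm_eval rho v)) (tm_eval rho u))
  end.

Definition env_cons (x : str) (rho : nat -> str) (i : nat) : str :=
  if i is j.+1 then rho j else x.

Fixpoint sat (omega : oracle) (rho : nat -> str) (A : fm) : Prop :=
  match A with
  | Flip t => omega (tm_eval rho t) = true
  | Eq t u => tm_eval rho t = tm_eval rho u
  | Pre t u => prefix (tm_eval rho t) (tm_eval rho u)
  | Neg B => ~ sat omega rho B
  | And B C => sat omega rho B /\ sat omega rho C
  | Or B C => sat omega rho B \/ sat omega rho C
  | Ex B => exists x, sat omega (env_cons x rho) B
  | All B => forall x, sat omega (env_cons x rho) B
  end.

(* Only used on closed formulas, for which the valuation is irrelevant. *)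
Definition truth_set (F : fm) (omega : oracle) : Prop :=
  sat omega (fun _ => [::]) F.

Definition numeral (s : str) : tm := foldl (fun t b => Cat t (Bit b)) Eps s.

(** * Classical natural deduction with equality over a theory [T] *)

(* Members of [T] may be open: [PrfAx] holds in every context, including those
   shifted by [PrfAllI], so an axiom stands for its universal closure. *)
Inductive prf (T : fm -> Prop) : seq fm -> fm -> Prop :=
  | PrfAx Gam A : T A -> prf T Gam A
  | PrfHyp Gam A : List.In A Gam -> prf T Gam A
  | PrfAndI Gam A B : prf T Gam A -> prf T Gam B -> prf T Gam (And A B)
  | PrfAndE1 Gam A B : prf T Gam (And A B) -> prf T Gam A
  | PrfAndE2 Gam A B : prf T Gam (And A B) -> prf T Gam B
  | PrfOrI1 Gam A B : prf T Gam A -> prf T Gam (Or A B)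
  | PrfOrI2 Gam A B : prf T Gam B -> prf T Gam (Or A B)
  | PrfOrE Gam A B C : prf T Gam (Or A B) ->
      prf T (A :: Gam) C -> prf T (B :: Gam) C -> prf T Gam C
  | PrfNegI Gam A B :
      prf T (A :: Gam) B -> prf T (A :: Gam) (Neg B) -> prf T Gam (Neg A)
  | PrfNegE Gam A B : prf T Gam A -> prf T Gam (Neg A) -> prf T Gam B
  | PrfNegNeg Gam A : prf T Gam (Neg (Neg A)) -> prf T Gam A
  | PrfAllI Gam A : prf T (map fm_shift Gam) A -> prf T Gam (All A)
  | PrfAllE Gam A t : prf T Gam (All A) -> prf T Gam (inst A t)
  | PrfExI Gam A t : prf T Gam (inst A t) -> prf T Gam (Ex A)
  | PrfExE Gam A B : prf T Gam (Ex A) ->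
      prf T (A :: map fm_shift Gam) (fm_shift B) -> prf T Gam B
  | PrfEqRefl Gam t : prf T Gam (Eq t t)
  | PrfEqSubst Gam A t u :
      prf T Gam (Eq t u) -> prf T Gam (inst A t) -> prf T Gam (inst A u).

Definition provable (T : fm -> Prop) (A : fm) : Prop := prf T [::] A.

(** * The theory RSigma^b_1-NIA *)

(* B(xb) for x = variable 0, without removing that variable. *)
Definition at_succ (B : fm) (b : bool) : fm :=
  fm_subst (fun i => if i is 0 then Cat (Var 0) (Bit b) else Var i) B.

Definition induction (B : fm) : fm :=
  Imp (And (inst B Eps)
           (All (Imp B (And (at_succ B false) (at_succ B true)))))
      (All B).

Inductive RS1bNIA : fm -> Prop :=
  | AxCatEps : RS1bNIA (Eq (Cat (Var 0) Eps) (Var 0))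
  | AxCatBit b :
      RS1bNIA (Eq (Cat (Var 0) (Cat (Var 1) (Bit b)))
                  (Cat (Cat (Var 0) (Var 1)) (Bit b)))
  | AxRepEps : RS1bNIA (Eq (Rep (Var 0) Eps) Eps)
  | AxRepBit b :
      RS1bNIA (Eq (Rep (Var 0) (Cat (Var 1) (Bit b)))
                  (Cat (Rep (Var 0) (Var 1)) (Var 0)))
  | AxPreEps : RS1bNIA (Iff (Pre (Var 0) Eps) (Eq (Var 0) Eps))
  | AxPreBit b :
      RS1bNIA (Iff (Pre (Var 0) (Cat (Var 1) (Bit b)))
                   (Or (Pre (Var 0) (Var 1))
                       (Eq (Var 0) (Cat (Var 1) (Bit b)))))
  | AxBitInj b :
      RS1bNIA (Imp (Eq (Cat (Var 0) (Bit b)) (Cat (Var 1) (Bit b)))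
                   (Eq (Var 0) (Var 1)))
  | AxBitNeq :
      RS1bNIA (Neg (Eq (Cat (Var 0) (Bit false)) (Cat (Var 1) (Bit true))))
  | AxBitNeqEps b : RS1bNIA (Neg (Eq (Cat (Var 0) (Bit b)) Eps))
  | AxInd B : sigma1b B -> RS1bNIA (induction B).

(** * Representability *)

(* Exists y (G(y) and forall z (G(z) -> z = y)); in the inner part z is
   variable 0, y is variable 1, and the renaming of [G] skips y. *)
Definition ExUnique (G : fm) : fm :=
  Ex (And G
          (All (Imp (fm_subst (fun i => if i is j.+1 then Var j.+2 else Var 0) G)
                    (Eq (Var 0) (Var 1))))).

(* In G(x_1, ..., x_k, y), y is variable 0 and x_i is variable i. *)
Definition plug (G : fm) (xs : seq str) (y : str) : fm :=
  fm_subst (fun i => if i is j.+1 then numeral (nth [::] xs j) else numeral y) G.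

Definition sigma1b_representable (k : nat)
    (f : k.-tuple str -> oracle -> str) : Prop :=
  exists G : fm,
    [/\ sigma1b G,
        fm_vars_lt k.+1 G,
        provable RS1bNIA (iter k All (ExUnique G))
      & forall (xs : k.-tuple str) (y : str) (omega : oracle),
          f xs omega = y <-> truth_set (plug G xs y) omega].

(** * The function algebra POR *)

(* Clauses are stated by pointwise equations, so that membership does not
   depend on functional extensionality. *)
Inductive POR : forall n, (n.-tuple str -> oracle -> str) -> Prop :=
  | PorE (f : 1.-tuple str -> oracle -> str) :
      (forall x omega, f [tuple x] omega = [::]) -> POR f
  | PorP n (i : 'I_n) (f : n.-tuple str -> oracle -> str) :
      (forall xs omega, f xs omega = tnth xs i) -> POR f
  | PorS (b : bool) (f : 1.-tuple str -> oracle -> str) :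
      (forall x omega, f [tuple x] omega = rcons x b) -> POR f
  | PorC (f : 4.-tuple str -> oracle -> str) :
      (forall y z0 z1 omega, f [tuple [::]; y; z0; z1] omega = y) ->
      (forall x b y z0 z1 omega,
         f [tuple rcons x b; y; z0; z1] omega = if b then z1 else z0) ->
      POR f
  | PorQ (f : 1.-tuple str -> oracle -> str) :
      (forall x omega, f [tuple x] omega = [:: omega x]) -> POR f
  | PorComp n m (g : m.-tuple str -> oracle -> str)
      (h : 'I_m -> n.-tuple str -> oracle -> str)
      (f : n.-tuple str -> oracle -> str) :
      POR g -> (forall i, POR (h i)) ->
      (forall xs omega, f xs omega = g [tuple h i xs omega | i < m] omega) ->
      POR f
  | PorRec n (g : n.-tuple str -> oracle -> str)
      (h : bool -> n.+2.-tuple str -> oracle -> str) (t : tm)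
      (f : n.+1.-tuple str -> oracle -> str) :
      POR g -> (forall b, POR (h b)) -> tm_vars_lt n.+1 t ->
      (forall (xs : n.-tuple str) omega,
         f [tuple of rcons xs [::]] omega = g xs omega) ->
      (forall (xs : n.-tuple str) y b omega,
         f [tuple of rcons xs (rcons y b)] omega =
         take (size (tm_eval (nth [::] (rcons xs y)) t))
              (h b [tuple of rcons (rcons xs y) (f [tuple of rcons xs y] omega)]
                 omega)) ->
      POR f.

(* All initial functions have positive arity, hence so do all members. *)
Lemma POR_arity_gt0 n (f : n.-tuple str -> oracle -> str) : POR f -> 0 < n.
Proof.
elim=> // [m i _ _ | m k g h _ _ gt0k _ IHh _].
  exact: leq_ltn_trans (ltn_ord i).
exact: IHh (Ordinal gt0k).
Qed.

(* Main.v *)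
Require Import Defs.
From mathcomp Require Import all_boot.
From mathcomp.classical Require Import boolp.
From Stdlib Require List.

Set Implicit Arguments.
Unset Strict Implicit.
Unset Printing Implicit Defensive.

(** Provability is replaced by truth in all models, via Henkin's completeness
    theorem.

    From POR to representability: in every model of the theory one carries out
    bounded recursion with a history made of blocks of a fixed length, so that
    the block of a prefix [p] is found at the position given by the length of
    [c x p]. The witnesses of the individual steps are just concatenated: a
    subword quantifier finds them again, so that no pairing is needed.

    From representability to POR: suppose that no POR function [tau] satisfies
    [G(x, tau(x, w))] for all [x] and [w], that is, that the universal formula
    [forall y, ~ G(c, y)] has no Herbrand refutation by POR functions. A Henkin
    construction extends it to a Herbrand-saturated set of universal formulas
    without such a refutation. The POR functions of the Henkin constants, modulo
    equality according to that set, form a model. There the induction step of a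
    Sigma^b_1 induction is witnessed by a POR function, by saturation; bounded
    recursion iterates it, and a search along the notation reduces the induction
    to instances of the step. So the model satisfies the theory and refutes
    [exists y, G(c, y)], which contradicts soundness. *)

(** Totality and uniqueness must be derived by induction on Sigma^b_1 formulas only. Graphs are
    therefore kept as one bounded witness in front of a subword-only formula. Subword quantifiers
    survive negation and implication, so uniqueness is also within reach of induction; only the
    existence of a history is proved by induction on a formula with genuine bounded quantifiers.

    In the converse direction, a statement [forall X Y, exists x] true in a model need not be
    witnessed by a function. For every program [P] the Henkin construction offers two fresh
    constants [d1], [d2] and the formula [forall x, P(d1, d2, x)]. If consistent it is added;
    otherwise its Herbrand refutation yields a POR function [s] with [~ P(d1, d2, s(d1, d2))]. Two
    constants are what an induction step needs: the argument and the witness already found, while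
    [x] is the next witness. This suffices because bounded quantifiers contract into one, because
    its witness is bounded by a term, which makes the truncation in bounded recursion harmless, and
    because decidability of subword-only formulas lets finitely many Herbrand instances merge into
    one. *)

Record structure := Structure {
  dom :> Type;
  s_eps : dom;
  s_bit : bool -> dom;
  s_cat : dom -> dom -> dom;
  s_rep : dom -> dom -> dom;
  s_pre : dom -> dom -> Prop;
  s_flip : dom -> Prop }.

(** Polymorphic, since it extends valuations in any structure and also substitutions. *)
Definition econs (T : Type) (x : T) (rho : nat -> T) (i : nat) : T :=
  if i is j.+1 then rho j else x.

Fixpoint teval (M : structure) (rho : nat -> M) (t : tm) : M :=
  match t with
  | Var i => rho i
  | Eps => s_eps M
  | Bit b => s_bit M b
  | Cat u v => s_cat (teval rho u) (teval rho v)
  | Rep u v => s_rep (teval rho u) (teval rho v)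
  end.

Fixpoint msat (M : structure) (rho : nat -> M) (A : fm) : Prop :=
  match A with
  | Flip t => s_flip (teval rho t)
  | Eq t u => teval rho t = teval rho u
  | Pre t u => s_pre (teval rho t) (teval rho u)
  | Neg B => ~ msat rho B
  | And B C => msat rho B /\ msat rho C
  | Or B C => msat rho B \/ msat rho C
  | Ex B => exists x, msat (econs x rho) B
  | All B => forall x, msat (econs x rho) B
  end.

Definition is_model (T : fm -> Prop) (M : structure) : Prop :=
  forall A (rho : nat -> M), T A -> msat rho A.

Definition Std (w : oracle) : structure :=
  @Structure str [::] (fun b => [:: b]) cat
    (fun x y => flatten (nseq (size y) x)) (fun x y => prefix x y)
    (fun x => w x = true).

Lemma teval_Std w rho t : @teval (Std w) rho t = tm_eval rho t.
Proof. by elim: t => //= [u -> v ->|u -> v ->]. Qed.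

Lemma env_consE x rho : env_cons x rho = econs x rho.
Proof. by apply/funext; case. Qed.

Lemma msat_Std w rho A : @msat (Std w) rho A = sat w rho A.
Proof.
elim: A rho => //=.
- by move=> t rho; rewrite teval_Std.
- by move=> t u rho; rewrite !teval_Std.
- by move=> t u rho; rewrite !teval_Std.
- by move=> B IH rho; rewrite IH.
- by move=> B IHB C IHC rho; rewrite IHB IHC.
- by move=> B IHB C IHC rho; rewrite IHB IHC.
- by move=> B IH rho; apply: eq_exists => x; rewrite IH env_consE.
- by move=> B IH rho; apply: eq_forall => x; rewrite IH env_consE.
Qed.

(** * Substitution *)

Lemma teval_subst (M : structure) (rho : nat -> M) s t :
  teval rho (tm_subst s t) = teval (fun i => teval rho (s i)) t.
Proof. by elim: t => //= [u -> v ->|u -> v ->]. Qed.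

Lemma teval_shift (M : structure) (rho : nat -> M) x t :
  teval (econs x rho) (tm_shift t) = teval rho t.
Proof. exact: teval_subst. Qed.

Lemma teval_up (M : structure) (rho : nat -> M) x s :
  (fun i => teval (econs x rho) (up s i)) = econs x (fun i => teval rho (s i)).
Proof. by apply/funext => -[|i] //=; rewrite teval_shift. Qed.

Lemma msat_subst (M : structure) (rho : nat -> M) s A :
  msat rho (fm_subst s A) = msat (fun i => teval rho (s i)) A.
Proof.
elim: A rho s => //=.
- by move=> t rho s; rewrite teval_subst.
- by move=> t u rho s; rewrite !teval_subst.
- by move=> t u rho s; rewrite !teval_subst.
- by move=> B IH rho s; rewrite IH.
- by move=> B IHB C IHC rho s; rewrite IHB IHC.
- by move=> B IHB C IHC rho s; rewrite IHB IHC.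
- by move=> B IH rho s; apply: eq_exists => x; rewrite IH teval_up.
- by move=> B IH rho s; apply: eq_forall => x; rewrite IH teval_up.
Qed.

Lemma msat_shift (M : structure) (rho : nat -> M) x A :
  msat (econs x rho) (fm_shift A) = msat rho A.
Proof. exact: msat_subst. Qed.

Lemma msat_inst (M : structure) (rho : nat -> M) A t :
  msat rho (inst A t) = msat (econs (teval rho t) rho) A.
Proof. by rewrite /inst msat_subst; congr msat; apply/funext => -[]. Qed.

Lemma tm_subst_comp s s' t :
  tm_subst s' (tm_subst s t) = tm_subst (fun i => tm_subst s' (s i)) t.
Proof. by elim: t => //= [u -> v ->|u -> v ->]. Qed.

Lemma tm_subst_Var t : tm_subst Var t = t.
Proof. by elim: t => //= [u -> v ->|u -> v ->]. Qed.

Lemma up_comp s s' :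
  (fun i => tm_subst (up s') (up s i)) = up (fun i => tm_subst s' (s i)).
Proof. by apply/funext => -[|i] //=; rewrite /tm_shift !tm_subst_comp. Qed.

Lemma fm_subst_comp s s' A :
  fm_subst s' (fm_subst s A) = fm_subst (fun i => tm_subst s' (s i)) A.
Proof.
elim: A s s' => //=.
- by move=> t s s'; rewrite tm_subst_comp.
- by move=> t u s s'; rewrite !tm_subst_comp.
- by move=> t u s s'; rewrite !tm_subst_comp.
- by move=> B IH s s'; rewrite IH.
- by move=> B IHB C IHC s s'; rewrite IHB IHC.
- by move=> B IHB C IHC s s'; rewrite IHB IHC.
- by move=> B IH s s'; rewrite IH up_comp.
- by move=> B IH s s'; rewrite IH up_comp.
Qed.

Lemma up_Var : up Var = Var.
Proof. by apply/funext => -[]. Qed.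

Lemma fm_subst_Var A : fm_subst Var A = A.
Proof.
elim: A => //=; rewrite ?up_Var.
- by move=> t; rewrite tm_subst_Var.
- by move=> t u; rewrite !tm_subst_Var.
- by move=> t u; rewrite !tm_subst_Var.
- by move=> B ->.
- by move=> B -> C ->.
- by move=> B -> C ->.
- by move=> B ->.
- by move=> B ->.
Qed.

Lemma fm_shift_up s A : fm_subst (up s) (fm_shift A) = fm_shift (fm_subst s A).
Proof. by rewrite /fm_shift !fm_subst_comp. Qed.

Lemma tm_shift_up s t : tm_subst (up s) (tm_shift t) = tm_shift (tm_subst s t).
Proof. by rewrite /tm_shift !tm_subst_comp. Qed.

Lemma inst_subst s A t :
  fm_subst s (inst A t) = inst (fm_subst (up s) A) (tm_subst s t).
Proof.
rewrite /inst !fm_subst_comp; congr fm_subst; apply/funext => -[|i] //=.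
by rewrite /tm_shift tm_subst_comp /= tm_subst_Var.
Qed.

(** Turns an instance of a quantified body into an extended substitution, the form needed by the
    quantifier cases of the truth lemma. *)
Lemma fm_subst_cons s A t :
  inst (fm_subst (up s) A) t = fm_subst (econs t s) A.
Proof.
rewrite /inst fm_subst_comp; congr fm_subst; apply/funext => -[|i] //=.
by rewrite /tm_shift tm_subst_comp /= tm_subst_Var.
Qed.

Lemma tm_subst_ext n s s' t :
  (forall i, i < n -> s i = s' i) -> tm_vars_lt n t ->
  tm_subst s t = tm_subst s' t.
Proof.
by move=> e; elim: t => //= u IHu v IHv /andP[/IHu-> /IHv->].
Qed.

Lemma fm_subst_ext n s s' A :
  (forall i, i < n -> s i = s' i) -> fm_vars_lt n A ->
  fm_subst s A = fm_subst s' A.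
Proof.
elim: A n s s' => //=.
- by move=> t n s s' e h; rewrite (tm_subst_ext e).
- by move=> t u n s s' e /andP[h k]; rewrite !(tm_subst_ext e).
- by move=> t u n s s' e /andP[h k]; rewrite !(tm_subst_ext e).
- by move=> B IH n s s' e h; rewrite (IH _ _ _ e).
- by move=> B IHB C IHC n s s' e /andP[h k]; rewrite (IHB _ _ _ e h) (IHC _ _ _ e k).
- by move=> B IHB C IHC n s s' e /andP[h k]; rewrite (IHB _ _ _ e h) (IHC _ _ _ e k).
- move=> B IH n s s' e h; congr Ex; apply: IH h => -[|i] //=.
  by rewrite ltnS => /e ->.
- move=> B IH n s s' e h; congr All; apply: IH h => -[|i] //=.
  by rewrite ltnS => /e ->.
Qed.

Lemma tm_vars_le m n t : m <= n -> tm_vars_lt m t -> tm_vars_lt n t.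
Proof.
move=> le_mn; elim: t => //= [i /leq_trans-> //|u IHu v IHv|u IHu v IHv];
by case/andP=> /IHu -> /IHv ->.
Qed.

Lemma fm_vars_le m n A : m <= n -> fm_vars_lt m A -> fm_vars_lt n A.
Proof.
elim: A m n => //=.
- by move=> t m n; apply: tm_vars_le.
- by move=> t u m n le_mn /andP[h k]; rewrite !(tm_vars_le le_mn).
- by move=> t u m n le_mn /andP[h k]; rewrite !(tm_vars_le le_mn).
- by move=> B IHB C IHC m n le_mn /andP[/(IHB _ _ le_mn)-> /(IHC _ _ le_mn)->].
- by move=> B IHB C IHC m n le_mn /andP[/(IHB _ _ le_mn)-> /(IHC _ _ le_mn)->].
- by move=> B IH m n le_mn; apply: IH.
- by move=> B IH m n le_mn; apply: IH.
Qed.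

Lemma tm_vars_ex t : exists n, tm_vars_lt n t.
Proof.
elim: t => [i|||u [m hm] v [n hn]|u [m hm] v [n hn]] /=;
  [by exists i.+1 | by exists 0 | by exists 0 | |];
by exists (maxn m n); rewrite (tm_vars_le (leq_maxl _ _) hm) (tm_vars_le (leq_maxr _ _)
  hn).
Qed.

Lemma fm_vars_ex A : exists n, fm_vars_lt n A.
Proof.
elim: A => [t|t u|t u|B [n h]|B [m hm] C [n hn]|B [m hm] C [n hn]|B [n h]|B [n h]] /=.
- exact: tm_vars_ex.
- by have [n] := tm_vars_ex (Cat t u); exists n.
- by have [n] := tm_vars_ex (Cat t u); exists n.
- by exists n.
- by exists (maxn m n); rewrite (fm_vars_le (leq_maxl _ _) hm) (fm_vars_le (leq_maxr _
    _) hn).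
- by exists (maxn m n); rewrite (fm_vars_le (leq_maxl _ _) hm) (fm_vars_le (leq_maxr _
    _) hn).
- by exists n; apply: fm_vars_le h.
- by exists n; apply: fm_vars_le h.
Qed.

Lemma tm_vars_subst m n s t : (forall i, i < m -> tm_vars_lt n (s i)) ->
  tm_vars_lt m t -> tm_vars_lt n (tm_subst s t).
Proof.
by move=> h; elim: t => //= u IHu v IHv /andP[/IHu-> /IHv->].
Qed.

Lemma fm_vars_subst m n s A : (forall i, i < m -> tm_vars_lt n (s i)) ->
  fm_vars_lt m A -> fm_vars_lt n (fm_subst s A).
Proof.
have up_lt m' n' s' : (forall i, i < m' -> tm_vars_lt n' (s' i)) ->
    forall i, i < m'.+1 -> tm_vars_lt n'.+1 (up s' i).
  by move=> h [|i] //= /h; apply: tm_vars_subst => j.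
elim: A m n s => //=.
- by move=> t m n s; apply: tm_vars_subst.
- by move=> t u m n s h /andP[? ?]; rewrite !(tm_vars_subst h).
- by move=> t u m n s h /andP[? ?]; rewrite !(tm_vars_subst h).
- by move=> B IHB C IHC m n s h /andP[/(IHB _ _ _ h)-> /(IHC _ _ _ h)->].
- by move=> B IHB C IHC m n s h /andP[/(IHB _ _ _ h)-> /(IHC _ _ _ h)->].
- by move=> B IH m n s /up_lt h; apply: IH.
- by move=> B IH m n s /up_lt h; apply: IH.
Qed.

Lemma subword_only_subst s A : subword_only A -> subword_only (fm_subst s A).
Proof.
move=> h; elim: h s => /=.
- by move=> t s; constructor.
- by move=> t u s; constructor.
- by move=> t u s; constructor.
- by move=> B _ IH s; constructor.
- by move=> B C _ IHB _ IHC s; constructor.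
- by move=> B C _ IHB _ IHC s; constructor.
- move=> t B _ IH s; rewrite fm_shift_up !tm_shift_up.
  exact: (SubEx (tm_subst s t)).
- move=> t B _ IH s; rewrite !tm_shift_up.
  exact: (SubAll (tm_subst s t)).
Qed.

(** * Soundness *)

Lemma soundness T (M : structure) Gam A : is_model T M -> prf T Gam A ->
  forall rho : nat -> M, (forall B, List.In B Gam -> msat rho B) -> msat rho A.
Proof.
move=> hM; elim=> {Gam A}.
- by move=> Gam A /hM h rho _.
- by move=> Gam A h rho; apply.
- by move=> Gam A B _ IHA _ IHB rho h /=; split; [apply: IHA | apply: IHB].
- by move=> Gam A B _ IH rho /IH[].
- by move=> Gam A B _ IH rho /IH[].
- by move=> Gam A B _ IH rho /IH /=; left.
- by move=> Gam A B _ IH rho /IH /=; right.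
- move=> Gam A B C _ IH _ IHA _ IHB rho h.
  by case: (IH rho h) => hh; [apply: IHA | apply: IHB] => D [<-|/h].
- move=> Gam A B _ IHA _ IHB rho h /= hA.
  have h' D : List.In D (A :: Gam) -> msat rho D by case=> [<-|/h].
  exact: IHB h' (IHA _ h').
- by move=> Gam A B _ IHA _ IHB rho h; case: (IHB _ h); apply: IHA.
- by move=> Gam A _ IH rho /IH /= /contrapT.
- move=> Gam A _ IH rho h /= x; apply: IH => B.
  by case/List.in_map_iff=> C [<- /h]; rewrite msat_shift.
- by move=> Gam A t _ IH rho /IH /=; rewrite msat_inst.
- by move=> Gam A t _ IH rho /IH; rewrite msat_inst /=; exists (teval rho t).
- move=> Gam A B _ IHA _ IHB rho h; have [x hx] := IHA _ h.
  rewrite -(msat_shift _ x); apply: IHB => C [<- //|].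
  by case/List.in_map_iff=> D [<- /h]; rewrite msat_shift.
- by [].
- by move=> Gam A t u _ IHe _ IH rho h; rewrite msat_inst -IHe // -msat_inst; apply: IH.
Qed.

Lemma msat_iter_All (M : structure) k A :
  (forall rho : nat -> M, msat rho (iter k All A)) <->
  (forall rho : nat -> M, msat rho A).
Proof.
elim: k A => //= k IH A; split=> h rho.
- by apply: (IH A).1 => {}rho; have := h (fun i => rho i.+1) (rho 0);
    congr msat; apply/funext => -[].
- by move=> x; apply: (IH A).2.
Qed.

(** * Quotients *)

Section Quotient.
Variables (T : Type) (R : T -> T -> Prop).
Hypothesis Rrefl : forall x, R x x.
Hypothesis Rsym : forall x y, R x y -> R y x.
Hypothesis Rtrans : forall x y z, R x y -> R y z -> R x z.

(** Classes are predicates, so extensionality makes equivalent elements equal; [cid] supplies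
    representatives. *)
Definition quot : Type := {P : T -> Prop | exists x, P = R x}.
Definition cls (x : T) : quot := exist _ (R x) (ex_intro _ x erefl).
Definition qrep (q : quot) : T := projT1 (cid (projT2 q)).

Lemma qrepK q : cls (qrep q) = q.
Proof.
case: q => P hP; rewrite /qrep /=; case: cid => x /= e; subst P.
by congr exist; apply: Prop_irrelevance.
Qed.

Lemma clsP x y : cls x = cls y <-> R x y.
Proof.
split=> [[e]|h]; first by rewrite e; apply: Rrefl.
apply: eq_exist => /=; apply/funext => z; apply/propext.
by split; apply: Rtrans => //; apply: Rsym.
Qed.

Lemma R_qrep x : R (qrep (cls x)) x.
Proof. by apply/clsP/qrepK. Qed.

End Quotient.

(** * Completeness *)

(** [GenTree.tree nat] is countable, which gives an enumeration of formulas. Labels may repeat,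
    since the number of children also separates the constructors. *)
Fixpoint tm_code (t : tm) : GenTree.tree nat :=
  match t with
  | Var i => GenTree.Leaf i
  | Eps => GenTree.Node 0 [::]
  | Bit b => GenTree.Node b.+1 [::]
  | Cat u v => GenTree.Node 0 [:: tm_code u; tm_code v]
  | Rep u v => GenTree.Node 1 [:: tm_code u; tm_code v]
  end.

Fixpoint tm_decode (t : GenTree.tree nat) : tm :=
  match t with
  | GenTree.Leaf i => Var i
  | GenTree.Node 0 [::] => Eps
  | GenTree.Node n [::] => Bit (n == 2)
  | GenTree.Node 0 [:: u; v] => Cat (tm_decode u) (tm_decode v)
  | GenTree.Node _ [:: u; v] => Rep (tm_decode u) (tm_decode v)
  | _ => Eps
  end.

Lemma tm_codeK : cancel tm_code tm_decode.
Proof. by elim=> //= [[]|u -> v ->|u -> v ->]. Qed.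

Fixpoint fm_code (A : fm) : GenTree.tree nat :=
  match A with
  | Flip t => GenTree.Node 0 [:: tm_code t]
  | Eq t u => GenTree.Node 0 [:: tm_code t; tm_code u]
  | Pre t u => GenTree.Node 1 [:: tm_code t; tm_code u]
  | Neg B => GenTree.Node 1 [:: fm_code B]
  | And B C => GenTree.Node 2 [:: fm_code B; fm_code C]
  | Or B C => GenTree.Node 3 [:: fm_code B; fm_code C]
  | Ex B => GenTree.Node 2 [:: fm_code B]
  | All B => GenTree.Node 3 [:: fm_code B]
  end.

Fixpoint fm_decode (t : GenTree.tree nat) : fm :=
  match t with
  | GenTree.Node 0 [:: t] => Flip (tm_decode t)
  | GenTree.Node 0 [:: t; u] => Eq (tm_decode t) (tm_decode u)
  | GenTree.Node 1 [:: t; u] => Pre (tm_decode t) (tm_decode u)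
  | GenTree.Node 1 [:: t] => Neg (fm_decode t)
  | GenTree.Node 2 [:: t; u] => And (fm_decode t) (fm_decode u)
  | GenTree.Node 3 [:: t; u] => Or (fm_decode t) (fm_decode u)
  | GenTree.Node 2 [:: t] => Ex (fm_decode t)
  | GenTree.Node 3 [:: t] => All (fm_decode t)
  | _ => Flip Eps
  end.

Lemma fm_codeK : cancel fm_code fm_decode.
Proof.
by elim=> //= [t|t u|t u|B ->|B -> C ->|B -> C ->|B ->|B ->] //; rewrite !tm_codeK.
Qed.

Definition fm_enum (n : nat) : fm :=
  fm_decode (odflt (GenTree.Leaf 0) (unpickle n)).

Lemma fm_enum_surj A : exists n, fm_enum n = A.
Proof. by exists (pickle (fm_code A)); rewrite /fm_enum pickleK /= fm_codeK. Qed.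

(** * Weakening, substitution and Henkin witnesses in derivations *)

Section Derivations.
Variable T : fm -> Prop.

Lemma prf_weaken Gam Gam' A : prf T Gam A ->
  (forall B, List.In B Gam -> List.In B Gam') -> prf T Gam' A.
Proof.
move=> h; elim: h Gam' => {Gam A}.
- by move=> Gam A h Gam' _; apply: PrfAx.
- by move=> Gam A h Gam' s; apply/PrfHyp/s.
- by move=> Gam A B _ IHA _ IHB Gam' s; apply: PrfAndI; [apply: IHA | apply: IHB].
- by move=> Gam A B _ IH Gam' s; apply/PrfAndE1/IH.
- by move=> Gam A B _ IH Gam' s; apply/PrfAndE2/IH.
- by move=> Gam A B _ IH Gam' s; apply/PrfOrI1/IH.
- by move=> Gam A B _ IH Gam' s; apply/PrfOrI2/IH.
- move=> Gam A B C _ IH _ IHA _ IHB Gam' s; apply: PrfOrE (IH _ s) _ _.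
    by apply: IHA => D /= [->|/s]; [left | right].
  by apply: IHB => D /= [->|/s]; [left | right].
- move=> Gam A B _ IHA _ IHB Gam' s; apply: (@PrfNegI _ _ _ B).
    by apply: IHA => D /= [->|/s]; [left | right].
  by apply: IHB => D /= [->|/s]; [left | right].
- by move=> Gam A B _ IHA _ IHB Gam' s; apply: PrfNegE (IHA _ s) (IHB _ s).
- by move=> Gam A _ IH Gam' s; apply/PrfNegNeg/IH.
- move=> Gam A _ IH Gam' s; apply/PrfAllI/IH => B.
  by case/List.in_map_iff=> C [<- /s hC]; apply: List.in_map.
- by move=> Gam A t _ IH Gam' s; apply/PrfAllE/IH.
- by move=> Gam A t _ IH Gam' s; apply/(@PrfExI _ _ _ t)/IH.
- move=> Gam A B _ IHA _ IHB Gam' s; apply: PrfExE (IHA _ s) _.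
  apply: IHB => C /= [->|]; first by left.
  by case/List.in_map_iff=> D [<- /s hD]; right; apply: List.in_map.
- by move=> Gam t Gam' _; apply: PrfEqRefl.
- by move=> Gam A t u _ IHe _ IH Gam' s; apply: PrfEqSubst (IHe _ s) (IH _ s).
Qed.

(** Implication is not primitive, so the cut is an elimination of [Or A A]. *)
Lemma prf_cut Gam A B : prf T Gam A -> prf T (A :: Gam) B -> prf T Gam B.
Proof. by move=> hA hB; apply: (PrfOrE (PrfOrI1 A hA) hB hB). Qed.

Lemma iter_All_subst k s A :
  fm_subst s (iter k All A) = iter k All (fm_subst (iter k up s) A).
Proof. by elim: k s => //= k IH s; rewrite IH -iterSr. Qed.

Lemma iter_up_lt k s i : i < k -> iter k up s i = Var i.
Proof. by elim: k i => // k IH [|i] //=; rewrite ltnS => /IH ->. Qed.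

Lemma iter_up_ge k s i :
  iter k up s (k + i) = tm_subst (fun j => Var (k + j)) (s i).
Proof.
elim: k => [|k IH] /=; first exact: esym (tm_subst_Var _).
by rewrite IH /tm_shift tm_subst_comp.
Qed.

(** The outermost quantifier binds the highest index, so the terms are supplied from the highest one
    downwards; [iter_up_lt] and [iter_up_ge] describe how the remaining binders transform each
    instantiation. *)
Lemma prf_iter_AllE Gam k A s : prf T Gam (iter k All A) ->
  prf T Gam (fm_subst (fun i => if i < k then s i else Var (i - k)) A).
Proof.
elim: k A => [|k IH] A /=.
  move=> h; rewrite (_ : (fun i => _) = Var) ?fm_subst_Var //.
  by apply/funext => i; rewrite subn0.
move/(PrfAllE (s k)); rewrite /inst iter_All_subst => /IH.
rewrite fm_subst_comp; congr prf; congr fm_subst; apply/funext => i.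
have [lt_ik|] := ltnP i k; first by rewrite iter_up_lt //= lt_ik ltnW.
move=> le_ki; rewrite -(subnKC le_ki) iter_up_ge tm_subst_comp.
have -> : (fun i => tm_subst (fun i => if i < k then s i else Var (i - k))
                    (Var (k + i))) = Var.
  by apply/funext => j /=; rewrite ltnNge leq_addr /= addKn.
rewrite tm_subst_Var; case: (i - k) => [|j] //=.
  by rewrite addn0 ltnSn.
by rewrite addnS ltnNge ltnS leq_addr /= subSS addKn.
Qed.

(** [T] need not be closed under substitution, but a derivation without hypotheses can be
    generalised over all its variables and instantiated again. This settles the axiom case of
    [prf_subst]. *)
Lemma prf_subst_closed A s Gam : prf T [::] A -> prf T Gam (fm_subst s A).
Proof.
move=> h; have [n hn] := fm_vars_ex A.
apply: (@prf_weaken [::]) => //.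
rewrite (@fm_subst_ext n _ (fun i => if i < n then s i else Var (i - n))) //.
  by apply: prf_iter_AllE; elim: n {hn} => //= n IH; apply: PrfAllI.
by move=> i ->.
Qed.

Lemma prf_subst Gam A s : prf T Gam A ->
  prf T (map (fm_subst s) Gam) (fm_subst s A).
Proof.
have shiftE s' Gam' : map (fm_subst (up s')) (map fm_shift Gam') =
    map fm_shift (map (fm_subst s') Gam').
  by rewrite -!map_comp; apply: eq_map => B /=; rewrite fm_shift_up.
move=> h; elim: h s => {Gam A} /=.
- by move=> Gam A h s; apply/prf_subst_closed/PrfAx.
- by move=> Gam A h s; apply/PrfHyp/List.in_map.
- by move=> Gam A B _ IHA _ IHB s; apply: PrfAndI.
- by move=> Gam A B _ IH s; apply: PrfAndE1 (IH s).
- by move=> Gam A B _ IH s; apply: PrfAndE2 (IH s).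
- by move=> Gam A B _ IH s; apply: PrfOrI1.
- by move=> Gam A B _ IH s; apply: PrfOrI2.
- by move=> Gam A B C _ IH _ IHA _ IHB s; apply: PrfOrE (IH s) (IHA s) (IHB s).
- by move=> Gam A B _ IHA _ IHB s; apply: PrfNegI (IHA s) (IHB s).
- by move=> Gam A B _ IHA _ IHB s; apply: PrfNegE (IHA s) (IHB s).
- by move=> Gam A _ IH s; apply: PrfNegNeg (IH s).
- by move=> Gam A _ IH s; apply: PrfAllI; rewrite -shiftE.
- by move=> Gam A t _ IH s; rewrite inst_subst; apply: PrfAllE (IH s).
- by move=> Gam A t _ IH s; apply: (PrfExI (t := tm_subst s t)); rewrite -inst_subst.
- move=> Gam A B _ IHA _ IHB s; apply: PrfExE (IHA s) _.
  by rewrite -fm_shift_up -shiftE; apply: IHB.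
- by move=> Gam t s; apply: PrfEqRefl.
- move=> Gam A t u _ IHe _ IH s; rewrite inst_subst; apply: PrfEqSubst (IHe s) _.
  by rewrite -inst_subst.
Qed.

(** A closed formula, hence fixed by the shifts of the quantifier rules. *)
Definition Bot : fm := Neg (Eq Eps Eps).
Definition con (Gam : seq fm) : Prop := ~ prf T Gam Bot.

Lemma prf_NegI_Bot Gam A : prf T (A :: Gam) Bot -> prf T Gam (Neg A).
Proof. by apply: PrfNegI; apply: PrfEqRefl. Qed.

(** Henkin constants are free variables: a finite stage always leaves fresh ones. The renaming [s]
    sends [v] to 0 and shifts the others, which turns a contradiction from the instance at [v] into
    the minor premise of [PrfExE]. *)
Lemma con_witness Gam C v : List.In (Ex C) Gam ->
  (forall B, List.In B Gam -> fm_vars_lt v B) ->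
  con Gam -> con (inst C (Var v) :: Gam).
Proof.
move=> hC hv hcon h; apply: hcon; apply: (PrfExE (PrfHyp T hC)).
pose s i := if i == v then Var 0 else Var i.+1.
have := prf_subst s h; rewrite /= -/Bot.
have sE i : i < v -> s i = Var i.+1.
  by rewrite /s => lt_iv; rewrite ltn_eqF.
have -> : fm_subst s (inst C (Var v)) = C.
  rewrite inst_subst /= /s eqxx fm_subst_cons -[RHS]fm_subst_Var.
  by apply: (@fm_subst_ext v.+1) (hv _ hC) => -[|i] //= /sE.
suff -> : map (fm_subst s) Gam = map fm_shift Gam by [].
apply: List.map_ext_in => B /hv hB; exact: fm_subst_ext hB.
Qed.

Lemma fresh_ex (Gam : seq fm) :
  exists n, forall B, List.In B Gam -> fm_vars_lt n B.
Proof.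
elim: Gam => [|A Gam [n IH]]; first by exists 0.
have [m hm] := fm_vars_ex A; exists (maxn m n) => B /= [<-|/IH].
  exact: fm_vars_le (leq_maxl _ _) hm.
exact: fm_vars_le (leq_maxr _ _).
Qed.

(** The witness is added together with the formula, so one visit to each formula suffices. *)
Definition henkin (A : fm) (Gam : seq fm) : seq fm :=
  if A is Ex C then inst C (Var (projT1 (cid (fresh_ex (A :: Gam))))) :: A :: Gam
  else A :: Gam.

Definition extend (A : fm) (Gam : seq fm) : seq fm :=
  if pselect (con (A :: Gam)) then henkin A Gam else Gam.

Lemma con_extend A Gam : con Gam -> con (extend A Gam).
Proof.
rewrite /extend; case: pselect => // hA _; rewrite /henkin; case: A hA => //= C hC.
by case: cid => v hv; apply: con_witness => //=; left.
Qed.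

Lemma extend_sub A Gam B : List.In B Gam -> List.In B (extend A Gam).
Proof.
rewrite /extend /henkin; case: pselect => //= _ h.
by case: A => * /=; auto.
Qed.

(** * The complete theory with witnesses and its term model *)

Section Henkin.
Variable Gam0 : seq fm.
Hypothesis con0 : con Gam0.

Fixpoint stage (n : nat) : seq fm :=
  if n is m.+1 then extend (fm_enum m) (stage m) else Gam0.

Lemma stage_con n : con (stage n).
Proof. by elim: n => //= n IH; apply: con_extend. Qed.

Lemma stage_sub m n B : m <= n -> List.In B (stage m) -> List.In B (stage n).
Proof.
move=> le_mn hB; rewrite -(subnK le_mn).
by elim: (n - m) => //= k IH; apply: extend_sub.
Qed.

(** Derivability from some stage, not membership: closure under the rules is then immediate once
    derivations are moved to a common stage. *)
Definition th (A : fm) : Prop := exists n, prf T (stage n) A.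

Lemma th_lift2 A B C : (forall n, prf T (stage n) A -> prf T (stage n) B ->
  prf T (stage n) C) -> th A -> th B -> th C.
Proof.
move=> h [m hA] [n hB]; exists (maxn m n); apply: h.
  by apply: (prf_weaken hA) => D; apply: stage_sub (leq_maxl _ _).
by apply: (prf_weaken hB) => D; apply: stage_sub (leq_maxr _ _).
Qed.

Lemma th_lift A C : (forall n, prf T (stage n) A -> prf T (stage n) C) ->
  th A -> th C.
Proof. by move=> h [n /h hC]; exists n. Qed.

Lemma th_consistent A : th A -> th (Neg A) -> False.
Proof.
move=> hA hB; suff [n] : th Bot by apply: stage_con.
by move: hA hB; apply: th_lift2 => n; apply: PrfNegE.
Qed.

Lemma th_complete A : th A \/ th (Neg A).
Proof.
have [n hn] := fm_enum_surj A.
have [h|h] := pselect (con (A :: stage n)); last first.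
  by right; exists n; apply: prf_NegI_Bot; apply: contrapT.
left; exists n.+1; apply: PrfHyp; rewrite /= hn /extend.
by rewrite /henkin; case: pselect => //= _; case: A {hn h} => * /=; auto.
Qed.

Lemma th_Neg A : th (Neg A) <-> ~ th A.
Proof.
split=> [hN hA|]; first exact: th_consistent hA hN.
by case: (th_complete A).
Qed.

Lemma th_And A B : th (And A B) <-> th A /\ th B.
Proof.
split=> [h|[]]; last by apply: th_lift2 => n; apply: PrfAndI.
by split; move: h; apply: th_lift => n; [apply: PrfAndE1 | apply: PrfAndE2].
Qed.

Lemma th_Or A B : th (Or A B) <-> th A \/ th B.
Proof.
split=> [h|[]]; last 2 first.
- by apply: th_lift => n; apply: PrfOrI1.
- by apply: th_lift => n; apply: PrfOrI2.
have [hA|/th_Neg hA] := pselect (th A); first by left.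
right; move: h hA; apply: th_lift2 => n h hA; apply: PrfOrE h _ _.
  apply: (@PrfNegE _ _ A); first by apply: PrfHyp; left.
  by apply: (prf_weaken hA) => D; right.
by apply: PrfHyp; left.
Qed.

Lemma th_Ex C : th (Ex C) <-> exists t, th (inst C t).
Proof.
split=> [[m hm]|[t]]; last by apply: th_lift => n; apply: PrfExI.
have [n hn] := fm_enum_surj (Ex C).
(* The enumeration may reach [Ex C] before it is derivable. It was accepted all the same, since a
   rejection would make a later stage inconsistent. *)
have hcon : con (Ex C :: stage n).
  move=> h; apply: (@stage_con (maxn m n)); apply: (@prf_cut _ (Ex C)).
    by apply: (prf_weaken hm) => D; apply: stage_sub (leq_maxl _ _).
  apply: (prf_weaken h) => D [->|hD]; [by left | right].
  exact: stage_sub (leq_maxr _ _) hD.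
exists (Var (projT1 (cid (fresh_ex (Ex C :: stage n))))); exists n.+1.
by apply: PrfHyp; rewrite /= hn /extend; case: pselect => //= _; left.
Qed.

(** Stages provide witnesses for existential formulas only, so a missing universal formula is first
    turned classically into [Ex (Neg C)]. *)
Lemma th_All C : th (All C) <-> forall t, th (inst C t).
Proof.
split=> [h t|h]; first by move: h; apply: th_lift => n; apply: PrfAllE.
apply: contrapT => /th_Neg hN.
suff /th_Ex[t] : th (Ex (Neg C)) by apply: (th_consistent (h t)).
move: hN; apply: th_lift => n hn; apply: PrfNegNeg.
apply: (@PrfNegI _ _ _ (All C)); last by apply: (prf_weaken hn) => D; right.
apply: PrfAllI; apply: PrfNegNeg; apply: (@PrfNegI _ _ _ (fm_shift (Ex (Neg C)))).
  apply: (PrfExI (t := Var 0)).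
  have E : inst (fm_subst (up (fun i => Var i.+1)) C) (Var 0) = C.
    rewrite fm_subst_cons -[RHS]fm_subst_Var; congr fm_subst.
    by apply/funext => -[].
  change (prf T (Neg C :: [seq fm_shift i | i <- Neg (Ex (Neg C)) :: stage n])
    (Neg (inst (fm_subst (up (fun i => Var i.+1)) C) (Var 0)))).
  by rewrite E; apply: PrfHyp; left.
by apply: PrfHyp; right; left.
Qed.

(** The Leibniz rule replaces one variable at a time, so it is applied twice. Symmetry, transitivity
    and all congruences come from suitable choices of [A]. *)
Lemma th_congr2 A t t' u u' : th (Eq t t') -> th (Eq u u') ->
  th (fm_subst (econs t (econs u Var)) A) -> th (fm_subst (econs t' (econs u' Var)) A).
Proof.
move=> ht hu h.
have shK x v : tm_subst (fun i => if i is j.+1 then Var j else v) (tm_shift x) = x.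
  by rewrite /tm_shift tm_subst_comp /= tm_subst_Var.
have {}h : th (fm_subst (econs t' (econs u Var)) A).
  pose B := fm_subst (econs (Var 0) (econs (tm_shift u) (fun i => Var i.+1))) A.
  have BE x : inst B x = fm_subst (econs x (econs u Var)) A.
    rewrite /inst fm_subst_comp; congr fm_subst; apply/funext => -[|[|i]] //=.
  by move: ht h; rewrite -!BE; apply: th_lift2 => n; apply: PrfEqSubst.
pose B := fm_subst (econs (tm_shift t') (econs (Var 0) (fun i => Var i.+1))) A.
have BE x : inst B x = fm_subst (econs t' (econs x Var)) A.
  rewrite /inst fm_subst_comp; congr fm_subst; apply/funext => -[|[|i]] //=.
by move: hu h; rewrite -!BE; apply: th_lift2 => n; apply: PrfEqSubst.
Qed.

Lemma th_refl t : th (Eq t t).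
Proof. by exists 0; apply: PrfEqRefl. Qed.

Let sh2K t u v : tm_subst (econs t (econs u Var)) (tm_shift (tm_shift v)) = v.
Proof. by rewrite /tm_shift !tm_subst_comp /= tm_subst_Var. Qed.

Lemma th_sym t u : th (Eq t u) -> th (Eq u t).
Proof.
move=> h; have := @th_congr2 (Eq (Var 0) (tm_shift (tm_shift t))) _ _ _ _ h h.
by rewrite /= !sh2K; apply; apply: th_refl.
Qed.

Lemma th_trans t u v : th (Eq t u) -> th (Eq u v) -> th (Eq t v).
Proof.
move=> h k; have := @th_congr2 (Eq (tm_shift (tm_shift t)) (Var 0)) _ _ _ _ k k.
by rewrite /= !sh2K; apply.
Qed.

Lemma th_Cat t t' u u' : th (Eq t t') -> th (Eq u u') ->
  th (Eq (Cat t u) (Cat t' u')).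
Proof.
move=> h k; have := @th_congr2 (Eq (Cat (tm_shift (tm_shift t))
  (tm_shift (tm_shift u))) (Cat (Var 0) (Var 1))) _ _ _ _ h k.
by rewrite /= !sh2K; apply; apply: th_refl.
Qed.

Lemma th_Rep t t' u u' : th (Eq t t') -> th (Eq u u') ->
  th (Eq (Rep t u) (Rep t' u')).
Proof.
move=> h k; have := @th_congr2 (Eq (Rep (tm_shift (tm_shift t))
  (tm_shift (tm_shift u))) (Rep (Var 0) (Var 1))) _ _ _ _ h k.
by rewrite /= !sh2K; apply; apply: th_refl.
Qed.

Definition th_eq t u := th (Eq t u).
Local Notation q := (cls th_eq).

Definition term_model : structure :=
  @Structure (quot th_eq) (q Eps) (fun b => q (Bit b))
    (fun x y => q (Cat (qrep x) (qrep y))) (fun x y => q (Rep (qrep x) (qrep y)))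
    (fun x y => th (Pre (qrep x) (qrep y))) (fun x => th (Flip (qrep x))).

Let qP t u : q t = q u <-> th (Eq t u).
Proof. exact: (clsP th_refl th_sym th_trans). Qed.

Let q_qrep t : th (Eq (qrep (q t)) t).
Proof. exact: (R_qrep th_refl th_sym th_trans). Qed.

Lemma teval_term_model s t : @teval term_model (q \o s) t = q (tm_subst s t).
Proof.
elim: t => //= u -> v ->; apply/qP; first by apply: th_Cat; apply: q_qrep.
by apply: th_Rep; apply: q_qrep.
Qed.

(** Truth lemma. Every valuation is the class of a substitution, so the induction can run over
    substitutions. *)
Lemma msat_term_model s A : @msat term_model (q \o s) A <-> th (fm_subst s A).
Proof.
have q_econs x s' : econs (q x) (q \o s') = q \o econs x s' by apply/funext => -[].
elim: A s => /=.
- move=> t s; rewrite teval_term_model.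
  have e := q_qrep (tm_subst s t); have e' := th_sym e.
  split; first exact: (@th_congr2 (Flip (Var 0)) _ _ _ _ e e).
  exact: (@th_congr2 (Flip (Var 0)) _ _ _ _ e' e').
- by move=> t u s; rewrite !teval_term_model; apply: qP.
- move=> t u s; rewrite !teval_term_model.
  have e := q_qrep (tm_subst s t); have e' := th_sym e.
  have k := q_qrep (tm_subst s u); have k' := th_sym k.
  split; first exact: (@th_congr2 (Pre (Var 0) (Var 1)) _ _ _ _ e k).
  exact: (@th_congr2 (Pre (Var 0) (Var 1)) _ _ _ _ e' k').
- by move=> B IH s; rewrite th_Neg; split=> h /IH.
- by move=> B IHB C IHC s; rewrite th_And IHB IHC.
- by move=> B IHB C IHC s; rewrite th_Or IHB IHC.
- move=> B IH s; rewrite th_Ex; split=> [[x hx]|[t]].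
    exists (qrep x); rewrite fm_subst_cons -IH -q_econs.
    by rewrite (qrepK x).
  by rewrite fm_subst_cons -IH -q_econs; exists (q t).
- move=> B IH s; rewrite th_All; split=> [h t|h x].
    by rewrite fm_subst_cons -IH -q_econs; apply: h.
  by have := h (qrep x); rewrite fm_subst_cons -IH -q_econs (qrepK x).
Qed.

Lemma term_model_is_model : is_model T term_model.
Proof.
move=> A rho hA; have -> : rho = q \o (fun i => qrep (rho i)).
  by apply/funext => i /=; rewrite qrepK.
by apply/msat_term_model; exists 0; apply: prf_subst_closed; apply: PrfAx.
Qed.

End Henkin.

Theorem completeness A :
  (forall (M : structure) (rho : nat -> M), is_model T M -> msat rho A) ->
  prf T [::] A.
Proof.
move=> h; apply: PrfNegNeg; apply: prf_NegI_Bot; apply: contrapT => hcon.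
have := h (term_model [:: Neg A]) (cls (th_eq [:: Neg A]) \o Var) (@term_model_is_model
  [:: Neg A] hcon).
rewrite (msat_term_model hcon) fm_subst_Var => hA.
by apply: (th_consistent hcon hA); exists 0; apply: PrfHyp; left.
Qed.

End Derivations.

(** * Definability, uniformly in all structures *)

Definition len (M : structure) (x : M) : M := s_rep (s_bit M true) x.
Definition prec (M : structure) (x y : M) : Prop := s_pre (len x) (len y).
Definition subw (M : structure) (x t : M) : Prop :=
  exists w, s_pre w t /\ s_pre (s_cat w x) t.

(** Formulas are presented semantically, as properties stated uniformly for all structures;
    [definable] then finds the syntax, and de Bruijn indices need not be written by hand. *)
Definition term_def (f : forall M : structure, (nat -> M) -> M) : Prop :=
  exists t, forall M rho, f M rho = teval rho t.

Definition subword_def (P : forall M : structure, (nat -> M) -> Prop) : Prop :=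
  exists A, subword_only A /\ forall M rho, P M rho = msat rho A.

Definition sigma_def (P : forall M : structure, (nat -> M) -> Prop) : Prop :=
  exists A, sigma1b A /\ forall M rho, P M rho = msat rho A.

Lemma term_def_var i : term_def (fun M r => r i).
Proof. by exists (Var i). Qed.

Lemma term_def_eps : term_def (fun M r => s_eps M).
Proof. by exists Eps. Qed.

Lemma term_def_bit b : term_def (fun M r => s_bit M b).
Proof. by exists (Bit b). Qed.

Lemma term_def_cat f g : term_def f -> term_def g ->
  term_def (fun M r => s_cat (f M r) (g M r)).
Proof. by case=> t ht [u hu]; exists (Cat t u) => M r /=; rewrite ht hu. Qed.

Lemma term_def_rep f g : term_def f -> term_def g ->
  term_def (fun M r => s_rep (f M r) (g M r)).
Proof. by case=> t ht [u hu]; exists (Rep t u) => M r /=; rewrite ht hu. Qed.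

Lemma term_def_len f : term_def f -> term_def (fun M r => len (f M r)).
Proof. by case=> t ht; exists (Ones t) => M r /=; rewrite ht. Qed.

Lemma term_def_teval t s : (forall i, term_def (s i)) ->
  term_def (fun M r => teval (fun i => s i M r) t).
Proof.
case/choice=> s' hs; exists (tm_subst s' t) => M r; rewrite teval_subst.
by congr teval; apply/funext => i.
Qed.

Lemma term_def_econs x (e : forall M : structure, (nat -> M) -> nat ->
  M) : term_def x ->
  (forall i, term_def (fun M r => e M r i)) ->
    forall i, term_def (fun M r => econs (x M r) (e M r) i).
Proof. by move=> hx he [|i]; [exact: hx | exact: (he i)]. Qed.

Lemma subword_def_eq f g : term_def f -> term_def g ->
  subword_def (fun M r => f M r = g M r).
Proof.
case=> t ht [u hu]; exists (Eq t u); split; first by constructor.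
by move=> M r /=; rewrite ht hu.
Qed.

Lemma subword_def_pre f g : term_def f -> term_def g ->
  subword_def (fun M r => s_pre (f M r) (g M r)).
Proof.
case=> t ht [u hu]; exists (Pre t u); split; first by constructor.
by move=> M r /=; rewrite ht hu.
Qed.

Lemma subword_def_prec f g : term_def f -> term_def g ->
  subword_def (fun M r => prec (f M r) (g M r)).
Proof. by move=> hf hg; apply: subword_def_pre; apply: term_def_len. Qed.

Lemma subword_def_flip f : term_def f -> subword_def (fun M r => s_flip (f M r)).
Proof.
case=> t ht; exists (Flip t); split; first by constructor.
by move=> M r /=; rewrite ht.
Qed.

Lemma subword_def_not P : subword_def P -> subword_def (fun M r => ~ P M r).
Proof.
case=> A [hA e]; exists (Neg A); split; first by constructor.
by move=> M r /=; rewrite e.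
Qed.

Lemma subword_def_and P Q : subword_def P -> subword_def Q ->
  subword_def (fun M r => P M r /\ Q M r).
Proof.
case=> A [hA e] [B [hB e']]; exists (And A B); split; first by constructor.
by move=> M r /=; rewrite e e'.
Qed.

Lemma subword_def_or P Q : subword_def P -> subword_def Q ->
  subword_def (fun M r => P M r \/ Q M r).
Proof.
case=> A [hA e] [B [hB e']]; exists (Or A B); split; first by constructor.
by move=> M r /=; rewrite e e'.
Qed.

Lemma subword_def_imp P Q : subword_def P -> subword_def Q ->
  subword_def (fun M r => P M r -> Q M r).
Proof.
case=> A [hA e] [B [hB e']]; exists (Imp A B); split; first by do ?constructor.
by move=> M r /=; rewrite e e'; apply/propext; rewrite implyE.
Qed.

Lemma msat_ExSub (M : structure) (r : nat -> M) t A :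
  msat r (ExSub t A) = (exists x, subw x (teval r t) /\ msat (econs x r) A).
Proof.
rewrite /ExSub /=; apply: eq_exists => x; apply/propext; split=> [[w]|[[w h] k]].
  by rewrite !teval_shift msat_shift => -[h k]; split=> //; exists w.
by exists w; rewrite !teval_shift msat_shift.
Qed.

Lemma msat_AllSub (M : structure) (r : nat -> M) t A :
  msat r (AllSub t A) = (forall x, subw x (teval r t) -> msat (econs x r) A).
Proof.
rewrite /AllSub /=; apply: eq_forall => x; apply/propext; rewrite -implyE /subw;
  split=> h [w hw].
  by apply: h; exists w; rewrite !teval_shift.
by apply: h; exists w; rewrite !teval_shift in hw.
Qed.

Lemma subword_def_ex t (P : forall M : structure, (nat -> M) -> M ->
  Prop) : term_def t ->
  subword_def (fun M r => P M (fun i => r i.+1) (r 0)) ->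
  subword_def (fun M r => exists x, subw x (t M r) /\ P M r x).
Proof.
case=> u hu [A [hA e]]; exists (ExSub u A); split; first by constructor.
by move=> M r; rewrite msat_ExSub hu; apply: eq_exists => x; rewrite -e.
Qed.

Lemma subword_def_all t (P : forall M : structure, (nat -> M) -> M ->
  Prop) : term_def t ->
  subword_def (fun M r => P M (fun i => r i.+1) (r 0)) ->
  subword_def (fun M r => forall x, subw x (t M r) -> P M r x).
Proof.
case=> u hu [A [hA e]]; exists (AllSub u A); split; first by constructor.
by move=> M r; rewrite msat_AllSub hu; apply: eq_forall => x; rewrite -e.
Qed.

Lemma subword_def_sub (P : forall M : structure, (nat -> M) -> Prop)
    (s : nat -> forall M : structure, (nat -> M) -> M) :
  subword_def P -> (forall i, term_def (s i)) ->
    subword_def (fun M r => P M (fun i => s i M r)).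
Proof.
case=> A [hA e] /choice[s' hs]; exists (fm_subst s' A).
split; first exact: subword_only_subst.
move=> M r; rewrite e msat_subst; congr msat.
by apply/funext => i; rewrite hs.
Qed.

Lemma sigma_def_base P : subword_def P -> sigma_def P.
Proof. by case=> A [hA e]; exists A; split=> //; constructor. Qed.

Lemma sigma_def_ex t (P : forall M : structure, (nat -> M) -> M -> Prop) : term_def t ->
  sigma_def (fun M r => P M (fun i => r i.+1) (r 0)) ->
  sigma_def (fun M r => exists x, prec x (t M r) /\ P M r x).
Proof.
case=> u hu [A [hA e]]; exists (ExB u A); split; first by constructor.
move=> M r; rewrite /ExB /=; apply: eq_exists => x; rewrite -e teval_shift -hu.
by [].
Qed.

(** Substitution into an abstract graph [A], whose arguments are an environment, a witness and a
    value: the shape of all representing formulas below. *)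
Lemma subword_def_app (A : forall M : structure, (nat -> M) -> M -> M -> Prop) w y
    (s : nat -> forall M : structure, (nat -> M) -> M) :
  subword_def (fun M r => A M (fun i => r i.+2) (r 0) (r 1)) -> term_def w ->
    term_def y ->
  (forall i, term_def (s i)) ->
  subword_def (fun M r => A M (fun i => s i M r) (w M r) (y M r)).
Proof.
move=> hA hw hy hs.
pose s' i : forall M : structure, (nat -> M) -> M :=
  match i with 0 => w | 1 => y | j.+2 => s j end.
apply: (@subword_def_sub (fun M r => A M (fun i => r i.+2) (r 0) (r 1)) s') => //.
by move=> [|[|i]]; [exact: hw | exact: hy | exact: (hs i)].
Qed.

(** Hypotheses about abstract graphs enter through [subword_def_app]; the guard keeps that rule away
    from goals about terms. *)
Ltac def_step := cbn beta; first
  [ assumption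
  | match goal with |- term_def _ => fail 1 | _ => idtac end;
    apply: subword_def_app; [eassumption | | | move=> ?] | apply: sigma_def_ex | apply:
      sigma_def_base
  | apply: subword_def_and | apply: subword_def_or | apply: subword_def_not
  | apply: subword_def_eq | apply: subword_def_pre | apply: subword_def_prec | apply:
    subword_def_flip
  | apply: subword_def_ex | apply: subword_def_all | apply: subword_def_imp
  | apply: term_def_var | apply: term_def_eps | apply: term_def_bit
  | apply: term_def_cat | apply: term_def_rep | apply: term_def_len
  | apply: term_def_econs; [ | move=> ?] | apply: term_def_teval => ? ].

Ltac definable := repeat def_step.

(** * Arithmetic in models of RSigma^b_1-NIA *)

Section Arithmetic.
Variables (M : structure) (hM : is_model RS1bNIA M).

Local Notation "x ** y" := (s_cat x y) (at level 40, left associativity).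
Local Notation "x %* y" := (s_rep x y) (at level 39, left associativity).
Local Notation "x [= y" := (s_pre x y) (at level 70).
Local Notation e := (s_eps M).
Local Notation bt := (s_bit M).

Let ev x y : nat -> M := econs x (econs y (fun _ => e)).

Lemma s_cat_e (x : M) : x ** e = x.
Proof. exact: (hM (ev x x) AxCatEps). Qed.
Lemma s_cat_b (x y : M) b : x ** (y ** bt b) = x ** y ** bt b.
Proof. exact: (hM (ev x y) (AxCatBit b)). Qed.
Lemma rep_e (x : M) : x %* e = e.
Proof. exact: (hM (ev x x) AxRepEps). Qed.
Lemma rep_b (x y : M) b : x %* (y ** bt b) = x %* y ** x.
Proof. exact: (hM (ev x y) (AxRepBit b)). Qed.
Lemma pre_e (x : M) : x [= e <-> x = e.
Proof.
by have [] := hM (ev x x) AxPreEps; rewrite /= -!implyE; split.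
Qed.
Lemma pre_b (x y : M) b : x [= y ** bt b <-> x [= y \/ x = y ** bt b.
Proof.
by have [] := hM (ev x y) (AxPreBit b); rewrite /= -!implyE; split.
Qed.
Lemma bit_inj (x y : M) b : x ** bt b = y ** bt b -> x = y.
Proof. by have := hM (ev x y) (AxBitInj b); rewrite /= -!implyE. Qed.
Lemma bit_neq (x y : M) : x ** bt false <> y ** bt true.
Proof. exact: (hM (ev x y) AxBitNeq). Qed.
Lemma bit_neq_e (x : M) b : x ** bt b <> e.
Proof. exact: (hM (ev x x) (AxBitNeqEps b)). Qed.

Lemma bit_inj2 (x y : M) b c : x ** bt b = y ** bt c -> b = c /\ x = y.
Proof.
case: b c => [] [] => [/bit_inj//|h|/bit_neq//|/bit_inj//].
by case: (@bit_neq y x).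
Qed.

(** [rho] carries the parameters. Since [P] must be [sigma_def], each induction below has to put its
    quantifiers into bounded or subword form. *)
Lemma sg_ind P (rho : nat -> M) : sigma_def P -> P M (econs e rho) ->
  (forall x, P M (econs x rho) -> forall b, P M (econs (x ** bt b) rho)) ->
  forall x, P M (econs x rho).
Proof.
case=> A [hA eA] h0 hs x; rewrite eA.
have := hM rho (AxInd hA); rewrite /= -!implyE; apply; split.
  by rewrite msat_inst -eA.
have atE y b : msat (econs y rho) (at_succ A b) = msat (econs (y ** bt b) rho) A.
  by rewrite msat_subst; congr msat; apply/funext => -[].
by move=> y; rewrite -implyE !atE -!eA => /hs h; split; apply: h.
Qed.

Lemma ind3 (P : forall M : structure, M -> M -> M -> M -> Prop) p q r :
  sigma_def (fun M s => P M (s 0) (s 1) (s 2) (s 3)) -> P M e p q r ->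
  (forall x, P M x p q r -> forall b, P M (x ** bt b) p q r) ->
  forall x, P M x p q r.
Proof. exact: (sg_ind (rho := econs p (econs q (econs r (fun=> e))))). Qed.

Lemma s_catA (x y z : M) : x ** (y ** z) = x ** y ** z.
Proof.
move: z; refine (@ind3 (fun M (z x y _ : M) =>
  s_cat x (s_cat y z) = s_cat (s_cat x y) z) x y e _ _ _).
- by definable.
- by rewrite !s_cat_e.
- by move=> z h b; rewrite !s_cat_b h.
Qed.

Lemma e_cat (x : M) : e ** x = x.
Proof.
move: x; refine (@ind3 (fun M (x _ _ _ : M) => s_cat (s_eps M) x = x) e e e _ _ _).
- by definable.
- by rewrite !s_cat_e.
- by move=> z h b; rewrite !s_cat_b h.
Qed.

Lemma pre_refl (x : M) : x [= x.
Proof.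
move: x; refine (@ind3 (fun M (x _ _ _ : M) => s_pre x x) e e e _ _ _).
- by definable.
- exact/pre_e.
- by move=> z h b; apply/pre_b; right.
Qed.

Lemma pre_cat (x y : M) : x [= x ** y.
Proof.
move: y; refine (@ind3 (fun M (y x _ _ : M) => s_pre x (s_cat x y)) x e e _ _ _).
- by definable.
- by rewrite s_cat_e; apply: pre_refl.
- by move=> z h b; rewrite s_cat_b; apply/pre_b; left.
Qed.

Lemma preP (x y : M) : x [= y <-> exists z, y = x ** z.
Proof.
split=> [|[z ->]]; last exact: pre_cat.
(* The remainder [z] is a subword of [y]; saying so makes the statement admissible for induction. *)
suff h : x [= y -> exists z, subw z y /\ y = x ** z by move/h=> [z [_ ?]]; exists z.
move: y; refine (@ind3 (fun M (y x _ _ : M) => s_pre x y ->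
  exists z, subw z y /\ y = s_cat x z) x e e _ _ _).
- by definable.
- move/pre_e->; exists e; split; last by rewrite s_cat_e.
  by exists e; rewrite s_cat_e; split; apply: pre_refl.
- move=> y IH b /pre_b[/IH[z [_ ->]]|->].
    exists (z ** bt b); rewrite s_cat_b; split=> //.
    by exists x; rewrite s_cat_b -{1}s_cat_b; split; [apply: pre_cat | apply: pre_refl].
  exists e; rewrite s_cat_e; split=> //.
  by exists (y ** bt b); rewrite s_cat_e; split; apply: pre_refl.
Qed.

Lemma pre_trans (x y z : M) : x [= y -> y [= z -> x [= z.
Proof. by move=> /preP[u ->] /preP[v ->]; apply/preP; exists (u ** v);
  rewrite s_catA. Qed.

Lemma casesP (x : M) : x = e \/ exists y b, x = y ** bt b.
Proof.
suff : x = e \/ exists y, subw y x /\ (x = y ** bt false \/ x = y ** bt true).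
  by case; [left | move=> [y [_ [->|->]]]; right; exists y;
    [exists false | exists true]].
move: x; refine (@ind3 (fun M (x _ _ _ : M) => x = s_eps M \/ exists y, subw y x /\
  (x = s_cat y (s_bit M false) \/ x = s_cat y (s_bit M true))) e e e _ _ _).
- by definable.
- by left.
- move=> x _ b; right; exists x; split; last by case: b; auto.
  exists e; rewrite e_cat; split; last by apply: pre_cat.
  by apply/preP; exists (x ** bt b); rewrite e_cat.
Qed.

Lemma e_pre (x : M) : e [= x.
Proof. by apply/preP; exists x; rewrite e_cat. Qed.

Lemma pre_strict (x : M) b : ~ x ** bt b [= x.
Proof.
(* Both bits go together: at [x ** bt b] the claim for each next bit rests on the hypothesis for
   [b], which is arbitrary. *)
suff: ~ x ** bt false [= x /\ ~ x ** bt true [= x by case: b => -[].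
move: x {b}; refine (@ind3 (fun M (x _ _ _ : M) =>
  ~ s_pre (s_cat x (s_bit M false)) x /\
  ~ s_pre (s_cat x (s_bit M true)) x) e e e _ _ _).
- by definable.
- by split=> /pre_e /bit_neq_e.
- move=> x [h0 h1] b.
  have hb : ~ x ** bt b [= x by case: b.
  suff hc c : ~ x ** bt b ** bt c [= x ** bt b by [].
  move=> /pre_b[h|/bit_inj2[_ h]].
    by apply: hb; apply: pre_trans h; apply: pre_cat.
  by apply: hb; rewrite h; apply: pre_refl.
Qed.

Lemma cat_idr (x u : M) : x ** u = x -> u = e.
Proof.
case: (casesP u) => [//|[v [b ->]]]; rewrite s_cat_b => h.
by case: (@pre_strict (x ** v) b); rewrite h; apply: pre_cat.
Qed.

Lemma cat_eq_e (x y : M) : x ** y = e -> x = e /\ y = e.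
Proof.
case: (casesP y) => [->|[z [b ->]]]; first by rewrite s_cat_e.
by rewrite s_cat_b => /bit_neq_e.
Qed.

Lemma subw_refl (x : M) : subw x x.
Proof. by exists e; rewrite e_cat; split; [apply: e_pre | apply: pre_refl]. Qed.

Lemma subw_pre (u x t : M) : u ** x [= t -> subw x t.
Proof. by move=> h; exists u; split=> //; apply: pre_trans h; apply: pre_cat. Qed.

Lemma pre_subw (x t : M) : x [= t -> subw x t.
Proof. by move=> h; apply: (@subw_pre e); rewrite e_cat. Qed.

Lemma subw_trans (x t t' : M) : subw x t -> t [= t' -> subw x t'.
Proof. by move=> [w [_ h]] k; apply: subw_pre (pre_trans h k). Qed.

Lemma subw_catl (x t : M) : subw x (x ** t).
Proof. by apply: pre_subw; apply: pre_cat. Qed.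

Lemma subw_catr (x t : M) : subw x (t ** x).
Proof. by apply: (@subw_pre t); apply: pre_refl. Qed.

Lemma cancel_cat (x y z : M) : x ** y = x ** z -> y = z.
Proof.
(* The induction on [y] needs [z] universally quantified, so [z] is confined to subwords of a
   parameter [p]. These are closed under removal of the last bit. *)
suff h p : forall z, subw z p -> x ** y = x ** z -> y = z by apply: h (subw_refl z).
move: y {z}; refine (@ind3 (fun M (y x p _ : M) => forall z, subw z p ->
  s_cat x y = s_cat x z -> y = z) x p e _ _ _).
- by definable.
- by move=> z _; rewrite s_cat_e => /esym/cat_idr.
- move=> y IH b z; case: (casesP z) => [->|[z' [c ->]]] hz.
    rewrite s_cat_e => h; have := @cat_idr x (y ** bt b) h.
    by move/bit_neq_e.
  rewrite !s_cat_b => /bit_inj2[-> h]; congr (_ ** _); apply: IH h.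
  case: hz => w [_]; rewrite s_cat_b => h; apply: subw_pre (pre_trans _ h).
  exact: pre_cat.
Qed.

Lemma pre_total (u v w : M) : u [= w -> v [= w -> u [= v \/ v [= u.
Proof.
move: w; refine (@ind3 (fun M (w u v _ : M) => s_pre u w -> s_pre v w ->
  s_pre u v \/ s_pre v u) u v e _ _ _).
- by definable.
- by move/pre_e-> => /pre_e->; left; apply: pre_refl.
- move=> w IH b hu hv; case/pre_b: (hu) => [hu'|eu]; last by right; rewrite eu.
  by case/pre_b: (hv) => [/(IH hu')//|ev']; left; rewrite ev'.
Qed.

Lemma pre_antisym (u v : M) : u [= v -> v [= u -> u = v.
Proof.
move=> /preP[z ->] /preP[k]; rewrite -s_catA => /esym/cat_idr/cat_eq_e[-> _].
by rewrite s_cat_e.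
Qed.

Lemma len_e : len e = e.
Proof. exact: rep_e. Qed.

Lemma len_b (x : M) b : len (x ** bt b) = len x ** bt true.
Proof. exact: rep_b. Qed.

Lemma len_cat (x y : M) : len (x ** y) = len x ** len y.
Proof.
move: y; refine (@ind3 (fun M (y x _ _ : M) =>
  len (s_cat x y) = s_cat (len x) (len y)) x e e _ _ _).
- by definable.
- by rewrite len_e !s_cat_e.
- by move=> y h b; rewrite s_cat_b !len_b h s_cat_b.
Qed.

Lemma len_len (x : M) : len (len x) = len x.
Proof.
move: x; refine (@ind3 (fun M (x _ _ _ : M) => len (len x) = len x) e e e _ _ _).
- by definable.
- by rewrite !len_e.
- by move=> y h b; rewrite !len_b h.
Qed.

Lemma len_comm (x y : M) : len x ** len y = len y ** len x.
Proof.
have one z : bt true ** len z = len z ** bt true.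
  move: z; refine (@ind3 (fun M (z _ _ _ : M) =>
    s_cat (s_bit M true) (len z) = s_cat (len z) (s_bit M true)) e e e _ _ _).
  - by definable.
  - by rewrite len_e s_cat_e e_cat.
  - by move=> z h b; rewrite len_b s_cat_b h.
move: y; refine (@ind3 (fun M (y x _ _ : M) =>
  s_cat (len x) (len y) = s_cat (len y) (len x)) x e e _ _ _).
- by definable.
- by rewrite len_e s_cat_e e_cat.
- by move=> y h b; rewrite len_b s_cat_b h -s_catA -one s_catA.
Qed.

Lemma pre_prec (x y : M) : x [= y -> prec x y.
Proof. by move=> /preP[z ->]; rewrite /prec len_cat; apply: pre_cat. Qed.

Lemma prec_refl (x : M) : prec x x.
Proof. exact: pre_refl. Qed.

Lemma prec_trans (x y z : M) : prec x y -> prec y z -> prec x z.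
Proof. exact: pre_trans. Qed.

Lemma prec_e (x : M) : prec e x.
Proof. by rewrite /prec len_e; apply: e_pre. Qed.

Lemma prec_total (x y : M) : prec x y \/ prec y x.
Proof.
apply: (@pre_total _ _ (len x ** len y)); first exact: pre_cat.
by rewrite len_comm; apply: pre_cat.
Qed.

(** The remainder of one length after another is itself a length: take [len] of both sides and
    cancel. *)
Lemma precP (x y : M) : prec x y <-> exists k, len y = len x ** len k.
Proof.
split=> [/preP[k hk]|[k hk]]; last by rewrite /prec hk; apply: pre_cat.
exists k; rewrite hk; congr (_ ** _).
have := congr1 (@len M) hk; rewrite len_cat !len_len hk.
exact: cancel_cat.
Qed.

Lemma prec_cat (x x' y y' : M) : prec x x' -> prec y y' -> prec (x ** y) (x' ** y').
Proof.
move=> /precP[k hk] /precP[l hl]; apply/precP; exists (k ** l).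
by rewrite !len_cat hk hl -!s_catA; congr (_ ** _); rewrite !s_catA (len_comm k).
Qed.

Lemma prec_catl (x y : M) : prec x (x ** y).
Proof. by apply: pre_prec; apply: pre_cat. Qed.

Lemma prec_catr (x y : M) : prec y (x ** y).
Proof. by rewrite -{1}[y]e_cat; apply: prec_cat;
  [apply: prec_e | apply: prec_refl]. Qed.

Lemma prec_cat_l (x y z : M) : prec x y -> prec x (y ** z).
Proof. by move=> h; apply: prec_trans h (prec_catl _ _). Qed.

Lemma prec_cat_r (x y z : M) : prec x z -> prec x (y ** z).
Proof. by move=> h; apply: prec_trans h (prec_catr _ _). Qed.

Lemma rep_cat (c x y : M) : c %* (x ** y) = c %* x ** c %* y.
Proof.
move: y; refine (@ind3 (fun M (y c x _ : M) =>
  s_rep c (s_cat x y) = s_cat (s_rep c x) (s_rep c y)) c x e _ _ _).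
- by definable.
- by rewrite rep_e !s_cat_e.
- by move=> y h b; rewrite s_cat_b !rep_b h s_catA.
Qed.

Lemma rep_len (c x : M) : c %* len x = c %* x.
Proof.
move: x; refine (@ind3 (fun M (x c _ _ : M) =>
  s_rep c (len x) = s_rep c x) c e e _ _ _).
- by definable.
- by rewrite len_e.
- by move=> x h b; rewrite len_b !rep_b h.
Qed.

Lemma prec_rep (x x' y y' : M) : prec x x' -> prec y y' -> prec (x %* y) (x' %* y').
Proof.
move=> hx /precP[k hk]; apply: (@prec_trans _ (x' %* y)).
  move: y {hk}; refine (@ind3 (fun M (y x x' _ : M) =>
    prec (s_rep x y) (s_rep x' y)) x x' e _ _ _).
  - by definable.
  - by rewrite !rep_e; apply: prec_refl.
  - by move=> y h b; rewrite !rep_b; apply: prec_cat.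
rewrite -(rep_len x' y') hk rep_cat rep_len; exact: prec_catl.
Qed.

(** All function symbols are monotone in length; this is why bounds can be composed by
    substitution. *)
Lemma prec_teval (r r' : nat -> M) t : (forall i, prec (r i) (r' i)) ->
  prec (teval r t) (teval r' t).
Proof.
move=> h; elim: t => //= [||u IHu v IHv|u IHu v IHv].
- exact: prec_refl.
- by move=> b; apply: prec_refl.
- exact: prec_cat.
- exact: prec_rep.
Qed.

Lemma len_eq_e (x : M) : len x = e -> x = e.
Proof. by case: (casesP x) => [//|[y [b ->]]]; rewrite len_b => /bit_neq_e. Qed.

(** Prefixes of one word are comparable, so their lengths determine them. This makes it possible to
    address a block of a history by the length of what precedes it. *)
Lemma pre_len_eq (x y w : M) : x [= w -> y [= w -> len x = len y -> x = y.
Proof.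
have key (u v : M) : u [= v -> len u = len v -> u = v.
  move=> /preP[z ->]; rewrite len_cat => /esym/cat_idr/len_eq_e ->.
  by rewrite s_cat_e.
move=> hx hy hl; case: (pre_total hx hy) => [/key->//|/key h].
by rewrite h.
Qed.

(** Provides truncation to a given length in an arbitrary model. *)
Lemma pre_of_len (k x : M) : prec k x -> exists u, u [= x /\ len u = len k.
Proof.
suff h : prec k x -> exists u, subw u x /\ (u [= x /\ len u = len k).
  by move/h=> [u [_ ?]]; exists u.
move: x; refine (@ind3 (fun M (x k _ _ : M) => prec k x ->
  exists u, subw u x /\ (s_pre u x /\ len u = len k)) k e e _ _ _).
- by definable.
- rewrite /prec len_e => /pre_e h; exists e.
  by rewrite len_e h; split; [apply: subw_refl | split=> //; apply: pre_refl].
- move=> x IH b; rewrite /prec len_b => /pre_b[/IH[u [hu [h1 h2]]]|h].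
    exists u; split; first by apply: subw_trans hu (pre_cat _ _).
    by split=> //; apply: pre_trans h1 (pre_cat _ _).
  exists (x ** bt b); rewrite h len_b.
  by split; [apply: subw_refl | split=> //; apply: pre_refl].
Qed.

Lemma zeros_no_one (k z : M) : ~ k ** bt true [= bt false %* z.
Proof.
move: z; refine (@ind3 (fun M (z k _ _ : M) =>
  ~ s_pre (s_cat k (s_bit M true)) (s_rep (s_bit M false) z)) k e e _ _ _).
- by definable.
- by rewrite rep_e => /pre_e/bit_neq_e.
- by move=> z h b; rewrite rep_b => /pre_b[//|/esym/bit_neq].
Qed.

(** The last bit 1 marks the end of [x], so padding to a fixed length can be undone. *)
Lemma pad_inj (x x' z z' : M) :
  x ** bt true ** bt false %* z = x' ** bt true ** bt false %* z' -> x = x'.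
Proof.
(* Both marked words are prefixes of one word, hence comparable, and the statement is symmetric. *)
wlog h : x x' z z' / x ** bt true [= x' ** bt true.
  move=> wl h; have [] := @pre_total (x ** bt true) (x' ** bt true)
      (x ** bt true ** bt false %* z).
  - exact: pre_cat.
  - by rewrite h; apply: pre_cat.
  - by move=> h'; apply: wl h' h.
  - by move=> h'; apply/esym; apply: wl h' (esym h).
case/pre_b: h => [/preP[k ->] h|/bit_inj//].
have {}h : bt false %* z = k ** bt true ** bt false %* z'.
  by apply: (@cancel_cat (x ** bt true)); rewrite h !s_catA.
by case: (@zeros_no_one k z); rewrite h; apply: pre_cat.
Qed.

Lemma pad_ex (x c : M) : prec (x ** bt true) c ->
  exists2 z, z = bt false %* z & len (x ** bt true ** z) = len c.
Proof.
move=> /precP[k hk].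
have h : len (bt false %* k) = len k.
  move: k {hk}; refine (@ind3 (fun M (k _ _ _ : M) =>
    len (s_rep (s_bit M false) k) = len k) e e e _ _ _).
  - by definable.
  - by rewrite rep_e len_e.
  - by move=> k h b; rewrite rep_b !len_b h.
exists (bt false %* k); last by rewrite len_cat hk h.
by rewrite -[RHS]rep_len h rep_len.
Qed.

End Arithmetic.

(** * The standard structures *)

Lemma flatten_nseqSr (T : Type) n (x : seq T) :
  flatten (nseq n.+1 x) = flatten (nseq n x) ++ x.
Proof. by elim: n => [|n IH]; [rewrite /= cats0 | rewrite /= -catA -IH]. Qed.

Lemma prefix_rconsP (x y : str) b :
  prefix x (rcons y b) <-> prefix x y \/ x = rcons y b.
Proof.
split=> [/prefixP[s]|[/prefixP[s ->]|->]]; last 2 first.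
- by rewrite rcons_cat; apply: prefix_prefix.
- exact: prefix_refl.
case/lastP: s => [|s c]; first by rewrite cats0 => ->; right.
by rewrite -rcons_cat => /rcons_inj[-> _]; left; apply: prefix_prefix.
Qed.

Lemma Std_model w : is_model RS1bNIA (Std w).
Proof.
move=> A rho; case=> {A} /= [|b||b||b|b||b|B hB].
- by rewrite cats0.
- by rewrite catA.
- by [].
- by rewrite size_cat addn1 flatten_nseqSr.
- rewrite -!implyE; split; last by move->.
  by case: (rho 0).
- by rewrite -!implyE cats1; split; case: (prefix_rconsP (rho 0) (rho 1) b).
- by rewrite -implyE !cats1 => /rcons_inj[].
- by rewrite !cats1 => /rcons_inj[].
- by case: (rho 0).
- rewrite -implyE msat_inst => -[h0 hs]; elim/last_ind => // x b /= IH.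
  have := hs x; rewrite -implyE => /(_ IH); rewrite !msat_subst => -[hf ht].
  have e c : (fun i => @teval (Std w) (econs x rho)
      match i with 0 => Cat (Var 0) (Bit c) | _.+1 => Var i end) =
      econs (rcons x c) rho by apply/funext => -[|i] //=; rewrite cats1.
  by case: b; rewrite -e.
Qed.

Lemma len_Std w (x : Std w) : len x = nseq (size (x : str)) true :> str.
Proof. by rewrite /len /=; elim: (size x) => //= n ->. Qed.

Lemma prec_Std w (x y : Std w) : prec x y <-> size (x : str) <= size (y : str).
Proof.
change (prefix (len x : str) (len y) <-> size (x : str) <= size (y : str)).
rewrite !len_Std; split; first by move/size_prefix; rewrite !size_nseq.
by move=> /subnKC <-; rewrite nseqD; apply: prefix_prefix.
Qed.

(** * Representable functions of environments *)

Definition fenv : Type := (nat -> str) -> oracle -> str.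

Section Substitution.
Variable K : fenv -> Prop.
Hypothesis K_let : forall G H : fenv, K G -> K H ->
  K (fun r w => G (econs (H r w) r) w).
Hypothesis K_drop : forall k (H : fenv), K H -> K (fun r w => H (fun i => r (k + i)) w).

(** Simultaneous substitution from two one-step operations, possible because [G] reads finitely many
    variables. It serves both for representable functions and for programs. *)
Lemma subst_closed m (G : fenv) (s : nat -> fenv) : K G -> (forall i, K (s i)) ->
  (forall r r' w, (forall i, i < m -> r i = r' i) -> G r w = G r' w) ->
  K (fun r w => G (fun i => s i r w) w).
Proof.
move=> hG hs hm.
(* After [d] steps the environment starts with the [m - d] values not yet replaced, followed by the
   actual environment. The next value is computed behind the [m - d.+1] that still remain, which is
   the purpose of [K_drop]. *)
have h d : d <= m -> K (fun r w => G (fun i =>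
    if i < d then s i (fun l => r (m - d + l)) w else r (i - d)) w).
  elim: d => [_|d IH lt_dm].
    rewrite (_ : (fun r w => _) = G) //; apply/funext => r; apply/funext => w.
    by apply: (hm) => i _; rewrite ltn0 subn0.
  have := K_let (IH (ltnW lt_dm)) (K_drop (m - d.+1) (hs d)).
  congr K; apply/funext => r; apply/funext => w; congr (G _ w); apply/funext => i.
  rewrite ltnS (leq_eqVlt i d); case: ltnP => [lt_id|le_di].
    by rewrite orbT; congr (s i _ w); apply/funext => l; rewrite -(subnSK lt_dm).
  rewrite orbF; case: eqP => [->|/eqP ne_id]; first by rewrite subnn.
  have lt_di : d < i by rewrite ltn_neqAle eq_sym ne_id.
  by rewrite -(subnSK lt_di).
have := h m (leqnn m); congr K; apply/funext => r; apply/funext => w.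
by apply: hm => i ->; rewrite subnn.
Qed.

End Substitution.

(** The final formula is [exists w, prec w b /\ A r w y]. Totality and functionality are required in
    every model, so completeness makes them provable. [b] bounds the value as well as the witness,
    because the value becomes part of a witness under composition. *)
Record repr_by (F : fenv) (A : forall M : structure, (nat -> M) -> M -> M -> Prop)
    (b : tm) : Prop := ReprBy {
  rp_def : subword_def (fun M r => A M (fun i => r i.+2) (r 0) (r 1));
  rp_total : forall M : structure, is_model RS1bNIA M -> forall r : nat -> M,
    exists w y, [/\ prec w (teval r b), prec y (teval r b) & A M r w y];
  rp_fun : forall M : structure, is_model RS1bNIA M -> forall (r : nat -> M) w w' y y',
    A M r w y -> A M r w' y' -> y = y';
  rp_std : forall om r w y, A (Std om) r w y -> y = F r om }.

Definition Repr (F : fenv) : Prop := exists A b, repr_by F A b.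

Lemma Repr_graph (F : fenv) (P : forall M : structure, (nat -> M) -> M -> Prop) b :
  subword_def (fun M r => P M (fun i => r i.+1) (r 0)) ->
  (forall M : structure, is_model RS1bNIA M -> forall r : nat -> M,
    exists y, prec y (teval r b) /\ P M r y) ->
  (forall M : structure, is_model RS1bNIA M -> forall (r : nat -> M) y y',
    P M r y -> P M r y' -> y = y') ->
  (forall om r y, P (Std om) r y -> y = F r om) -> Repr F.
Proof.
move=> hP h1 h2 h3; exists (fun M r _ y => P M r y), b; split=> //.
- apply: (@subword_def_sub (fun M r => P M (fun i => r i.+1) (r 0))
    (fun i M r => r i.+1)) => // i; exact: term_def_var.
- move=> M hM r; have [y [hy hP']] := h1 M hM r.
  by exists (s_eps M), y; split=> //; apply: prec_e.
- by move=> M hM r _ _; apply: h2.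
- by move=> om r _; apply: h3.
Qed.

Lemma Repr_term t : Repr (fun r _ => tm_eval r t).
Proof.
apply: (@Repr_graph _ (fun M r y => y = teval r t) t).
- by definable.
- by move=> M hM r; exists (teval r t); split=> //; apply: prec_refl.
- by move=> M hM r y y' -> ->.
- by move=> om r y ->; rewrite teval_Std.
Qed.

Definition cond (x y z0 z1 : str) : str :=
  if x is a :: x' then if last a x' then z1 else z0 else y.

Lemma cond_rcons x b y z0 z1 : cond (rcons x b) y z0 z1 = if b then z1 else z0.
Proof. by case: x => //= a x; rewrite last_rcons. Qed.

Lemma Repr_cond : Repr (fun r _ => cond (r 0) (r 1) (r 2) (r 3)).
Proof.
apply: (@Repr_graph _ (fun M r y => (r 0 = s_eps M /\ y = r 1) \/
  exists p, subw p (r 0) /\ ((r 0 = s_cat p (s_bit M false) /\ y = r 2) \/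
                             (r 0 = s_cat p (s_bit M true) /\ y = r 3)))
  (Cat (Var 1) (Cat (Var 2) (Var 3)))).
- by definable.
- move=> M hM r /=; case: (casesP hM (r 0)) => [h|[p [b h]]].
    by exists (r 1); split; [apply: prec_catl | left].
  have hp : subw p (r 0) by rewrite h; apply: subw_catl.
  case: b h => h; [exists (r 3) | exists (r 2)]; split.
  + by apply/(prec_cat_r hM)/(prec_catr hM).
  + by right; exists p; split=> //; right.
  + by apply/(prec_cat_r hM)/(prec_catl hM).
  + by right; exists p; split=> //; left.
- move=> M hM r y y'; case=> [[h ->]|[p [_ [][h ->]]]]; rewrite h.
  + by case=> [[_ ->]//|[q [_ [][/esym/(bit_neq_e hM)]]]].
  + case=> [[/(bit_neq_e hM)]//|[q [_ [][]/(bit_inj2 hM)[]//]]].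
  + case=> [[/(bit_neq_e hM)]//|[q [_ [][]/(bit_inj2 hM)[]//]]].
- move=> om r y /=; case=> [[-> ->]//|[p [_ [][]]]];
  by rewrite cats1 => -> ->; rewrite cond_rcons.
Qed.

Lemma Repr_query : Repr (fun r om => [:: om (r 0)]).
Proof.
apply: (@Repr_graph _ (fun M r y => (s_flip (r 0) /\ y = s_bit M true) \/
  (~ s_flip (r 0) /\ y = s_bit M false)) (Bit true)).
- by definable.
- move=> M hM r /=; have [h|h] := EM (s_flip (r 0)).
    by exists (s_bit M true); split; [apply: prec_refl | left].
  exists (s_bit M false); split; last by right.
  rewrite /prec -[s_bit M true](e_cat hM) -[s_bit M false](e_cat hM) !len_b //.
  exact: pre_refl.
- by move=> M hM r y y' [][h ->] [][h' ->].
- by move=> om r y /= [][h ->]; [rewrite h | case: (om _) h].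
Qed.

Lemma Repr_sub F (s : nat -> tm) : Repr F ->
  Repr (fun r om => F (fun i => tm_eval r (s i)) om).
Proof.
case=> A [b [hA h1 h2 h3]].
exists (fun M r w y => A M (fun i => teval r (s i)) w y), (tm_subst s b); split.
- definable.
- by move=> M hM r; rewrite teval_subst; apply: h1.
- by move=> M hM r w w' y y'; apply: h2.
- move=> om r w y /h3 ->; congr (F _ om).
  by apply/funext => i; rewrite teval_Std.
Qed.

(** The intermediate value and both witnesses are concatenated into one. Where they are found inside
    it is immaterial: functionality of [H] determines [u], and then that of [G] determines [y]. The
    bound is [bG] at the bound of [H], by monotonicity. *)
Lemma Repr_let G H : Repr G -> Repr H -> Repr (fun r om => G (econs (H r om) r) om).
Proof.
case=> AG [bG [hG G1 G2 G3]] [AH [bH [hH H1 H2 H3]]].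
exists (fun M r w y => exists u, subw u w /\ exists v, subw v w /\
  exists v', subw v' w /\ (AH M r v u /\ AG M (econs u r) v' y)),
  (Cat (Cat bH bH) (tm_subst (econs bH Var) bG)); split.
- definable.
- move=> M hM r; have [v [u [pv pu hu]]] := H1 M hM r.
  have [v' [y [pv' py hy]]] := G1 M hM (econs u r).
  have mono : prec (teval (econs u r) bG) (teval r (tm_subst (econs bH Var) bG)).
    rewrite teval_subst; apply: prec_teval => // -[|i] //=.
    exact: prec_refl.
  exists (s_cat (s_cat u v) v'), y; split=> /=.
  + by do 2?[apply: prec_cat => //]; apply: prec_trans mono.
  + by apply: prec_cat_r => //; apply: prec_trans mono.
  + exists u; split; first by apply: (subw_trans hM (subw_catl hM u v)); apply: pre_cat.
    exists v; split; first by apply: (subw_trans hM (subw_catr hM v u)); apply: pre_cat.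
    by exists v'; split=> //; apply: subw_catr.
- move=> M hM r w w' y y' [u [_ [v [_ [v' [_ [hu hy]]]]]]] [x [_ [k [_ [k' [_ [hx
    hy']]]]]]].
  by rewrite -(H2 _ hM _ _ _ _ _ hu hx) in hy'; apply: G2 hy hy'.
- by move=> om r w y [u [_ [v [_ [v' [_ [/H3-> /G3->]]]]]]].
Qed.

(** The second conclusion bounds every value in every model by [t]; this later allows blocks of a
    fixed length. *)
Lemma Repr_trunc H t : Repr H ->
  exists A b, repr_by (fun r om => take (size (tm_eval r t)) (H r om)) A b /\
    forall M : structure, is_model RS1bNIA M -> forall (r : nat -> M) w y,
      A M r w y -> prec y (teval r t).
Proof.
case=> A [b [hA h1 h2 h3]].
exists (fun M r w y => exists s, subw s w /\ exists v, subw v w /\ (A M r v s /\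
  (s_pre y s /\ ((prec s (teval r t) /\ y = s) \/
                 (prec (teval r t) s /\ len y = len (teval r t)))))), (Cat b b).
split; last first.
  move=> M hM r w y [s [_ [v [_ [_ [_ [[h ->]//|[_ h]]]]]]]].
  by rewrite /prec h; apply: pre_refl.
split.
- definable.
- move=> M hM r /=; have [v [s [pv ps hs]]] := h1 M hM r.
  have [y [yb hy]] : exists y, prec y (teval r b) /\ (s_pre y s /\
     ((prec s (teval r t) /\ y = s) \/
      (prec (teval r t) s /\ len y = len (teval r t)))).
    case: (prec_total hM s (teval r t)) => h.
      by exists s; split=> //; split; [apply: pre_refl | left].
    have [u [hu lu]] := pre_of_len hM h.
    exists u; split; last by split=> //; right.
    by apply: prec_trans ps => //; apply: pre_prec.
  exists (s_cat s v), y; split.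
  + exact: prec_cat.
  + exact: prec_cat_l.
  + exists s; split; first exact: subw_catl.
    by exists v; split=> //; apply: subw_catr.
- move=> M hM r w w' y y' [s [_ [v [_ [hs [ys hy]]]]]] [s' [_ [v' [_ [hs' [ys'
    hy']]]]]].
  have es := h2 _ hM _ _ _ _ _ hs hs'; subst s'.
  apply: (pre_len_eq hM ys ys').
  case: hy hy' => [[h ->]|[h e]] [[h' ->]|[h' e']] //; rewrite ?e ?e' //;
    exact: pre_antisym.
- move=> om r w y [s [_ [v [_ [/h3 -> [ys]]]]]].
  have /prefixP[s' e] : prefix (y : str) (H r om) := ys.
  rewrite -teval_Std => -[[/prec_Std h ->]|[/prec_Std h]].
    by rewrite take_oversize.
  rewrite !len_Std => /(congr1 size); rewrite !size_nseq => <-.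
  by rewrite e take_size_cat.
Qed.

(** * Bounded recursion by histories in models of the theory *)

Section BoundedRecursion.
Variables (F G : fenv) (H : bool -> fenv) (t : tm).
Variables (AG : forall M : structure, (nat -> M) -> M -> M -> Prop) (bG : tm).
Variables (AH : bool -> forall M : structure, (nat -> M) -> M -> M -> Prop)
  (bH : bool -> tm).
Hypothesis rG : repr_by G AG bG.
Hypothesis rH : forall b, repr_by (H b) (AH b) (bH b).
Hypothesis AH_bound : forall b (M : structure), is_model RS1bNIA M ->
  forall x p (r : nat -> M) w y, AH b (econs x (econs p r)) w y ->
    prec y (teval (econs p r) t).
Hypothesis F_eps : forall r om, F (econs [::] r) om = G r om.
Hypothesis F_rcons : forall r y b om,
  F (econs (rcons y b) r) om = H b (econs (F (econs y r) om) (econs y r)) om.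

(* [block w c p x]: the history [w] is cut into blocks of length [|c|], and the
   block at position [|c x p|] is [x 1 0 ... 0]. *)
Definition block (M : structure) (w c p x : M) : Prop :=
  exists u, subw u w /\ exists z, subw z w /\
    (s_pre (s_cat u (s_cat (s_cat x (s_bit M true)) z)) w /\
    (len u = len (s_rep c p) /\ (z = s_rep (s_bit M false) z /\
    len (s_cat (s_cat x (s_bit M true)) z) = len c))).

(** In [history] the variable [p] ranges over subwords of [y], as the syntax demands; the premise
    here selects the prefixes. *)
Definition hist_step b (M : structure) (w1 w2 c y p : M) (r : nat -> M) : Prop :=
  s_pre (s_cat p (s_bit M b)) y -> exists x, subw x w1 /\ exists x', subw x' w1 /\
    exists v, subw v w2 /\ (block w1 c p x /\ (block w1 c (s_cat p (s_bit M b)) x' /\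
      AH b (econs x (econs p r)) v x')).

(* The witnesses of the steps occur somewhere in [w2]: no positions are needed,
   since subword quantifiers can search for them. *)
Definition history (M : structure) (w1 w2 c y : M) (r : nat -> M) : Prop :=
  (exists x, subw x w1 /\ exists v, subw v w2 /\
    (block w1 c (s_eps M) x /\ AG r v x)) /\
  (forall p, subw p y -> hist_step false w1 w2 c y p r /\ hist_step true w1 w2 c y p r).

Lemma subword_def_block w c p x : term_def w -> term_def c -> term_def p ->
  term_def x ->
  subword_def (fun M r => block (w M r) (c M r) (p M r) (x M r)).
Proof.
move=> hw hc hp hx.
have h : subword_def (fun M r => block (r 0) (r 1) (r 2) (r 3)) by rewrite /block;
  definable.
pose s' i : forall M : structure, (nat -> M) -> M :=
  match i with 0 => w | 1 => c | 2 => p | _ => x end.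
by apply: (@subword_def_sub _ s' h) => -[|[|[|i]]].
Qed.

Lemma subword_def_history (w1 w2 c y : forall M : structure, (nat -> M) -> M)
    (s : nat -> forall M : structure, (nat -> M) -> M) :
  term_def w1 -> term_def w2 -> term_def c -> term_def y ->
    (forall i, term_def (s i)) ->
  subword_def (fun M r => history (w1 M r) (w2 M r) (c M r) (y M r) (fun i => s i M r)).
Proof.
move=> h1 h2 h3 h4 hs.
have defG := rp_def rG; have def0 := rp_def (rH false); have def1 := rp_def (rH true).
have h : subword_def (fun M r => history (r 0) (r 1) (r 2) (r 3) (fun i => r i.+4)).
  rewrite /history /hist_step.
  by repeat first [progress definable | apply: subword_def_block | apply:
    (subword_def_app def0)
    | apply: (subword_def_app def1) | move=> ?].
pose s' i : forall M : structure, (nat -> M) -> M :=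
  match i with 0 => w1 | 1 => w2 | 2 => c | 3 => y | j.+4 => s j end.
apply: (@subword_def_sub _ s' h).
by move=> [|[|[|[|i]]]]; [exact: h1 | exact: h2 | exact: h3 | exact: h4 | exact: (hs
  i)].
Qed.

Ltac history_definable := repeat first
  [apply: subword_def_history; [.. | move=> ?] | apply: subword_def_block | def_step].

Section InModel.
Variables (M : structure) (hM : is_model RS1bNIA M).

Local Notation "x ** y" := (s_cat x y) (at level 40, left associativity).
Local Notation "x %* y" := (s_rep x y) (at level 39, left associativity).
Local Notation "x [= y" := (s_pre x y) (at level 70).
Local Notation e := (s_eps M).
Local Notation bt := (s_bit M).

(** The length of [u] fixes the position, the length of the block fixes where it ends, and [pad_inj]
    recovers its content. *)
Lemma block_fun (w c p x x' : M) : block w c p x -> block w c p x' -> x = x'.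
Proof.
move=> [u [_ [z [_ [h [lu [ez lx]]]]]]] [u' [_ [z' [_ [h' [lu' [ez' lx']]]]]]].
have eu : u = u'.
  apply: (@pre_len_eq _ hM u u' w); last by rewrite lu lu'.
    by apply: pre_trans h => //; apply: pre_cat.
  by apply: pre_trans h' => //; apply: pre_cat.
subst u'; have := pre_len_eq hM h h'.
rewrite !len_cat // in lx lx' *; rewrite lx lx' => /(_ erefl) /(cancel_cat hM).
rewrite ez ez'; exact: (pad_inj hM).
Qed.

Lemma block_mono (w w' c p x : M) : w [= w' -> block w c p x -> block w' c p x.
Proof.
move=> hw [u [su [z [sz [h hz]]]]]; exists u; split; first exact: subw_trans su hw.
exists z; split; first exact: subw_trans sz hw.
by split=> //; apply: pre_trans h hw.
Qed.

Lemma block_prec (w c p x : M) : block w c p x -> prec x c.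
Proof.
move=> [u [_ [z [_ [_ [_ [_ h]]]]]]].
by rewrite /prec -h -s_catA // len_cat //; apply: pre_cat.
Qed.

Lemma block_subw (w c p x : M) : block w c p x -> subw x w.
Proof.
move=> [u [_ [z [_ [h _]]]]]; apply: (@subw_pre _ hM u); apply: pre_trans h => //.
by rewrite !s_catA // -[_ ** z]s_catA //; apply: pre_cat.
Qed.

Lemma block_new (w c p x : M) : len w = len (c %* p) -> prec (x ** bt true) c ->
  exists w', [/\ w [= w', len w' = len w ** len c & block w' c p x].
Proof.
move=> hw hx; have [z kk hk] := pad_ex hM hx.
exists (w ** (x ** bt true ** z)); split.
- exact: pre_cat.
- by rewrite len_cat // hk.
exists w; split; first by apply: subw_catl.
exists z; split; first by rewrite (s_catA hM); apply: subw_catr.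
by split=> //; apply: pre_refl.
Qed.

Lemma history_step b (w1 w2 c y p : M) r : history w1 w2 c y r ->
  p ** bt b [= y -> exists x x' v, [/\ block w1 c p x,
    block w1 c (p ** bt b) x', subw v w2 & AH b (econs x (econs p r)) v x'].
Proof.
move=> [_ h] hp; have sp : subw p y.
  by apply: pre_subw => //; apply: pre_trans hp => //; apply: pre_cat.
suff /(_ hp)[x [_ [x' [_ [v [sv [h1 [h2 h3]]]]]]]] : hist_step b w1 w2 c y p r.
  by exists x, x', v.
by case: (h p sp); case: b {hp}.
Qed.

Lemma history_last (w1 w2 c y : M) r : history w1 w2 c y r ->
  exists x, block w1 c y x.
Proof.
move=> h; case: (casesP hM y) => [->|[p [b ey]]].
  by case: h => -[x [_ [v [_ [hx _]]]]] _; exists x.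
have [] := history_step (b := b) (p := p) h; first by rewrite ey; apply: pre_refl.
by move=> x [x' [v [_ hx' _ _]]]; exists x'; rewrite ey.
Qed.

(** Blocks stay in place when the history grows to the right, so the old steps survive; the only new
    prefix is the whole of [p ** bt b]. *)
Lemma history_extend b (w1 w2 w1' w2' c p x x' v : M) r :
  history w1 w2 c p r -> w1 [= w1' -> w2 [= w2' -> block w1 c p x ->
  block w1' c (p ** bt b) x' -> subw v w2' -> AH b (econs x (econs p r)) v x' ->
  history w1' w2' c (p ** bt b) r.
Proof.
move=> h le1 le2 hx hx' sv hA; have hx1 := block_mono le1 hx; split.
  case: h => -[y [sy [k [sk [hy hk]]]]] _.
  exists y; split; first exact: subw_trans sy le1.
  exists k; split; first exact: subw_trans sk le2.
  by split=> //; apply: block_mono hy.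
suff hs b' q : hist_step b' w1' w2' c (p ** bt b) q r by [].
case/(pre_b hM) => [/(history_step h)[y [y' [k [h1 h2 h3 h4]]]]|].
  have {}h1 := block_mono le1 h1; have {}h2 := block_mono le1 h2.
  exists y; split; first exact: block_subw h1.
  exists y'; split; first exact: block_subw h2.
  by exists k; split; first exact: subw_trans h3 le2.
case/(bit_inj2 hM) => -> ->; exists x; split; first exact: block_subw hx1.
exists x'; split; first exact: block_subw hx'.
by exists v.
Qed.

(** Induction on [p], with both parts of the history under bounded quantifiers. The factor
    [p ** bt false] counts one block per prefix, the empty one included; only its length matters.
    The premise [p [= y] is there because the bounds [cH] and [dH] cover prefixes of [y] only. *)
Lemma history_ex (c d y : M) r :
  (forall x, prec x (teval r bG) -> prec (x ** bt true) c) ->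
  (forall p x, p [= y -> prec x (teval (econs p r) t) -> prec (x ** bt true) c) ->
  prec (teval r bG) d ->
  (forall b p x, p [= y -> prec x c -> prec (teval (econs x (econs p r)) (bH b)) d) ->
  forall p, exists w1, prec w1 (c %* (y ** bt false)) /\
    exists w2, prec w2 (d %* (y ** bt false)) /\ (p [= y ->
      len w1 = len (c %* (p ** bt false)) /\
      (prec w2 (d %* (p ** bt false)) /\ history w1 w2 c p r)).
Proof.
move=> cG cH dG dH.
have intro p w1 w2 : p [= y -> len w1 = len (c %* (p ** bt false)) ->
    prec w2 (d %* (p ** bt false)) -> history w1 w2 c p r ->
    exists w1, prec w1 (c %* (y ** bt false)) /\
    exists w2, prec w2 (d %* (y ** bt false)) /\ (p [= y ->
      len w1 = len (c %* (p ** bt false)) /\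
      (prec w2 (d %* (p ** bt false)) /\ history w1 w2 c p r)).
  move=> hp l1 l2 h.
  have le u : prec (u %* (p ** bt false)) (u %* (y ** bt false)).
    apply: prec_rep => //; first exact: prec_refl.
    by apply: prec_cat => //; [apply: pre_prec | apply: prec_refl].
  exists w1; split; first by rewrite /prec l1; apply: le.
  by exists w2; split; first exact: prec_trans l2 (le d).
(* Outside the prefixes of [y] the claim is vacuous, and empty words meet the bounds. *)
have not_pre p : ~ p [= y -> exists w1, prec w1 (c %* (y ** bt false)) /\
    exists w2, prec w2 (d %* (y ** bt false)) /\ (p [= y ->
      len w1 = len (c %* (p ** bt false)) /\
      (prec w2 (d %* (p ** bt false)) /\ history w1 w2 c p r)).
  by move=> h; exists e; split; [apply: prec_e | exists e; split=> //; apply: prec_e].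
refine (@sg_ind _ hM (fun M s => exists w1,
  prec w1 (s_rep (s 2) (s_cat (s 1) (s_bit M false))) /\
    exists w2, prec w2 (s_rep (s 3) (s_cat (s 1) (s_bit M false))) /\
      (s_pre (s 0) (s 1) ->
      len w1 = len (s_rep (s 2) (s_cat (s 0) (s_bit M false))) /\
      (prec w2 (s_rep (s 3) (s_cat (s 0) (s_bit M false))) /\
       history w1 w2 (s 2) (s 0) (fun i =>
         s i.+4)))) (econs y (econs c (econs d r))) _ _ _).
- by history_definable.
- have [v [x [pv px hx]]] := rp_total rG hM r.
  have le0 : len e = len (c %* e) by rewrite rep_e.
  have [w1 [_ lw hw]] := block_new le0 (cG _ px).
  apply: (intro e w1 v); first exact: e_pre.
  + by rewrite lw le0 rep_b // len_cat.
  + by rewrite rep_b // rep_e // e_cat //; apply: prec_trans dG.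
  split=> [|p _].
    exists x; split; first exact: block_subw hw.
    by exists v; split=> //; apply: subw_refl.
  by split=> /(pre_e hM)/(bit_neq_e hM).
- move=> p IH b; have [hpb|/not_pre//] := EM (p ** bt b [= y).
  have hp : p [= y by apply: pre_trans hpb => //; apply: pre_cat.
  have [w1 [_ [w2 [_ /(_ hp)[l1 [l2 h]]]]]] := IH.
  have [x hx] := history_last h.
  have [v [x' [pv _ hx']]] := rp_total (rH b) hM (econs x (econs p r)).
  have px' : prec (x' ** bt true) c by apply: (cH p) => //; apply: AH_bound hx'.
  have lw1 : len w1 = len (c %* (p ** bt b)) by rewrite l1 !rep_b.
  have [w1' [le1 lw hw]] := block_new lw1 px'.
  apply: (intro _ w1' (w2 ** v)) => //.
  + by rewrite lw lw1 rep_b // (rep_b hM c _ false) !len_cat // rep_b // len_cat.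
  + rewrite rep_b //; apply: prec_cat => //; first by move: l2; rewrite !rep_b.
    by apply: prec_trans pv _ => //; apply: dH => //; apply: block_prec hx.
  + apply: (history_extend h le1 _ hx hw _ hx'); first exact: pre_cat.
    exact: subw_catr.
Qed.

(** Along the prefixes of [y] both histories carry a common block [k]. Since [k] is a subword of
    [w1], this is a subword formula and induction applies. *)
Lemma history_unique (w1 w2 w1' w2' c y x x' : M) r :
  history w1 w2 c y r -> history w1' w2' c y r ->
  block w1 c y x -> block w1' c y x' -> x = x'.
Proof.
move=> h h' hx hx'.
suff /(_ (pre_refl hM y))[k [_ [hk hk']]] : y [= y ->
    exists k, subw k w1 /\ (block w1 c y k /\ block w1' c y k).
  by rewrite (block_fun hx hk) (block_fun hx' hk').
have hyy := pre_refl hM y; move: {1 3 4}y.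
refine (@sg_ind _ hM (fun M s => s_pre (s 0) (s 1) -> exists k, subw k (s 3) /\
  (block (s 3) (s 2) (s 0) k /\ block (s 4) (s 2) (s 0) k))
  (econs y (econs c (econs w1 (econs w1' (fun=> e))))) _ _ _).
- by history_definable.
- move=> _; case: h => -[k [sk [v [_ [hk Ak]]]]] _.
  case: h' => -[k' [_ [v' [_ [hk' Ak']]]]] _.
  exists k; split=> //; split=> //.
  by rewrite (rp_fun rG hM Ak Ak').
- move=> p IH b hp.
  have /IH[k /= [_ [hk hk']]] : p [= y by apply: pre_trans hp => //; apply: pre_cat.
  have [a [a' [v [ha ha' _ Aa]]]] := history_step h hp.
  have [z [z' [v' [hz hz' _ Az]]]] := history_step h' hp.
  rewrite -(block_fun hk ha) in Aa; rewrite -(block_fun hk' hz) in Az.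
  exists a'; split; first exact: block_subw ha'.
  by split=> //; rewrite (rp_fun (rH b) hM Aa Az).
Qed.

End InModel.

Lemma history_Std om (w1 w2 c y : Std om) r : history w1 w2 c y r ->
  forall x, block w1 c y x -> x = F (econs (y : str) r) om.
Proof.
move=> h; have hM := @Std_model om.
have {h} : forall p : str, prefix p y -> forall x, block w1 c p x ->
  x = F (econs p r) om.
  elim/last_ind => [_|p b IH hp] x hx.
    case: h => -[x' [_ [v [_ [hx' Ax]]]]] _.
    by rewrite F_eps -(rp_std rG Ax); apply: block_fun hx hx'.
  have hp' : @s_pre (Std om) (@s_cat (Std om) p (s_bit (Std om) b)) y by rewrite /=
    cats1.
  have [a [a' [v [ha ha' _ /(rp_std (rH b)) Aa]]]] := history_step hM h hp'.
  rewrite F_rcons -(IH _ a ha); last by apply: prefix_trans hp; apply: prefix_rcons.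
  by rewrite -Aa; apply: block_fun hx _; move: ha'; rewrite /= cats1.
by apply; apply: prefix_refl.
Qed.

Lemma Repr_rec : Repr F.
Proof.
(* Block length: [bG] for the initial value, [t] for the later ones, one more bit for the end
   marker. The shift skips variable 0, the recursion argument. *)
pose tc := Cat (tm_shift bG) (Cat t (Bit true)).
(* Room for the witness of one step; the previous value, variable 0 of [bH], is replaced by its
   bound [tc]. *)
pose td := Cat (tm_shift bG) (Cat (tm_subst (econs tc Var) (bH false)) (tm_subst (econs
  tc Var) (bH true))).
(* One portion for each of the prefixes of the recursion argument, whose number is its length plus
   one. *)
pose B u := Rep u (Cat (Var 0) (Bit false)).
exists (fun M r w y => exists w1, subw w1 w /\ exists w2, subw w2 w /\
  (history w1 w2 (teval r tc) (r 0) (fun i => r i.+1) /\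
   block w1 (teval r tc) (r 0) y)), (Cat (Cat (B tc) (B td)) tc); split.
- by history_definable.
- move=> M hM r; pose c := teval r tc; pose d := teval r td.
  have er : r = econs (r 0) (fun i => r i.+1) by apply/funext => -[].
  have bGE : teval r (tm_shift bG) = teval (fun i => r i.+1) bG.
    by rewrite er teval_shift.
  have dE b : prec (teval (econs c r) (bH b)) d.
    rewrite /d /= !teval_subst.
    have -> : (fun i => teval r (econs tc Var i)) = econs c r by apply/funext => -[].
    by apply: prec_cat_r => //; case: b; [apply: prec_catr | apply: prec_catl].
  have [] := @history_ex M hM c d (r 0) (fun i => r i.+1) _ _ _ _ (r 0).
  + move=> x hx; rewrite /c /= bGE s_catA //; apply: prec_cat => //.
      exact: prec_cat_l.
    exact: prec_refl.
  + move=> p x hp hx; rewrite /c /= s_catA //; apply: prec_cat => //;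
      last exact: prec_refl.
    apply: prec_cat_r => //; apply: prec_trans hx _ => //.
    rewrite {2}er; apply: prec_teval => // -[|i] /=;
      [exact: pre_prec | exact: prec_refl].
  + by rewrite /d /= bGE; apply: prec_catl.
  + move=> b p x hp hx; apply: prec_trans (dE b) => //; apply: prec_teval => //.
    by move=> [|[|i]] //=; [apply: pre_prec | apply: prec_refl].
  move=> w1 [p1 [w2 [p2 /(_ (pre_refl hM _))[_ [_ h]]]]].
  have [x hx] := history_last hM h.
  exists (s_cat w1 w2), x; split.
  + by apply: prec_cat_l => //; apply: prec_cat.
  + by apply: prec_cat_r => //; apply: block_prec hx.
  + exists w1; split; first exact: subw_catl.
    by exists w2; split=> //; apply: subw_catr.
- move=> M hM r w w' y y' [w1 [_ [w2 [_ [h hy]]]]] [w1' [_ [w2' [_ [h' hy']]]]].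
  exact: (history_unique hM h h' hy hy').
- move=> om r w y [w1 [_ [w2 [_ [h hy]]]]].
  rewrite (history_Std h hy); congr (F _ om).
  by apply/funext => -[].
Qed.

End BoundedRecursion.

(** * From POR functions to Sigma^b_1 formulas *)

Definition tup n (r : nat -> str) : n.-tuple str := [tuple r i | i < n].

Arguments tup : simpl never.

Lemma nth_tup n r i : i < n -> nth [::] (tup n r) i = r i.
Proof. by move=> h; rewrite -(tnth_nth _ _ (Ordinal h)) tnth_mktuple. Qed.

Lemma tup_eq n (xs : n.-tuple str) r :
  (forall i, i < n -> nth [::] xs i = r i) -> xs = tup n r.
Proof.
by move=> h; apply: eq_from_tnth => i; rewrite tnth_mktuple (tnth_nth [::]) h.
Qed.

Lemma tm_eval_ext n (r r' : nat -> str) t : (forall i, i < n -> r i = r' i) ->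
  tm_vars_lt n t -> tm_eval r t = tm_eval r' t.
Proof.
by move=> e; elim: t => //= u IHu v IHv /andP[/IHu-> /IHv->].
Qed.

Lemma tm_eval_subst (r : nat -> str) s t :
  tm_eval r (tm_subst s t) = tm_eval (fun i => tm_eval r (s i)) t.
Proof. by elim: t => //= [u -> v ->|u -> v ->]. Qed.

Lemma Repr_drop k F : Repr F -> Repr (fun r om => F (fun i => r (k + i)) om).
Proof. exact: (Repr_sub (fun i => Var (k + i))). Qed.

Lemma POR_Repr n (f : n.-tuple str -> oracle -> str) : POR f ->
  Repr (fun r om => f (tup n r) om).
Proof.
elim=> {n f}.
- move=> f h; have := Repr_term Eps; congr Repr; apply/funext => r; apply/funext => om.
  by rewrite /= -[LHS](h (r 0) om); congr (f _ om); apply: tup_eq => -[].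
- move=> n i f h; have := Repr_term (Var i); congr Repr.
  by apply/funext => r; apply/funext => om; rewrite h tnth_mktuple.
- move=> b f h; have := Repr_term (Cat (Var 0) (Bit b)); congr Repr.
  apply/funext => r; apply/funext => om; rewrite /= cats1 -[LHS](h (r 0) om).
  by congr (f _ om); apply: tup_eq => -[].
- move=> f h0 hb; have := Repr_cond; congr Repr.
  apply/funext => r; apply/funext => om.
  have -> : tup 4 r = [tuple r 0; r 1; r 2; r 3].
    by apply/esym/tup_eq => -[|[|[|[|]]]].
  by case/lastP: (r 0) => [|x b]; rewrite ?h0 // hb cond_rcons.
- move=> f h; have := Repr_query; congr Repr.
  apply/funext => r; apply/funext => om; rewrite -[LHS](h (r 0) om).
  by congr (f _ om); apply: tup_eq => -[].
- move=> n m g h f _ IHg _ IHh hf.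
  (* The finite family is padded with the empty word, as [subst_closed] expects one function for
     every index. *)
  pose s j : fenv := if insub j is Some i then fun r om => h i (tup n r) om
    else fun r om => tm_eval r Eps.
  have hs j : Repr (s j) by rewrite /s; case: insub => [i|];
    [exact: IHh | exact: Repr_term].
  have hm (r r' : nat -> str) (om : oracle) : (forall i, i < m -> r i = r' i) ->
      g (tup m r) om = g (tup m r') om.
    by move=> h'; congr (g _ om); apply: tup_eq => i lt_im; rewrite nth_tup // h'.
  have := subst_closed Repr_let Repr_drop IHg hs hm; congr Repr.
  apply/funext => r; apply/funext => om; rewrite hf; congr (g _ om).
  apply: eq_from_tnth => i; rewrite !tnth_mktuple /s;
    case: insubP => [j _ /val_inj-> //|].
  by rewrite ltn_ord.
- move=> n g h t f _ IHg _ IHh ht hf0 hf1.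
  pose F : fenv := fun r om => f [tuple of rcons (tup n (fun i => r i.+1)) (r 0)] om.
  (* Tuples end with the prefix and the previous value, whereas environments start with the previous
     value and the prefix; [sH] and [t'] translate between the two orders. *)
  pose sH i := if i < n then Var i.+2 else if i == n then Var 1 else Var 0.
  pose t' := tm_subst (fun i => if i < n then Var i.+1 else Var 0) t.
  have RH b := Repr_trunc (tm_shift t') (Repr_sub sH (IHh b)).
  have [A0 [b0 [R0 B0]]] := RH false; have [A1 [b1 [R1 B1]]] := RH true.
  have [AG [bG RG]] := IHg.
  have FE y r om : F (econs y r) om = f [tuple of rcons (tup n r) y] om by [].
  have RF : Repr F.
    apply: (@Repr_rec F _ (fun b r om => take (size (tm_eval r (tm_shift t')))
      (h b (tup n.+2 (fun i => tm_eval r (sH i))) om)) t' AG bG (fun b =>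
        if b then A1 else A0)
      (fun b => if b then b1 else b0) RG).
    + by case; [exact: R1 | exact: R0].
    + move=> b M hM x p r w y hA; rewrite -(teval_shift _ x).
      by case: b hA; [apply: B1 | apply: B0].
    + by move=> r om; rewrite FE hf0.
    + move=> r y b om; rewrite !FE hf1; cbn beta.
      set x := f _ _.
      have -> : tm_eval (econs x (econs y r)) (tm_shift t') =
          tm_eval (nth [::] (rcons (tup n r) y)) t.
        rewrite /tm_shift /t' !tm_eval_subst;
          apply: (tm_eval_ext (n := n.+1)) => // i lt_in.
        rewrite nth_rcons size_tuple.
        case: ltngtP => [h'|h'|_] //; first by rewrite nth_tup.
        by move: lt_in; rewrite ltnS leqNgt h'.
      congr take; congr (h b _ om); apply: tup_eq => i lt_in; rewrite !nth_rcons.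
      rewrite size_rcons size_tuple /sH ltnS leq_eqVlt.
      case: ltngtP => [h'|h'|->] //=; first by rewrite nth_tup.
      by rewrite eqn_leq h' -ltnS lt_in.
  (* The recursion argument is moved back from the front to index [n]. *)
  have := Repr_sub (fun i => if i is j.+1 then Var j else Var n) RF.
  congr Repr; apply/funext => r; apply/funext => om.
  rewrite (_ : (fun i => _) = econs (r n) r) ?FE; last by apply/funext => -[].
  congr (f _ om); apply: tup_eq => i lt_in; rewrite nth_rcons size_tuple.
  case: ltngtP => [h'|h'|->] //; first by rewrite nth_tup.
  by move: lt_in; rewrite ltnS leqNgt h'.
Qed.

Lemma sigma1b_subst s A : sigma1b A -> sigma1b (fm_subst s A).
Proof.
move=> h; elim: h s => {A} [A hA s|t A _ IH s].
  by apply: Sigma1bBase; apply: subword_only_subst.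
by rewrite /= tm_shift_up; apply: (Sigma1bEx (tm_subst s t)).
Qed.

Lemma tm_eval_numeral r s : tm_eval r (numeral s) = s.
Proof.
rewrite /numeral -[RHS]/([::] ++ s) -[X in X ++ s]/(tm_eval r Eps).
by elim: s Eps => [t|b s IH t] /=; rewrite ?cats0 // IH /= -catA.
Qed.

Lemma truth_set_plug G xs y om :
  truth_set (plug G xs y) om = @msat (Std om) (econs y (nth [::] xs)) G.
Proof.
rewrite /truth_set -msat_Std msat_subst.
by congr msat; apply/funext => -[|i]; rewrite teval_Std tm_eval_numeral.
Qed.

Lemma msat_ExUnique (M : structure) (r : nat -> M) G :
  msat r (ExUnique G) <->
  exists y, msat (econs y r) G /\ forall z, msat (econs z r) G -> z = y.
Proof.
rewrite /ExUnique /=; split=> -[y [hy h]]; exists y; split=> // z.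
  move=> hz; have := h z; rewrite -implyE; apply.
  rewrite msat_subst; move: hz; congr msat; by apply/funext => -[].
rewrite -implyE msat_subst => hz; apply: h; move: hz.
by congr msat; apply/funext => -[].
Qed.

Lemma POR_representable k (f : k.-tuple str -> oracle -> str) :
  POR f -> sigma1b_representable f.
Proof.
move=> /POR_Repr[A [b [hA A1 A2 A3]]].
have : sigma_def (fun M r => exists w, prec w (teval (fun i => r i.+1) b) /\
    A M (fun i => r i.+1) w (r 0)) by definable.
case=> G0 [hG0 eG0].
(* Closing off the higher variables by [Eps] ensures that only the arguments and the value remain
   free. *)
pose s i := if i < k.+1 then Var i else Eps.
have eG (M : structure) (r : nat -> M) : msat r (fm_subst s G0) =
    exists w, prec w (teval (fun i => if i < k then r i.+1 else s_eps M) b) /\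
    A M (fun i => if i < k then r i.+1 else s_eps M) w (r 0).
  rewrite msat_subst -eG0 /s /=.
  have -> // : (fun i => teval r (if i.+1 < k.+1 then Var i.+1 else Eps)) =
      (fun i => if i < k then r i.+1 else s_eps M).
  by apply/funext => i; rewrite ltnS; case: ifP.
exists (fm_subst s G0); split.
- exact: sigma1b_subst.
- have [n hn] := fm_vars_ex G0; apply: fm_vars_subst hn => i _.
  by rewrite /s; case: ifP.
- apply: completeness => M r hM; move: r; apply/msat_iter_All => r.
  apply/msat_ExUnique.
  have [w [y [pw _ hy]]] := A1 M hM (fun i => if i < k then r i else s_eps M).
  exists y; split; first by rewrite eG; exists w.
  by move=> z; rewrite eG => -[w' [_ hz]]; apply: (A2 M hM) hz hy.
- move=> xs y om; rewrite truth_set_plug eG.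
  pose r i : str := if i < k then nth [::] xs i else [::].
  rewrite -/r -[econs y _ 0]/y.
  have -> : f xs om = f (tup k r) om.
    by congr (f _ om); apply: tup_eq => i lt_ik; rewrite /r lt_ik.
  split=> [<-|[w [_ /A3->]]//].
  have [w [z [pw _ hz]]] := A1 _ (@Std_model om) r.
  by exists w; split=> //; rewrite -(A3 _ _ _ _ hz).
Qed.

(** * Programs for POR *)

(** Recursion on notation removes the last bit, structural recursion on lists the first one; hence
    the reversed word. *)
Fixpoint rec_rev (g : str) (h : bool -> str -> str -> str) (y : str) : str :=
  if y is b :: y' then h b (rev y') (rec_rev g h y') else g.

Definition recn g h (y : str) : str := rec_rev g h (rev y).

Lemma recn_rcons g h y b : recn g h (rcons y b) = h b y (recn g h y).
Proof. by rewrite /recn rev_rcons /= revK. Qed.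

(* Arities are dropped: a program reads an infinite environment, and the steps of
   [PRec] see the previous value as variable 0 and the prefix as variable 1. *)
Inductive prog : Type :=
  | PVar of nat
  | PEps
  | PSucc of bool & prog
  | PCond of prog & prog & prog & prog
  | PQuery of prog
  | PLet of prog & prog
  | PDrop of nat & prog
  | PRec of tm & prog & prog & prog & prog.

Fixpoint run (c : prog) (r : nat -> str) (w : oracle) : str :=
  match c with
  | PVar i => r i
  | PEps => [::]
  | PSucc b p => rcons (run p r w) b
  | PCond p q q0 q1 => cond (run p r w) (run q r w) (run q0 r w) (run q1 r w)
  | PQuery p => [:: w (run p r w)]
  | PLet p q => run p (econs (run q r w) r) w
  | PDrop k p => run p (fun i => r (k + i)) w
  | PRec t g h0 h1 a => recn (run g r w) (fun b y x =>
      take (size (tm_eval (econs y r) t))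
        (if b then run h1 (econs x (econs y r)) w else run h0 (econs x (econs y r)) w))
      (run a r w)
  end.

Lemma eq_recn g h h' y : (forall b y x, h b y x = h' b y x) ->
  recn g h y = recn g h' y.
Proof. by move=> e; elim/last_ind: y => // y b IH; rewrite !recn_rcons IH e. Qed.

(** Used for substitution by [subst_closed] and for the freshness of Henkin constants. *)
Lemma run_finite c : exists n, forall r r' w, (forall i, i < n -> r i = r' i) ->
  run c r w = run c r' w.
Proof.
have ext n r r' x : (forall i, i < n -> r i = r' i) ->
    forall i, i < n -> econs x r i = econs x r' i :> str.
  by move=> h [|i] //= /ltnW/h.
elim: c => /=.
- by move=> i; exists i.+1 => r r' w; apply.
- by exists 0.
- by move=> b p [n IH]; exists n => r r' w /IH ->.
- move=> p [n IH] q [n' IH'] q0 [n0 IH0] q1 [n1 IH1].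
  exists (maxn (maxn n n') (maxn n0 n1)) => r r' w h.
  by rewrite (IH r r') 1?(IH' r r') 1?(IH0 r r') 1?(IH1 r r') // => i lt_i;
    apply: h; rewrite !leq_max lt_i ?orbT.
- by move=> p [n IH]; exists n => r r' w /IH ->.
- move=> p [n IH] q [n' IH']; exists (maxn n n') => r r' w h.
  rewrite (IH' r r'); last by move=> i lt_i; apply: h; rewrite leq_max lt_i orbT.
  by apply/IH/ext => i lt_i; apply: h; rewrite leq_max lt_i.
- move=> k p [n IH]; exists (k + n) => r r' w h.
  by apply: IH => i lt_i; apply: h; rewrite ltn_add2l.
- move=> t g [n IHg] h0 [n0 IH0] h1 [n1 IH1] a [m IHa].
  have [l hl] := tm_vars_ex t.
  exists (maxn (maxn n m) (maxn (maxn n0 n1) l)) => r r' w h.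
  rewrite (IHg r r') ?(IHa r r'); try by move=> i lt_i; apply: h;
    rewrite !leq_max lt_i ?orbT.
  apply: eq_recn => b y x; congr take.
    rewrite (@tm_eval_ext l _ (econs y r')) //; apply: ext => i lt_i.
    by apply: h; rewrite !leq_max lt_i ?orbT.
  by case: b; [apply: IH1 | apply: IH0]; do 2 apply: (ext); move=> i lt_i;
    apply: h; rewrite !leq_max lt_i ?orbT.
Qed.

Lemma POR_ext n (f g : n.-tuple str -> oracle -> str) :
  (forall xs w, f xs w = g xs w) -> POR f -> POR g.
Proof.
by move=> h; have -> : f = g by apply/funext => xs; apply/funext => w.
Qed.

Lemma POR_var n i : 0 < n -> POR (fun (xs : n.-tuple str) (w : oracle) =>
  nth [::] xs i).
Proof.
move=> n0; have [lt_in|le_ni] := ltnP i n.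
  by apply: (@PorP n (Ordinal lt_in)) => xs w; rewrite (tnth_nth [::]).
(* An index out of range must yield the default of [nth]. The empty function is unary, so it is
   composed with a projection, which exists because [n] is positive. *)
apply: (@PorComp n 1 (fun _ _ => [::]) (fun _ xs _ => tnth xs (Ordinal n0))).
- exact: PorE.
- by move=> _; apply: (@PorP _ (Ordinal n0)).
- by move=> xs w; rewrite nth_default // size_tuple.
Qed.

Lemma POR_comp n m (F : fenv) (h : nat -> n.-tuple str -> oracle -> str) :
  POR (fun (xs : m.-tuple str) w => F (nth [::] xs) w) ->
  (forall i, POR (h i)) -> (forall i xs w, m <= i -> h i xs w = [::]) ->
  POR (fun (xs : n.-tuple str) w => F (fun i => h i xs w) w).
Proof.
move=> hF hh h0; apply: (PorComp hF (fun i : 'I_m => hh i)) => xs w.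
congr (F _ w); apply/funext => i; have [lt_im|le_mi] := ltnP i m.
  by rewrite -(tnth_nth [::] _ (Ordinal lt_im)) tnth_mktuple.
by rewrite h0 // nth_default // size_tuple.
Qed.

Lemma run_POR c n : 0 < n -> POR (fun (xs : n.-tuple str) w => run c (nth [::] xs) w).
Proof.
have const k : 0 < k -> POR (fun (_ : k.-tuple str) (_ : oracle) => [::]).
  move=> k0; apply: POR_ext (POR_var k k0) => xs w.
  by rewrite nth_default // size_tuple.
elim: c n => [i||b p IH|p IHp q IHq q0 IH0 q1 IH1|p IH|p IHp q IHq|k p IH
  |t g IHg h0 IH0 h1 IH1 a IHa] n n0 /=.
- exact: POR_var.
- exact: const.
- apply: (@PorComp n 1 (fun xs _ => rcons (nth [::] xs 0) b)
    (fun _ xs w => run p (nth [::] xs) w)).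
  + exact: (PorS (b := b)).
  + by move=> _; apply: IH.
  + by move=> xs w; rewrite -(tnth_nth _ _ ord0) tnth_mktuple.
- apply: (@PorComp n 4 (fun xs _ =>
    cond (nth [::] xs 0) (nth [::] xs 1) (nth [::] xs 2) (nth [::] xs 3))
    (fun i xs w => run (nth PEps [:: p; q; q0; q1] i) (nth [::] xs) w)).
  + by apply: PorC => // x b y z0 z1 w /=; rewrite cond_rcons.
  + by move=> [[|[|[|[|]]]] //] _ /=;
      [apply: IHp | apply: IHq | apply: IH0 | apply: IH1].
  + move=> xs w; have tE k (lt_k : k < 4) : nth [::] [tuple run (nth PEps [:: p; q;
      q0; q1] i) (nth [::] xs) w | i < 4] k = run (nth PEps [:: p; q; q0;
      q1] k) (nth [::] xs) w.
      by rewrite -(tnth_nth _ _ (Ordinal lt_k)) tnth_mktuple.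
    by rewrite !tE.
- apply: (@PorComp n 1 (fun xs w => [:: w (nth [::] xs 0)])
    (fun _ xs w => run p (nth [::] xs) w)).
  + exact: PorQ.
  + by move=> _; apply: IH.
  + by move=> xs w; rewrite -(tnth_nth _ _ ord0) tnth_mktuple.
- apply: (@POR_comp n n.+1 (run p)
    (fun i xs w => econs (run q (nth [::] xs) w) (nth [::] xs) i)).
  + exact: IHp.
  + by case=> [|i] /=; [apply: IHq | apply: POR_var].
  + by move=> [//|i] xs w /= le_ni; rewrite nth_default // size_tuple.
- apply: (@POR_comp n n (run p) (fun i xs w => nth [::] xs (k + i))).
  + exact: IH.
  + by move=> i; apply: POR_var.
  + move=> i xs w le_ni; rewrite nth_default // size_tuple.
    exact: leq_trans le_ni (leq_addl _ _).
pose hh b := if b then h1 else h0.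
(* POR recursion runs on the last entry of the tuple, so the argument [a] is appended there first
   and its value substituted at the end; [t'] adapts the bound to this order. *)
pose f (zs : n.+1.-tuple str) w := recn (run g (nth [::] (take n zs)) w) (fun b y x =>
  take (size (tm_eval (econs y (nth [::] (take n zs))) t))
    (run (hh b) (econs x (econs y (nth [::] (take n zs)))) w)) (nth [::] zs n).
pose t' := tm_subst (fun i => if i is j.+1 then if j < n then Var j else Eps
                              else Var n) t.
have takeE (xs : n.-tuple str) (y : str) : take n (rcons xs y) = xs.
  by rewrite -cats1 take_size_cat ?size_tuple.
have nthE (xs : n.-tuple str) (y : str) : nth [::] (rcons xs y) n = y.
  by rewrite nth_rcons size_tuple ltnn eqxx.
have take2E (xs : n.-tuple str) (y x : str) : take n (rcons (rcons xs y) x) = xs.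
  by rewrite -!cats1 -catA take_size_cat ?size_tuple.
have nth2E (xs : n.-tuple str) (y x : str) : nth [::] (rcons (rcons xs y) x) n = y.
  by rewrite nth_rcons size_rcons size_tuple ltnSn nthE.
have nth3E (xs : n.-tuple str) (y x : str) : nth [::] (rcons (rcons xs y) x) n.+1 = x.
  by rewrite nth_rcons size_rcons size_tuple ltnn eqxx.
have Pf : POR f.
  apply: (@PorRec n (fun xs w => run g (nth [::] xs) w) (fun b (zs :
    n.+2.-tuple str) w =>
    run (hh b) (econs (nth [::] zs n.+1) (econs (nth [::] zs n) (nth [::] (take n
      zs)))) w) t').
  + exact: IHg.
  + move=> b; apply: (@POR_comp n.+2 n.+2 (run (hh b)) (fun i zs w =>
      econs (nth [::] zs n.+1) (econs (nth [::] zs n) (nth [::] (take n zs))) i)).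
    * by rewrite /hh; case: b; [apply: IH1 | apply: IH0].
    * move=> [|[|i]] /=; [exact: POR_var | exact: POR_var |].
      have [lt_in|le_ni] := ltnP i n.
        by apply: POR_ext (@POR_var n.+2 i isT) => zs w; rewrite nth_take.
      apply: POR_ext (@POR_var n.+2 n.+2 isT) => zs w.
      by rewrite nth_default ?size_tuple // [RHS]nth_default // size_takel ?size_tuple
        //; do 2 apply: leqW.
    * move=> [//|[//|i]] zs w /= le_ni.
      by rewrite nth_default // size_takel ?size_tuple ?(leqW (leqnSn n)) //;
        do 2 apply: ltnW.
  + have [m hm] := tm_vars_ex t; apply: tm_vars_subst hm => -[_|i _] /=;
      first exact: ltnSn.
    by case: ifP => //= lt_in; apply: ltnW.
  + by move=> xs w; rewrite /f takeE nthE.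
  + move=> xs y b w; rewrite /f !takeE !nthE recn_rcons.
    rewrite take2E nth2E nth3E.
    congr take; rewrite tm_eval_subst; congr (size (tm_eval _ t)).
    apply/funext => -[|i] /=; first by rewrite nthE.
    case: ltnP => [lt_in|le_ni] /=; first by rewrite nth_rcons size_tuple lt_in.
    by rewrite nth_default // size_tuple.
apply: (PorComp Pf (h := fun i xs w =>
  if i < n then nth [::] xs i else run a (nth [::] xs) w)).
  by move=> i; case: (i < n); [apply: POR_var | apply: IHa].
move=> xs w.
have -> : [tuple if i < n then nth [::] xs i else run a (nth [::] xs) w | i < n.+1] =
    [tuple of rcons xs (run a (nth [::] xs) w)].
  apply: eq_from_tnth => i; rewrite tnth_mktuple (tnth_nth [::]) /= nth_rcons
    size_tuple.
  by case: ltngtP => // lt_ni; have := ltn_ord i; rewrite ltnS leqNgt lt_ni.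
rewrite /f takeE nthE; apply: eq_recn => b y x.
by rewrite /hh; case: b.
Qed.

Fixpoint bound (c : prog) : tm :=
  match c with
  | PVar i => Var i
  | PEps => Eps
  | PSucc b p => Cat (bound p) (Bit b)
  | PCond _ q q0 q1 => Cat (bound q) (Cat (bound q0) (bound q1))
  | PQuery _ => Bit true
  | PLet p q => tm_subst (econs (bound q) Var) (bound p)
  | PDrop k p => tm_subst (fun i => Var (k + i)) (bound p)
  | PRec t g _ _ a => Cat (bound g) (tm_subst (econs (bound a) Var) t)
  end.

Lemma size_flatten_nseq n (x : str) : size (flatten (nseq n x)) = n * size x.
Proof. by elim: n => //= n IH; rewrite size_cat IH mulSn. Qed.

Lemma size_tm_eval_mono (r r' : nat -> str) t :
  (forall i, size (r i) <= size (r' i)) -> size (tm_eval r t) <= size (tm_eval r' t).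
Proof.
move=> h; elim: t => //= u IHu v IHv; first by rewrite !size_cat leq_add.
by rewrite !size_flatten_nseq leq_mul.
Qed.

(** Truncation is what keeps recursion below a term: a nonempty argument gives a value within [t] at
    a shorter prefix, and terms are monotone in length. *)
Lemma size_run c r w : size (run c r w) <= size (tm_eval r (bound c)).
Proof.
elim: c r => //=.
- by move=> b p IH r; rewrite size_rcons size_cat addn1 ltnS.
- move=> p _ q IHq q0 IH0 q1 IH1 r; rewrite !size_cat /cond.
  case: (run p r w) => [|a x]; first exact: leq_trans (IHq r) (leq_addr _ _).
  case: ifP => _; last first.
    by apply: leq_trans (IH0 r) _; rewrite addnCA leq_addr.
  by apply: leq_trans (IH1 r) _; rewrite addnA leq_addl.
- move=> p IHp q IHq r; apply: leq_trans (IHp _) _; rewrite tm_eval_subst.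
  by apply: size_tm_eval_mono => -[|i] /=.
- by move=> k p IH r; rewrite tm_eval_subst.
- move=> t g IHg h0 _ h1 _ a IHa r; rewrite size_cat tm_eval_subst.
  case/lastP: (run a r w) (IHa r) => [|y b] ha.
    exact: leq_trans (IHg r) (leq_addr _ _).
  rewrite recn_rcons; apply: leq_trans (leq_addl _ _).
  rewrite size_take_min; apply: leq_trans (geq_minl _ _) _.
  apply: size_tm_eval_mono => -[|i] //=; apply: leq_trans ha.
  by rewrite size_rcons.
Qed.

(** * Closure properties of the functions computed by programs *)

Definition prog_fun (F : fenv) : Prop := exists c, F = run c.

Lemma prog_fun_var i : prog_fun (fun r w => r i). Proof. by exists (PVar i). Qed.
Lemma prog_fun_eps : prog_fun (fun r w => [::]). Proof. by exists PEps. Qed.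
Lemma prog_fun_succ b F : prog_fun F -> prog_fun (fun r w => rcons (F r w) b).
Proof. by case=> c ->; exists (PSucc b c). Qed.
Lemma prog_fun_query F : prog_fun F -> prog_fun (fun r w => [:: w (F r w)]).
Proof. by case=> c ->; exists (PQuery c). Qed.
Lemma prog_fun_cond F G H K : prog_fun F -> prog_fun G -> prog_fun H -> prog_fun K ->
  prog_fun (fun r w => cond (F r w) (G r w) (H r w) (K r w)).
Proof. by case=> c -> [c1 ->] [c2 ->] [c3 ->]; exists (PCond c c1 c2 c3). Qed.

Lemma prog_fun_sub F (s : nat -> fenv) : prog_fun F -> (forall i, prog_fun (s i)) ->
  prog_fun (fun r w => F (fun i => s i r w) w).
Proof.
move=> [c ->]; have [m hm] := run_finite c.
move=> hs; apply: (subst_closed _ _ _ hs hm).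
- by move=> G H [a ->] [b ->]; exists (PLet a b).
- by move=> k H [a ->]; exists (PDrop k a).
- by exists c.
Qed.

Lemma prog_fun_econs F (e : (nat -> str) -> oracle -> nat -> str) : prog_fun F ->
  (forall i, prog_fun (fun r w => e r w i)) ->
    forall i, prog_fun (fun r w => econs (F r w) (e r w) i).
Proof. by move=> hF he [|i]; [exact: hF | exact: (he i)]. Qed.

Lemma prog_fun_app1 (f : str -> oracle -> str) F : prog_fun (fun r w => f (r 0) w) ->
  prog_fun F ->
  prog_fun (fun r w => f (F r w) w).
Proof.
by move=> hf hF; apply: (@prog_fun_sub (fun r w => f (r 0) w) (fun i => F)).
Qed.

Lemma prog_fun_app2 (f : str -> str -> oracle -> str) F G :
  prog_fun (fun r w => f (r 0) (r 1) w) -> prog_fun F -> prog_fun G ->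
  prog_fun (fun r w => f (F r w) (G r w) w).
Proof.
move=> hf hF hG.
by apply: (@prog_fun_sub (fun r w => f (r 0) (r 1) w) (fun i =>
  if i is 0 then F else G)) => // -[].
Qed.

(** Under a length bound the truncation is the identity, so a function can be recognised by plain
    recursion equations. *)
Lemma prog_fun_rec_tm (F G : fenv) (H : bool -> fenv) t : prog_fun G ->
  (forall b, prog_fun (H b)) ->
  (forall r w, F (econs [::] r) w = G r w) ->
  (forall r y b w, F (econs (rcons y b) r) w = H b (econs (F (econs y r) w) (econs y
    r)) w) ->
  (forall r y b w, size (F (econs (rcons y b) r) w) <= size (tm_eval (econs y r) t)) ->
  prog_fun F.
Proof.
move=> hG hH F0 F1 hF.
have [g eg] : prog_fun (fun r w => G (fun i => r i.+1) w).
  by apply: (prog_fun_sub (s := fun i r w => r i.+1)) => // i; apply: prog_fun_var.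
(* The steps of [PRec] see the whole environment, including the recursion argument at index 2. [H]
   expects the parameters only, so that index is skipped. *)
have hh b : prog_fun (fun r w => H b (fun i => match i with 0 => r 0 | 1 =>
  r 1 | j.+2 => r j.+3 end) w).
  apply: (prog_fun_sub (s := fun i r w => match i with 0 => r 0 | 1 => r 1 | j.+2 =>
    r j.+3 end)) => //.
  by move=> [|[|i]]; apply: prog_fun_var.
have [h0 e0] := hh false; have [h1 e1] := hh true.
exists (PRec (tm_subst (fun i => if i is j.+1 then Var j.+2 else Var 0) t) g h0 h1
  (PVar 0)).
apply/funext => r; apply/funext => w /=.
have {1}-> : r = econs (r 0) (fun i => r i.+1) by apply/funext => -[].
rewrite -e0 -e1 -eg; elim/last_ind: (r 0) => [|y b IH]; first exact: F0.
rewrite recn_rcons -IH tm_eval_subst.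
have -> : (fun i => tm_eval (econs y r) match i with 0 => Var 0 | j.+1 =>
  Var j.+2 end) =
    econs y (fun i => r i.+1) by apply/funext => -[].
rewrite -[LHS](take_oversize (hF _ _ _ _)) F1; congr take.
by case: b => /=; congr (H _ _ w); apply/funext => -[|[|i]].
Qed.

Lemma prog_fun_rec (F G : fenv) (H : bool -> fenv) B : prog_fun G ->
  (forall b, prog_fun (H b)) -> prog_fun B ->
  (forall r w, F (econs [::] r) w = G r w) ->
  (forall r y b w, F (econs (rcons y b) r) w = H b (econs (F (econs y r) w) (econs y
    r)) w) ->
  (forall r y b w, size (F (econs (rcons y b) r) w) <= size (B (econs y r) w)) ->
  prog_fun F.
Proof.
move=> hG hH [c ->] F0 F1 hF; apply: (prog_fun_rec_tm (t := bound c) hG hH F0 F1).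
by move=> r y b w; apply: leq_trans (hF _ _ _ _) (size_run _ _ _).
Qed.

Lemma prog_fun_cat F G : prog_fun F -> prog_fun G ->
  prog_fun (fun r w => F r w ++ G r w).
Proof.
move=> hF hG; apply: (@prog_fun_app2 (fun y x _ => x ++ y)) => //.
apply: (@prog_fun_rec_tm _ (fun r _ => r 0) (fun b r _ => rcons (r 0) b)
  (Cat (Var 1) (Cat (Var 0) (Bit true)))).
- exact: prog_fun_var.
- by move=> b; apply/prog_fun_succ/prog_fun_var.
- by move=> r w; rewrite /= cats0.
- by move=> r y b w; rewrite /= rcons_cat.
- by move=> r y b w; rewrite /= !size_cat size_rcons addn1.
Qed.

Lemma prog_fun_rep F G : prog_fun F -> prog_fun G ->
  prog_fun (fun r w => flatten (nseq (size (G r w)) (F r w))).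
Proof.
move=> hF hG; apply: (@prog_fun_app2 (fun y x _ => flatten (nseq (size y) x))) => //.
apply: (@prog_fun_rec_tm _ (fun r _ => [::]) (fun b r _ => r 0 ++ r 2)
  (Rep (Var 1) (Cat (Var 0) (Bit true)))).
- exact: prog_fun_eps.
- by move=> b; apply: prog_fun_cat; apply: prog_fun_var.
- by [].
- by move=> r y b w; rewrite /= size_rcons -flatten_nseqSr.
- by move=> r y b w; rewrite /= size_rcons size_cat addn1.
Qed.

Lemma prog_fun_tm t (s : nat -> fenv) : (forall i, prog_fun (s i)) ->
  prog_fun (fun r w => tm_eval (fun i => s i r w) t).
Proof.
move=> hs; elim: t => /=.
- by move=> i; apply: hs.
- exact: prog_fun_eps.
- by move=> b; exact: (prog_fun_succ b prog_fun_eps).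
- by move=> u IHu v IHv; apply: prog_fun_cat.
- by move=> u IHu v IHv; apply: prog_fun_rep.
Qed.

Definition prog_bool (p : (nat -> str) -> oracle -> bool) : Prop :=
  prog_fun (fun r w => [:: p r w]).

Lemma prog_fun_if p F G : prog_bool p -> prog_fun F -> prog_fun G ->
  prog_fun (fun r w => if p r w then F r w else G r w).
Proof.
move=> hp hF hG; have := prog_fun_cond hp prog_fun_eps hG hF; congr prog_fun.
Qed.

Lemma prog_bool_const b : prog_bool (fun r w => b).
Proof. exact: (prog_fun_succ b prog_fun_eps). Qed.

Lemma prog_bool_if p q q' : prog_bool p -> prog_bool q -> prog_bool q' ->
  prog_bool (fun r w => if p r w then q r w else q' r w).
Proof.
move=> hp hq hq'; have := prog_fun_if hp hq hq'; congr prog_fun.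
by apply/funext => r; apply/funext => w /=; case: (p r w).
Qed.

Lemma prog_bool_not p : prog_bool p -> prog_bool (fun r w => ~~ p r w).
Proof. by move=> hp; exact: (prog_bool_if hp (prog_bool_const false) (prog_bool_const
  true)). Qed.

Lemma prog_bool_and p q : prog_bool p -> prog_bool q ->
  prog_bool (fun r w => p r w && q r w).
Proof. by move=> hp hq; exact: (prog_bool_if hp hq (prog_bool_const false)). Qed.

Lemma prog_bool_or p q : prog_bool p -> prog_bool q ->
  prog_bool (fun r w => p r w || q r w).
Proof. by move=> hp hq; exact: (prog_bool_if hp (prog_bool_const true) hq). Qed.

Lemma prog_bool_sub p (s : nat -> fenv) : prog_bool p -> (forall i, prog_fun (s i)) ->
  prog_bool (fun r w => p (fun i => s i r w) w).
Proof. exact: (@prog_fun_sub (fun r w => [:: p r w]) s). Qed.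

Lemma prog_bool_isnil F : prog_fun F -> prog_bool (fun r w => F r w == [::]).
Proof.
move=> hF; have := prog_fun_cond hF (prog_bool_const true) (prog_bool_const false)
  (prog_bool_const false).
congr prog_fun; apply/funext => r; apply/funext => w; rewrite /cond.
by case: (F r w) => // a x; rewrite if_same.
Qed.

Lemma prog_bool_last F : prog_fun F -> prog_bool (fun r w => last false (F r w)).
Proof.
move=> hF; have := prog_fun_cond hF (prog_bool_const false) (prog_bool_const false)
  (prog_bool_const true).
congr prog_fun; apply/funext => r; apply/funext => w; rewrite /cond.
by case: (F r w) => // a x /=; case: (last a x).
Qed.

Definition chop (x : str) : str := take (size x).-1 x.

Lemma chop_rcons x b : chop (rcons x b) = x.
Proof. by rewrite /chop size_rcons -cats1 take_size_cat. Qed.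

Lemma prog_fun_chop F : prog_fun F -> prog_fun (fun r w => chop (F r w)).
Proof.
apply: (@prog_fun_app1 (fun x _ => chop x)).
apply: (@prog_fun_rec_tm _ (fun r _ => [::]) (fun b r _ => r 1) (Var 0)).
- exact: prog_fun_eps.
- by move=> b; apply: prog_fun_var.
- by [].
- by move=> r y b w; rewrite /= chop_rcons.
- by move=> r y b w; rewrite /= chop_rcons.
Qed.

(** Subtraction of lengths: a comparison of lengths becomes an emptiness test. *)
Definition del (x z : str) : str := take (size x - size z) x.

Lemma prog_fun_del F G : prog_fun F -> prog_fun G ->
  prog_fun (fun r w => del (F r w) (G r w)).
Proof.
move=> hF hG; apply: (@prog_fun_app2 (fun z x _ => del x z)) => //.
apply: (@prog_fun_rec_tm _ (fun r _ => r 0) (fun b r _ => chop (r 0)) (Var 1)).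
- exact: prog_fun_var.
- by move=> b; apply/prog_fun_chop/prog_fun_var.
- by move=> r w; rewrite /= /del subn0 take_size.
- move=> r y b w; rewrite /= /del /chop size_rcons size_takel ?leq_subr //.
  by rewrite take_takel ?leq_pred // subnS.
- by move=> r y b w; rewrite /= /del size_takel ?leq_subr.
Qed.

Lemma prog_fun_dropsize F G : prog_fun F -> prog_fun G ->
  prog_fun (fun r w => drop (size (G r w)) (F r w)).
Proof.
move=> hF hG; apply: (@prog_fun_app2 (fun x z _ => drop (size z) x)) => //.
(* [del (r 2) (r 1)] is empty once the prefix read so far has at least as many bits as must be
   dropped; from then on bits are kept. *)
apply: (@prog_fun_rec_tm _ (fun r _ => [::])
  (fun b r _ => if del (r 2) (r 1) == [::] then rcons (r 0) b else [::])
  (Cat (Var 0) (Bit true))).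
- exact: prog_fun_eps.
- move=> b; apply: prog_fun_if; [|exact/prog_fun_succ/prog_fun_var|exact: prog_fun_eps].
  by apply/prog_bool_isnil/prog_fun_del; apply: prog_fun_var.
- by [].
- move=> r y b w; rewrite /= /del -size_eq0 size_takel ?leq_subr // subn_eq0.
  case: leqP => h; first by rewrite drop_rcons.
  by rewrite drop_oversize // size_rcons.
- by move=> r y b w; rewrite /= size_drop size_rcons size_cat addn1 leq_subr.
Qed.

Lemma prog_fun_takesize F G : prog_fun F -> prog_fun G ->
  prog_fun (fun r w => take (size (F r w)) (G r w)).
Proof.
move=> hF hG.
have := prog_fun_del hG (prog_fun_dropsize hG hF); congr prog_fun; apply/funext => r;
  apply/funext => w.
rewrite /del size_drop; have [h|h] := leqP (size (F r w)) (size (G r w)).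
  by rewrite subKn.
by rewrite (eqP (ltnW h)) subn0 take_size take_oversize // ltnW.
Qed.

(** * Search *)

(* The shortest prefix of [y] that satisfies [P], or [y] if there is none. *)
Definition fpre (P : str -> bool) (y : str) : str :=
  recn [::] (fun b y x => if P x then x else rcons y b) y.

Lemma fpre_rcons P y b :
  fpre P (rcons y b) = if P (fpre P y) then fpre P y else rcons y b.
Proof. exact: recn_rcons. Qed.

Lemma fpre_prefix P y : prefix (fpre P y) y.
Proof.
elim/last_ind: y => // y b IH; rewrite fpre_rcons; case: ifP => // _.
  exact: prefix_trans IH (prefix_rcons _ _).
exact: prefix_refl.
Qed.

Lemma fpreP (P : str -> bool) (y p : str) : prefix p y -> P p -> P (fpre P y).
Proof.
elim/last_ind: y => [|y b IH]; first by rewrite prefixs0 => /eqP->.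
rewrite fpre_rcons => /prefix_rconsP[hp /(IH hp) h|-> h]; first by rewrite h.
by case: ifP.
Qed.

Lemma fpre_min (P : str -> bool) (y p : str) : prefix p (fpre P y) ->
  p != fpre P y -> ~~ P p.
Proof.
elim/last_ind: y => [|y b IH]; first by case: p.
rewrite fpre_rcons; case: ifP => // hP /prefix_rconsP[hp _|->]; last by rewrite eqxx.
by apply/negP => /(fpreP hp); rewrite hP.
Qed.

Lemma prog_fun_fpre (P : (nat -> str) -> str -> oracle -> bool) F :
  prog_bool (fun r w => P (fun i => r i.+1) (r 0) w) -> prog_fun F ->
  prog_fun (fun r w => fpre (fun p => P r p w) (F r w)).
Proof.
move=> hP hF.
have : prog_fun (fun r w => fpre (fun p => P (fun i => r i.+1) p w) (r 0)).
  apply: (@prog_fun_rec_tm _ (fun _ _ => [::]) (fun b r w =>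
    if P (fun i => r i.+2) (r 0) w then r 0 else rcons (r 1) b) (Cat (Var 0) (Bit
      true))).
  - exact: prog_fun_eps.
  - move=> b; apply: prog_fun_if;
      [|exact: prog_fun_var|exact/prog_fun_succ/prog_fun_var].
    by apply: (prog_bool_sub (s := fun i r w =>
      if i is j.+1 then r j.+2 else r 0) hP) => -[|i];
      apply: prog_fun_var.
  - by [].
  - by move=> r y b w; rewrite /= fpre_rcons.
  - move=> r y b w; rewrite /= size_cat addn1 -(size_rcons y b).
    exact: size_prefix (fpre_prefix _ _).
move=> h; have := @prog_fun_sub _ (fun i r w => econs (F r w) r i) h; apply.
by apply: prog_fun_econs => // i; apply: prog_fun_var.
Qed.

Definition same_last (x y : str) : bool :=
  if x == [::] then y == [::] else (y != [::]) && ~~ (last false x (+) last false y).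

(** The prefixes of [x] act as counters: shortening both words by the same amount and comparing the
    last bits reconstructs the words from the right. *)
Lemma same_lastP x y : (forall z, prefix z x -> same_last (del x z) (del y z)) -> x = y.
Proof.
move=> h; have {h} : forall j, j <= size x ->
    same_last (take (size x - j) x) (take (size y - j) y).
  move=> j le_j; have := h (take j x); rewrite /del size_takel //; apply.
  by rewrite -{2}(cat_take_drop j x); apply: prefix_prefix.
elim/last_ind: x y => [|x b IH] y h.
  by have := h 0 isT; rewrite !subn0 !take_size /same_last /= => /eqP.
case/lastP: y h => [|y c] h; first by have := h 0 isT; rewrite /same_last;
  case: x {h IH}.
have := h 0 isT; rewrite !subn0 !take_size /same_last !last_rcons.
rewrite -!size_eq0 !size_rcons /= negb_add => /eqP ->; congr rcons; apply: IH => j le_j.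
have := h j.+1; rewrite !size_rcons !subSS -!cats1 !takel_cat ?leq_subr //.
exact.
Qed.

Lemma prog_bool_same_last F G : prog_fun F -> prog_fun G ->
  prog_bool (fun r w => same_last (F r w) (G r w)).
Proof.
move=> hF hG; apply: prog_bool_if; [exact: prog_bool_isnil | exact: prog_bool_isnil |].
apply: prog_bool_and; first exact/prog_bool_not/prog_bool_isnil.
have hx : prog_bool (fun r w => if last false (F r w) then ~~ last false (G r w)
    else last false (G r w)).
  by apply: prog_bool_if; [|apply: prog_bool_not|]; apply: prog_bool_last.
apply: prog_bool_not; move: hx; congr prog_bool; apply/funext => r; apply/funext => w.
by case: (last false (F r w)).
Qed.

(** [Z] is the first counter at which the last bits disagree. If they agree at [Z], they agree at
    every counter. *)
Lemma prog_bool_eq F G : prog_fun F -> prog_fun G ->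
  prog_bool (fun r w => F r w == G r w).
Proof.
move=> hF hG.
pose Z : fenv := fun r w =>
  fpre (fun z => ~~ same_last (del (F r w) z) (del (G r w) z)) (F r w).
have hZ : prog_fun Z.
  apply: (@prog_fun_fpre (fun r z w =>
    ~~ same_last (del (F r w) z) (del (G r w) z))) => //.
  have hs (K : fenv) : prog_fun K -> prog_fun (fun r w => K (fun i => r i.+1) w).
    by move=> hK; apply: (prog_fun_sub (s := fun i r w => r i.+1)) => // i;
      apply: prog_fun_var.
  by apply/prog_bool_not/prog_bool_same_last; apply: prog_fun_del;
    (exact: hs || exact: prog_fun_var).
have : prog_bool (fun r w => same_last (del (F r w) (Z r w)) (del (G r w) (Z r w))).
  by apply: prog_bool_same_last; apply: prog_fun_del.
congr prog_bool; apply/funext => r; apply/funext => w.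
apply/idP/eqP => [h|->]; last by rewrite /same_last; case: eqP => //; rewrite addbb.
apply: same_lastP => z hz; apply: contraT => hn.
have := fpreP (P := fun z => ~~ same_last (del (F r w) z) (del (G r w) z)) hz hn.
by rewrite -/(Z r w) h.
Qed.

Lemma prog_bool_prefix F G : prog_fun F -> prog_fun G ->
  prog_bool (fun r w => prefix (F r w) (G r w)).
Proof.
move=> hF hG.
have : prog_bool (fun r w => fpre (fun p => p == F r w) (G r w) == F r w).
  apply: prog_bool_eq => //; apply: (@prog_fun_fpre (fun r p w => p == F r w)) => //.
  apply: prog_bool_eq; first exact: prog_fun_var.
  by apply: (prog_fun_sub (s := fun i r w => r i.+1)) => // i; apply: prog_fun_var.
congr prog_bool; apply/funext => r; apply/funext => w; apply/eqP/idP => [<-|h].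
  exact: fpre_prefix.
by apply/eqP; apply: (fpreP (P := fun p => p == F r w) h).
Qed.

(** A subword is a suffix of a prefix, so two nested prefix searches find one. The result is a
    subword even if the search fails. *)
Definition fsuf (P : str -> bool) (p : str) : str :=
  drop (size (fpre (fun u => P (drop (size u) p)) p)) p.
Definition fsub (P : str -> bool) (y : str) : str :=
  fsuf P (fpre (fun p => P (fsuf P p)) y).

Lemma fsub_subw om (P : str -> bool) (y : str) : @subw (Std om) (fsub P y) y.
Proof.
set p := fpre (fun p => P (fsuf P p)) y.
have hp : prefix p y by apply: fpre_prefix.
pose u := fpre (fun u => P (drop (size u) p)) p.
have hu : prefix u p by apply: fpre_prefix.
exists u; split; first exact: prefix_trans hu hp.
have -> // : @s_cat (Std om) u (fsub P y) = p.
move: hu; rewrite prefixE => /eqP e; rewrite /= /fsub -/p /fsuf -/u -{1}e.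
exact: cat_take_drop.
Qed.

Lemma fsubP om (P : str -> bool) (y x : str) : @subw (Std om) x y -> P x ->
  P (fsub P y).
Proof.
move=> [u [_ /= hu]] hx; apply: (fpreP (P := fun p => P (fsuf P p)) hu).
rewrite /fsuf; apply: (fpreP (P := fun v =>
  P (drop (size v) (u ++ x))) (prefix_prefix u x)).
by rewrite drop_size_cat.
Qed.

Lemma prog_fun_fsub (P : (nat -> str) -> str -> oracle -> bool) F :
  prog_bool (fun r w => P (fun i => r i.+1) (r 0) w) -> prog_fun F ->
  prog_fun (fun r w => fsub (fun x => P r x w) (F r w)).
Proof.
move=> hP hF.
have hP2 s (K : fenv) : (forall i, prog_fun (s i)) -> prog_fun K ->
  prog_bool (fun r w => P (fun i => s i r w) (K r w) w).
  move=> hs hK; apply: (prog_bool_sub (s := fun i r w =>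
    if i is j.+1 then s j r w else K r w) hP).
  by move=> [|i]; [exact: hK | exact: (hs i)].
have hsuf s (K : fenv) : (forall i, prog_fun (s i)) -> prog_fun K ->
    prog_fun (fun r w => fsuf (fun x => P (fun i => s i r w) x w) (K r w)).
  move=> hs hK; apply: prog_fun_dropsize => //.
  apply: (@prog_fun_fpre (fun r u w => P (fun i =>
    s i r w) (drop (size u) (K r w)) w)) => //.
  have shift (L : fenv) : prog_fun L -> prog_fun (fun r w => L (fun i => r i.+1) w).
    by move=> hL; apply: (prog_fun_sub (s := fun i r w => r i.+1)) => // i;
      apply: prog_fun_var.
  apply: (hP2 (fun i r w => s i (fun j => r j.+1) w)).
    by move=> i; apply: shift.
  by apply: prog_fun_dropsize; [apply: shift | apply: prog_fun_var].
apply: (hsuf (fun i r w => r i)); first by move=> i; apply: prog_fun_var.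
apply: (@prog_fun_fpre (fun r p w => P r (fsuf (fun x => P r x w) p) w)) => //.
apply: (hP2 (fun i r w => r i.+1)); first by move=> i; apply: prog_fun_var.
by apply: (hsuf (fun i r w => r i.+1)) => [i|]; apply: prog_fun_var.
Qed.

(** * Subword-only formulas are decidable in POR *)

Definition prog_dec (P : (nat -> str) -> oracle -> Prop) : Prop :=
  exists2 p, prog_bool p & forall r w, P r w <-> p r w.

(** Each quantifier is evaluated at a single subword computed by [fsub]: a candidate witness for the
    existential one, a candidate counterexample for the universal one. *)
Lemma prog_dec_subword_only A : subword_only A ->
  prog_dec (fun r w => @msat (Std w) r A).
Proof.
have tmE t : prog_fun (fun r w => tm_eval r t).
  by apply: (prog_fun_tm t (s := fun i r w => r i)) => i; apply: prog_fun_var.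
elim=> {A}.
- move=> t; exists (fun r w => w (tm_eval r t)); first exact: prog_fun_query.
  by move=> r w; rewrite /= teval_Std.
- move=> t u; exists (fun r w => tm_eval r t == tm_eval r u); first exact: prog_bool_eq.
  by move=> r w; rewrite /= !teval_Std; split=> /eqP.
- move=> t u; exists (fun r w => prefix (tm_eval r t) (tm_eval r u));
    first exact: prog_bool_prefix.
  by move=> r w; rewrite /= !teval_Std.
- move=> B _ [p hp e]; exists (fun r w => ~~ p r w); first exact: prog_bool_not.
  by move=> r w; rewrite /= e; split=> /negP.
- move=> B C _ [p hp e] _ [q hq e']; exists (fun r w => p r w && q r w);
    first exact: prog_bool_and.
  by move=> r w; rewrite /= e e'; split=> /andP.
- move=> B C _ [p hp e] _ [q hq e']; exists (fun r w => p r w || q r w);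
    first exact: prog_bool_or.
  by move=> r w; rewrite /= e e'; split=> /orP.
- move=> t B _ [p hp e].
  have hp' : prog_bool (fun r w => p (econs (r 0) (fun i => r i.+1)) w).
    by apply: (prog_bool_sub (s := fun i r w => econs (r 0) (fun i => r i.+1) i)) =>
      // -[|i]; apply: prog_fun_var.
  exists (fun r w => p (econs (fsub (fun x => p (econs x r) w) (tm_eval r t)) r) w).
    apply: (prog_bool_sub (s := fun i r w => econs (fsub (fun x =>
      p (econs x r) w) (tm_eval r t)) r i) hp).
    apply: prog_fun_econs => [|i]; last exact: prog_fun_var.
    exact: (@prog_fun_fsub (fun r x w => p (econs x r) w)).
  move=> r w; rewrite msat_ExSub teval_Std; split=> [[x [hx]]|h].
    rewrite e => h; exact: (fsubP (P := fun x => p (econs x r) w) hx h).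
  by exists (fsub (fun x => p (econs x r) w) (tm_eval r t)); rewrite e; split=> //;
    apply: fsub_subw.
- move=> t B _ [p hp e].
  have hp' : prog_bool (fun r w => ~~ p (econs (r 0) (fun i => r i.+1)) w).
    apply: prog_bool_not.
    by apply: (prog_bool_sub (s := fun i r w => econs (r 0) (fun i => r i.+1) i)) =>
      // -[|i]; apply: prog_fun_var.
  exists (fun r w => p (econs (fsub (fun x => ~~ p (econs x r) w) (tm_eval r t)) r) w).
    apply: (prog_bool_sub (s := fun i r w => econs (fsub (fun x =>
      ~~ p (econs x r) w) (tm_eval r t)) r i) hp).
    apply: prog_fun_econs => [|i]; last exact: prog_fun_var.
    exact: (@prog_fun_fsub (fun r x w => ~~ p (econs x r) w)).
  move=> r w; rewrite msat_AllSub teval_Std; split=> [h|h x hx].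
    by apply/e/h; apply: fsub_subw.
  apply/e; apply: contraT => hn.
  by have := fsubP (P := fun x => ~~ p (econs x r) w) hx hn; rewrite h.
Qed.

(** * Herbrand-saturated theories *)

Fixpoint prog_code (c : prog) : GenTree.tree nat :=
  match c with
  | PVar i => GenTree.Leaf i
  | PEps => GenTree.Node 0 [::]
  | PSucc b p => GenTree.Node b [:: prog_code p]
  | PQuery p => GenTree.Node 2 [:: prog_code p]
  | PDrop k p => GenTree.Node k.+3 [:: prog_code p]
  | PLet p q => GenTree.Node 0 [:: prog_code p; prog_code q]
  | PCond p q q0 q1 =>
      GenTree.Node 0 [:: prog_code p; prog_code q; prog_code q0; prog_code q1]
  | PRec t g h0 h1 a => GenTree.Node 0
      [:: tm_code t; prog_code g; prog_code h0; prog_code h1; prog_code a]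
  end.

Fixpoint prog_decode (t : GenTree.tree nat) : prog :=
  match t with
  | GenTree.Leaf i => PVar i
  | GenTree.Node k.+3 [:: p] => PDrop k (prog_decode p)
  | GenTree.Node 2 [:: p] => PQuery (prog_decode p)
  | GenTree.Node k [:: p] => PSucc (k == 1) (prog_decode p)
  | GenTree.Node _ [:: p; q] => PLet (prog_decode p) (prog_decode q)
  | GenTree.Node _ [:: p; q; q0; q1] =>
      PCond (prog_decode p) (prog_decode q) (prog_decode q0) (prog_decode q1)
  | GenTree.Node _ [:: t; g; h0; h1; a] => PRec (tm_decode t) (prog_decode g)
      (prog_decode h0) (prog_decode h1) (prog_decode a)
  | _ => PEps
  end.

Lemma prog_codeK : cancel prog_code prog_decode.
Proof.
elim=> //= [[] p ->|p -> q -> q0 -> q1 ->|p ->|p -> q ->|k p ->|t g -> h0 -> h1 ->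
  a ->] //.
by rewrite tm_codeK.
Qed.

Definition prog_enum (n : nat) : prog :=
  prog_decode (odflt (GenTree.Leaf 0) (unpickle n)).

Lemma prog_enum_surj c : exists n, prog_enum n = c.
Proof. by exists (pickle (prog_code c)); rewrite /prog_enum pickleK /= prog_codeK. Qed.

(* [U r z w]: the matrix of a universal formula in the constants [r], with
   universally quantified variables [z]. *)
Definition uform : Type := (nat -> str) -> (nat -> str) -> oracle -> bool.

(* Since [U] is decidable in POR, a finite disjunction of Herbrand instances
   can be merged into a single one. *)
Definition refuted (U : uform) : Prop := exists tau : nat -> fenv,
  (forall i, prog_fun (tau i)) /\ forall r w, ~~ U r (fun i => tau i r w) w.

Definition depends_below (U : uform) (N : nat) : Prop :=
  forall r r' z w, (forall i, i < N -> r i = r' i) -> U r z w = U r' z w.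

(** POR-decidability allows merging of instances, dependence on finitely many constants leaves fresh
    ones, and the last clause is consistency in the sense of Herbrand. *)
Definition good (U : uform) : Prop :=
  [/\ forall s tau : nat -> fenv, (forall i, prog_fun (s i)) ->
    (forall i, prog_fun (tau i)) ->
        prog_bool (fun r w => U (fun i => s i r w) (fun i => tau i r w) w),
      exists N, depends_below U N
    & ~ refuted U].

(** The fresh constants [r N] and [r N.+1] stand for an argument and a witness there; [x] is
    universally quantified over candidates for the next witness. *)
Definition request (c : prog) (N : nat) (r : nat ->
  str) (x : str) (w : oracle) : bool :=
  run c (econs (r N) (econs (r N.+1) (econs x r))) w == [:: true].

Definition add_request (U : uform) (c : prog) (N : nat) : uform :=
  fun r z w => U r (fun i => z i.+1) w && request c N r (z 0) w.

(** A rejected request leaves its Herbrand refutation behind; this is the source of the POR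
    functions in [holds_herbrand]. *)
Definition next (c : prog) (U U' : uform) : Prop := exists N,
  [/\ depends_below U N,
      forall d1 d2 x (r r' : nat -> str) w, (forall i, i < N -> r i = r' i) ->
        run c (econs d1 (econs d2 (econs x r))) w = run c (econs d1 (econs d2 (econs x
          r'))) w
    & U' = add_request U c N \/ U' = U /\ refuted (add_request U c N)].

Lemma prog_fun_run c (s : nat -> fenv) : (forall i, prog_fun (s i)) ->
  prog_fun (fun r w => run c (fun i => s i r w) w).
Proof. by apply: prog_fun_sub; exists c. Qed.

Lemma next_ex c U : good U -> exists U', good U' /\ next c U U'.
Proof.
move=> gU; have [Upb [N0 hN0] nU] := gU; have [N1 hN1] := run_finite c.
pose N := maxn N0 N1.
have dU : depends_below U N.
  by move=> r r' z w h; apply: hN0 => i lt_i; apply: h; rewrite leq_max lt_i.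
have dc d1 d2 x (r r' : nat -> str) w : (forall i, i < N -> r i = r' i) ->
    run c (econs d1 (econs d2 (econs x r))) w = run c (econs d1 (econs d2 (econs x
      r'))) w.
  move=> h; apply: hN1 => -[|[|[|i]]] //= lt_i; apply: h.
  by rewrite leq_max; apply/orP; right; do 3 apply: ltnW.
have [hr|hr] := EM (refuted (add_request U c N)).
  by exists U; split=> //; exists N; split=> //; right.
exists (add_request U c N); split; last by exists N; split=> //; left.
split=> //.
- move=> s tau hs ht; apply: prog_bool_and; first by apply: Upb.
  apply: prog_bool_eq; last exact: prog_bool_const.
  apply: (prog_fun_run c (s := fun i r w => econs (s N r w) (econs (s N.+1 r w)
    (econs (tau 0 r w) (fun i => s i r w))) i)).
  by do 3 apply: prog_fun_econs => //.
- exists N.+2 => r r' z w h; rewrite /add_request /request !h //.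
  have hN i : i < N -> r i = r' i by move=> lt_i; apply: h; rewrite 2?ltnW.
  by rewrite (dU r r') // (dc _ _ _ r r').
Qed.

(** Contraction is applied to the saturated model before induction is known there. It is therefore
    based on these facts, which transfer from the standard structures. *)
Record nice (M : structure) : Prop := Nice {
  nice_prec_e : forall x : M, prec (s_eps M) x;
  nice_prec_trans : forall x y z : M, prec x y -> prec y z -> prec x z;
  nice_prec_cat : forall x x' y y' : M, prec x x' -> prec y y' ->
    prec (s_cat x y) (s_cat x' y');
  nice_prec_tm : forall (r : nat -> M) x y t, prec x y ->
    prec (teval (econs x r) t) (teval (econs y r) t);
  nice_subw_l : forall x y : M, subw x (s_cat x y);
  nice_subw_r : forall x y : M, subw y (s_cat x y) }.

(* Contraction of the bounded quantifiers of a Sigma^b_1 formula into a single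
   one: the witnesses are subwords of their concatenation. *)
Lemma contract B : sigma1b B ->
  exists (K : forall M : structure, (nat -> M) -> M -> Prop) u,
  [/\ subword_def (fun M r => K M (fun i => r i.+1) (r 0)),
      forall M r x, K M r x -> prec x (teval r u) /\ msat r B
    & forall M, nice M -> forall r, msat r B -> exists x, K M r x].
Proof.
elim=> {B} [A hA|t F _ [K [u [hK K1 K2]]]].
  exists (fun M r x => prec x (s_eps M) /\ msat r A), Eps; split.
  - apply: subword_def_and; first by definable.
    exists (fm_shift A); split; first exact: subword_only_subst.
    by move=> M r; rewrite msat_subst.
  - by [].
  - by move=> M nM r h; exists (s_eps M); split=> //; apply: nice_prec_e.
(* The quantified variable is variable 0 of [u]; replacing it by its bound [t] is sound by
   monotonicity. *)
pose u' := Cat t (tm_subst (econs t Var) u).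
exists (fun M r x => prec x (teval r u') /\ exists y, subw y x /\
  exists x', subw x' x /\
  (prec y (teval r t) /\ K M (econs y r) x')), u'.
have subE (M : structure) (r : nat -> M) : teval r (tm_subst (econs t Var) u) =
    teval (econs (teval r t) r) u.
  by rewrite teval_subst; congr teval; apply/funext => -[].
split.
- have hK' w (s : nat -> forall M : structure, (nat -> M) -> M) : term_def w ->
      (forall i, term_def (s i)) -> subword_def (fun M r => K M (fun i =>
        s i M r) (w M r)).
    move=> hw hs; pose s' i : forall M : structure, (nat -> M) -> M :=
      if i is j.+1 then s j else w.
    apply: (@subword_def_sub _ s' hK); by move=> [|i]; [exact: hw | exact: (hs i)].
  by repeat first [apply: hK'; [|move=> ?] | def_step].
- move=> M r x [hx [y [_ [x' [_ [hy /K1[_ h]]]]]]]; split=> //=.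
  by exists y; rewrite teval_shift.
- move=> M nM r /= [y [hy h]]; rewrite teval_shift in hy.
  have [x' hx'] := K2 M nM _ h; have [px' _] := K1 _ _ _ hx'.
  exists (s_cat y x'); split.
    rewrite /= subE; apply: nice_prec_cat => //.
    by apply: (nice_prec_trans nM) px' _; apply: nice_prec_tm.
  exists y; split; first exact: nice_subw_l.
  by exists x'; split; first exact: nice_subw_r.
Qed.

(** * Henkin construction for universal formulas *)

Section Saturation.
Variables (U0 : uform) (gU0 : good U0).

Fixpoint stageU (n : nat) : {U | good U} :=
  if n is m.+1 then
    let: exist U gU := stageU m in
    let: exist U' hU' := cid (next_ex (prog_enum m) gU) in exist _ U' (proj1 hU')
  else exist _ U0 gU0.

Definition V n : uform := sval (stageU n).

Lemma V_good n : good (V n). Proof. exact: (svalP (stageU n)). Qed.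

Lemma V_next n : next (prog_enum n) (V n) (V n.+1).
Proof. by rewrite /V /=; case: (stageU n) => U gU; case: cid => U' []. Qed.

(** Each added request takes variable 0 and moves the older ones up; [k] counts these requests. *)
Lemma V_mono m n : m <= n ->
  exists k, forall r z w, V n r z w -> V m r (fun i => z (k + i)) w.
Proof.
move=> le_mn; rewrite -(subnK le_mn); elim: (n - m) => [|d [k IH]] /=;
  first by exists 0.
rewrite addSn; have [N [_ _ [->|[-> _]]]] := V_next (d + m); last by exists k.
by exists k.+1 => r z w /andP[/IH].
Qed.

(** Derivability from the saturated theory, with the derivation replaced by one Herbrand instance of
    one stage that implies [p] pointwise. *)
Definition holds (p : (nat -> str) -> oracle -> Prop) : Prop :=
  exists n (tau : nat -> fenv), (forall i, prog_fun (tau i)) /\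
    forall r w, V n r (fun i => tau i r w) w -> p r w.

Lemma holds_False : ~ holds (fun _ _ => False).
Proof.
move=> [n [tau [ht h]]]; have [_ _] := V_good n; apply; exists tau; split=> // r w.
by apply/negP => /h.
Qed.

Lemma holds_mono (p q : (nat -> str) -> oracle -> Prop) :
  (forall r w, p r w -> q r w) -> holds p -> holds q.
Proof. by move=> h [n [tau [ht hp]]]; exists n, tau; split=> // r w /hp/h. Qed.

Lemma holds_true (p : (nat -> str) -> oracle -> Prop) : (forall r w, p r w) -> holds p.
Proof. by move=> h; exists 0, (fun i r w => r i); split=> // i;
  apply: prog_fun_var. Qed.

(** The merged instance [u] follows the first one where that violates the matrix, and the second one
    elsewhere. Hence the matrix at [u] implies it at both. *)
Lemma holds_and p q : holds p -> holds q -> holds (fun r w => p r w /\ q r w).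
Proof.
move=> [m [s [hs hp]]] [n [t [ht hq]]].
have [k hk] := V_mono (leq_maxl m n); have [l hl] := V_mono (leq_maxr m n).
move: (maxn m n) hk hl => N hk hl.
have lift j (s' : nat -> fenv) : (forall i, prog_fun (s' i)) -> exists s'' : nat ->
  fenv,
    (forall i, prog_fun (s'' i)) /\ forall i r w, s'' (j + i) r w = s' i r w.
  move=> hs'; exists (fun i => s' (i - j)); split=> // i r w; by rewrite addKn.
have [s1 [hs1 es]] := lift k s hs; have [t1 [ht1 et]] := lift l t ht.
pose u i : fenv := fun r w =>
  if V N r (fun i => s1 i r w) w then t1 i r w else s1 i r w.
exists N, u; split=> [i|r w].
  have [Vpb _ _] := V_good N.
  apply: prog_fun_if => //; apply: (Vpb (fun i r w => r i)) => // j;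
    exact: prog_fun_var.
case h1 : (V N r (fun i => s1 i r w) w); rewrite /u h1 => h2; last by rewrite h1 in h2.
split.
  by apply: hp; move: (hk _ _ _ h1); congr (is_true (V _ _ _ _)); apply/funext => i;
    rewrite es.
by apply: hq; move: (hl _ _ _ h2); congr (is_true (V _ _ _ _)); apply/funext => i;
  rewrite et.
Qed.

(** Saturation: an accepted request gives constants at which [P] holds for all [s]; a rejected one
    gives a POR function that falsifies [P] for all arguments. *)
Lemma holds_herbrand (P : (nat -> str) -> oracle -> bool) : prog_bool P ->
  (exists d1 d2 : fenv, [/\ prog_fun d1, prog_fun d2 & forall s : fenv, prog_fun s ->
     holds (fun r w => P (econs (d1 r w) (econs (d2 r w) (econs (s r w) r))) w)]) \/
  (exists s : fenv, prog_fun s /\ forall d1 d2 : fenv, prog_fun d1 -> prog_fun d2 ->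
     holds (fun r w => ~~ P (econs (d1 r w) (econs (d2 r w)
       (econs (s (econs (d1 r w) (econs (d2 r w) r)) w) r))) w)).
Proof.
case=> c ec_; have [n hn] := prog_enum_surj c.
have Pc e w : P e w = (run c e w == [:: true]).
  by rewrite -ec_; case: (P e w).
have [N [dV dc [hV|[_ [tau [ht hr]]]]]] := V_next n; rewrite hn in dc.
  left; exists (fun r w => r N), (fun r w => r N.+1); split;
    [exact: prog_fun_var|exact: prog_fun_var|].
  move=> s hs; exists n.+1, (fun i => if i is 0 then s else fun r w => r i).
  split=> [[|i]//|r w]; first exact: prog_fun_var.
  by rewrite hV hn /add_request /request -Pc => /andP[_].
right; rewrite hn in hr.
(* The refutation is valid for all constants, so those at [N] and [N.+1] may be overwritten by
   arbitrary arguments. [V n] lies below [N] and does not notice. *)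
pose upd (e : nat -> str) i := if i == N then e 0 else if i == N.+1 then e 1 else e
  i.+2.
have hupd i : prog_fun (fun r w => upd r i) 
  by rewrite /upd; case: (i == N); [|case: (i == N.+1)]; apply: prog_fun_var.
exists (fun e w => tau 0 (upd e) w); split.
  exact: (prog_fun_sub (s := fun i r w => upd r i)).
move=> d1 d2 h1 h2; pose r' r w := upd (econs (d1 r w) (econs (d2 r w) r)).
exists n, (fun i r w => tau i.+1 (r' r w) w); split=> [i|r w hV].
  apply: (prog_fun_sub (s := fun i r w => r' r w i)) => // j.
  by rewrite /r' /upd; case: (j == N) => //; case: (j == N.+1) => //;
    exact: prog_fun_var.
have e i : i < N -> r' r w i = r i.
  by move=> lt_i; rewrite /r' /upd !ltn_eqF // ltnW.
have rN : r' r w N = d1 r w by rewrite /r' /upd eqxx.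
have rN1 : r' r w N.+1 = d2 r w by rewrite /r' /upd eqxx gtn_eqF.
have := hr (r' r w) w; rewrite /add_request /request -Pc rN rN1 (dV _ r) // hV /=.
by rewrite !Pc -(dc _ _ _ _ _ _ e).
Qed.

(** Saturation for a predicate that reads only the constants says that the theory decides it. *)
Lemma holds_max p : prog_dec p -> holds p \/ holds (fun r w => ~ p r w).
Proof.
case=> b hb e.
have hb' : prog_bool (fun r w => b (fun i => r i.+3) w).
  by apply: (prog_bool_sub (s := fun i r w => r i.+3)) => // i; apply: prog_fun_var.
case: (holds_herbrand hb') => [[d1 [d2 [_ _ h]]]|[s [_ h]]]; [left|right].
  by apply: holds_mono (h _ prog_fun_eps) => r w /= /e.
apply: holds_mono (h _ _ prog_fun_eps prog_fun_eps) => r w /= /negP hn.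
by move/e.
Qed.

Lemma holds_not p : prog_dec p -> holds (fun r w => ~ p r w) <-> ~ holds p.
Proof.
move=> hp; split=> [hn h|]; last by case: (holds_max hp).
by apply: holds_False; apply: holds_mono (holds_and h hn) => r w [].
Qed.

(** * The saturated model *)

Definition elt : Type := {F : fenv | prog_fun F}.
Definition eqG (F G : elt) : Prop := holds (fun r w => sval F r w = sval G r w).

Lemma eqG_refl F : eqG F F. Proof. exact: holds_true. Qed.
Lemma eqG_sym F G : eqG F G -> eqG G F. Proof. exact: holds_mono. Qed.
Lemma eqG_trans F G H : eqG F G -> eqG G H -> eqG F H.
Proof. by move=> h k; apply: holds_mono (holds_and h k) => r w [-> ->]. Qed.

Local Notation q := (cls eqG).
Local Notation qP := (clsP eqG_refl eqG_sym eqG_trans).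

Lemma q_qrep F : eqG (qrep (q F)) F.
Proof. exact: (R_qrep eqG_refl eqG_sym eqG_trans). Qed.

Definition elt_cat (F G : elt) : elt :=
  exist _ (fun r w => sval F r w ++ sval G r w) (prog_fun_cat (svalP F) (svalP G)).
Definition elt_rep (F G : elt) : elt :=
  exist _ (fun r w => flatten (nseq (size (sval G r w)) (sval F r w)))
    (prog_fun_rep (svalP F) (svalP G)).

Definition sat_model : structure :=
  @Structure (quot eqG) (q (exist _ _ prog_fun_eps))
    (fun b => q (exist _ (fun _ _ => [:: b]) (prog_fun_succ b prog_fun_eps)))
    (fun x y => q (elt_cat (qrep x) (qrep y)))
    (fun x y => q (elt_rep (qrep x) (qrep y)))
    (fun x y => holds (fun r w => prefix (sval (qrep x) r w) (sval (qrep y) r w)))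
    (fun x => holds (fun r w => w (sval (qrep x) r w) = true)).

Local Notation M := sat_model.

Definition val (tau : nat -> elt) r w (i : nat) : str := sval (tau i) r w.

Lemma prog_fun_val tau i : prog_fun (fun r w => val tau r w i).
Proof. exact: (svalP (tau i)). Qed.

Definition elt_tm (tau : nat -> elt) t : elt :=
  exist _ (fun r w => tm_eval (val tau r w) t) (prog_fun_tm t (prog_fun_val tau)).

Lemma catM F G : @s_cat M (q F) (q G) = q (elt_cat F G).
Proof.
by apply/qP; apply: holds_mono (holds_and (q_qrep F) (q_qrep G)) => r w /= [-> ->].
Qed.

Lemma repM F G : @s_rep M (q F) (q G) = q (elt_rep F G).
Proof.
by apply/qP; apply: holds_mono (holds_and (q_qrep F) (q_qrep G)) => r w /= [-> ->].
Qed.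

Lemma preM F G : @s_pre M (q F) (q G) <-> holds (fun r w =>
  prefix (sval F r w) (sval G r w)).
Proof.
by split=> h; apply: holds_mono (holds_and h (holds_and (q_qrep F) (q_qrep G))) =>
  r w /= [h' [e e']];
  move: h'; rewrite e e'.
Qed.

Lemma flipM F : @s_flip M (q F) <-> holds (fun r w => w (sval F r w) = true).
Proof.
by split=> h; apply: holds_mono (holds_and h (q_qrep F)) => r w /= [h' e];
  move: h'; rewrite e.
Qed.

Lemma tevalM tau t : @teval M (q \o tau) t = q (elt_tm tau t).
Proof.
elim: t => [i||b|u IHu v IHv|u IHu v IHv].
- by apply/qP; apply: holds_true.
- by apply/qP; apply: holds_true.
- by apply/qP; apply: holds_true.
- transitivity (@s_cat M (@teval M (q \o tau) u) (@teval M (q \o tau) v)) => //.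
  by rewrite IHu IHv catM; apply/qP; apply: holds_true.
- transitivity (@s_rep M (@teval M (q \o tau) u) (@teval M (q \o tau) v)) => //.
  by rewrite IHu IHv repM; apply/qP; apply: holds_true.
Qed.

Lemma econs_q F tau : econs (q F) (q \o tau) = q \o econs F tau :> (nat -> M).
Proof. by apply/funext => -[]. Qed.

Lemma val_econs F tau r w : val (econs F tau) r w = econs (sval F r w) (val tau r w).
Proof. by apply/funext => -[]. Qed.

(** From right to left, the position of the subword must itself be a POR function; [fpre] computes
    it. *)
Lemma subwM F G :
  @subw M (q F) (q G) <-> holds (fun r w => @subw (Std w) (sval F r w) (sval G r w)).
Proof.
split=> [[x]|h].
  rewrite -(qrepK x) catM !preM => -[h k].
  by apply: holds_mono (holds_and h k) => r w [? ?]; exists (sval (qrep x) r w).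
pose p r w (u : str) := prefix (u ++ sval F r w) (sval G r w).
have pu : prog_fun (fun r w => fpre (p r w) (sval G r w)).
  apply: (@prog_fun_fpre (fun r u w => p r w u)); last exact: (svalP G).
  have shift (K : fenv) : prog_fun K -> prog_fun (fun r w => K (fun i => r i.+1) w).
    by move=> hK; apply: (prog_fun_sub (s := fun i r w => r i.+1)) => // i;
      apply: prog_fun_var.
  apply: prog_bool_prefix; last exact: (shift _ (svalP G)).
  by apply: prog_fun_cat; [exact: prog_fun_var | exact: (shift _ (svalP F))].
exists (q (exist _ _ pu)); rewrite catM !preM; split.
  by apply: holds_true => r w; apply: fpre_prefix.
by apply: holds_mono h => r w [u [hu hu']]; exact: (fpreP (P := p r w) hu hu').
Qed.

Lemma prog_dec_val P tau : prog_dec P -> prog_dec (fun r w => P (val tau r w) w).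
Proof.
case=> p hp e; exists (fun r w => p (val tau r w) w) => //.
exact: (prog_bool_sub hp (prog_fun_val tau)).
Qed.

(** Pointwise witnesses become one element, since [fsub] finds them uniformly in the constants and
    the oracle. *)
Lemma sub_witness B tau t : subword_only B ->
  holds (fun r w => @msat (Std w) (val tau r w) (ExSub t B)) ->
  exists F : elt,
    holds (fun r w => @subw (Std w) (sval F r w) (tm_eval (val tau r w) t)) /\
    holds (fun r w => @msat (Std w) (val (econs F tau) r w) B).
Proof.
move=> /prog_dec_subword_only[p hp e] h.
have hF : prog_fun (fun r w => fsub (fun x =>
  p (econs x (val tau r w)) w) (tm_eval (val tau r w) t)).
  apply: (@prog_fun_fsub (fun r x w => p (econs x (val tau r w)) w));
    last exact: prog_fun_tm (prog_fun_val tau).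
  apply: (prog_bool_sub (s := fun i r w => econs (r 0) (val tau (fun i =>
    r i.+1) w) i) hp).
  apply: prog_fun_econs => [|i]; first exact: prog_fun_var.
  apply: (prog_fun_sub (s := fun i r w => r i.+1) (prog_fun_val tau i)) => j;
    exact: prog_fun_var.
exists (exist _ _ hF); split; first by apply: holds_true => r w; apply: fsub_subw.
apply: holds_mono h => r w; rewrite msat_ExSub teval_Std => -[x [hx /e hB]].
apply/e; rewrite val_econs /=.
exact: (fsubP (P := fun x => p (econs x (val tau r w)) w) hx hB).
Qed.

(** Analogue of the fundamental theorem on ultraproducts: [holds_max] settles negation and
    disjunction, [sub_witness] the quantifiers. *)
Lemma msatM A : subword_only A -> forall tau,
  @msat M (q \o tau) A <-> holds (fun r w => @msat (Std w) (val tau r w) A).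
Proof.
elim=> {A}.
- move=> t tau; have -> : @msat M (q \o tau) (Flip t) = @s_flip M (@teval M (q \o tau)
    t) by [].
  by rewrite tevalM flipM; split; apply: holds_mono => r w; rewrite /= teval_Std.
- move=> t u tau.
  have -> : @msat M (q \o tau) (Eq t u) = (@teval M (q \o tau) t = @teval M (q \o tau)
    u) by [].
  by rewrite !tevalM qP; split; apply: holds_mono => r w; rewrite /= !teval_Std.
- move=> t u tau.
  have -> : @msat M (q \o tau) (Pre t u) = @s_pre M (@teval M (q \o tau) t) (@teval M
    (q \o tau) u) by [].
  by rewrite !tevalM preM; split; apply: holds_mono => r w; rewrite /= !teval_Std.
- move=> B hB IH tau; rewrite [msat _ _]/= IH holds_not //.
  exact: prog_dec_val (prog_dec_subword_only hB).
- move=> B C hB IHB hC IHC tau; rewrite [msat _ _]/= IHB IHC; split=> [[h k]|h].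
    exact: holds_and.
  by split; apply: holds_mono h => r w [].
- move=> B C hB IHB hC IHC tau; rewrite [msat _ _]/= IHB IHC; split=> [[]|h].
  + by apply: holds_mono => r w; left.
  + by apply: holds_mono => r w; right.
  have [|k] := holds_max (prog_dec_val tau (prog_dec_subword_only hB)); first by left.
  by right; apply: holds_mono (holds_and h k) => r w [[]].
- move=> t B hB IH tau; rewrite msat_ExSub tevalM; split=> [[x]|h].
    rewrite -(qrepK x) econs_q IH subwM => -[hx h].
    apply: holds_mono (holds_and hx h) => r w [sx hw].
    by rewrite msat_ExSub teval_Std; exists (sval (qrep x) r w); rewrite -val_econs.
  have [F [hF hB']] := @sub_witness B tau t hB h.
  by exists (q F); rewrite econs_q IH subwM.
- move=> t B hB IH tau; rewrite msat_AllSub tevalM; split=> [h|h x].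
    have [//|hn] := holds_max (prog_dec_val tau (prog_dec_subword_only (SubAll t hB))).
    have [F [hF hB']] : exists F : elt,
        holds (fun r w => @subw (Std w) (sval F r w) (tm_eval (val tau r w) t)) /\
        holds (fun r w => @msat (Std w) (val (econs F tau) r w) (Neg B)).
      apply: sub_witness; first by constructor.
      apply: holds_mono hn => r w; rewrite msat_AllSub msat_ExSub teval_Std.
      by move=> /existsNP[x /not_implyP[hx hn]]; exists x.
    case: (@holds_False); have /IH hB2 : @msat M (q \o econs F tau) B.
      by rewrite -econs_q; apply: h; apply/subwM.
    by apply: holds_mono (holds_and hB' hB2) => r w [].
  rewrite -(qrepK x) econs_q IH subwM => hx.
  apply: holds_mono (holds_and hx h) => r w [sx].
  by rewrite msat_AllSub teval_Std val_econs; apply.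
Qed.

Lemma transfer A (e : nat -> M) : subword_only A ->
  (forall w r, @msat (Std w) r A) -> msat e A.
Proof.
move=> hA h; have -> : e = q \o (fun i => qrep (e i)).
  by apply/funext => i /=; rewrite qrepK.
by apply/msatM => //; apply: holds_true.
Qed.

Lemma transferP (P : forall M : structure, (nat -> M) -> Prop) (e : nat -> M) :
  subword_def P -> (forall w r, P (Std w) r) -> P M e.
Proof. by case=> A [hA eA] h; rewrite eA; apply: transfer => // w r; rewrite -eA. Qed.

Lemma sat_model_nice : nice M.
Proof.
split.
- move=> x; apply: (@transferP (fun M r => prec (s_eps M) (r 0)) (fun=> x));
    first by definable.
  by move=> w r; apply: prec_e; apply: Std_model.
- move=> x y z; apply: (@transferP (fun M r => prec (r 0) (r 1) -> prec (r 1) (r 2) ->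
    prec (r 0) (r 2)) (econs x (econs y (fun=> z)))); first by definable.
  by move=> w r; apply: prec_trans; apply: Std_model.
- move=> x x' y y'; apply: (@transferP (fun M r => prec (r 0) (r 1) ->
    prec (r 2) (r 3) ->
    prec (s_cat (r 0) (r 2)) (s_cat (r 1) (r 3))) (econs x (econs x' (econs y (fun=>
      y')))));
    first by definable.
  by move=> w r; apply: prec_cat; apply: Std_model.
- move=> r x y t; apply: (@transferP (fun M r => prec (r 0) (r 1) ->
    prec (teval (econs (r 0) (fun i => r i.+2)) t) (teval (econs (r 1) (fun i =>
      r i.+2)) t))
    (econs x (econs y r))); first by definable.
  move=> w r' h; apply: prec_teval; first exact: Std_model.
  by move=> [|i]; [exact: h | exact: (prec_refl (@Std_model w))].
- move=> x y; exists (s_eps M).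
  apply: (@transferP (fun M r => s_pre (s_eps M) (s_cat (r 0) (r 1)) /\
    s_pre (s_cat (s_eps M) (r 0)) (s_cat (r 0) (r 1))) (econs x (fun=> y)));
      first by definable.
  by move=> w r /=; split; [exact: prefix0s | exact: prefix_prefix].
- move=> x y; exists x.
  apply: (@transferP (fun M r => s_pre (r 0) (s_cat (r 0) (r 1)) /\
    s_pre (s_cat (r 0) (r 1)) (s_cat (r 0) (r 1))) (econs x (fun=> y)));
      first by definable.
  by move=> w r /=; split; [exact: prefix_prefix | exact: prefix_refl].
Qed.

Lemma relM (K : forall M : structure, (nat -> M) -> M -> Prop) tau F :
  subword_def (fun M r => K M (fun i => r i.+1) (r 0)) ->
  K M (q \o tau) (q F) <-> holds (fun r w => K (Std w) (val tau r w) (sval F r w)).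
Proof.
case=> A [hA eA].
have E (S : structure) (r : nat -> S) x : K S r x = msat (econs x r) A by rewrite -eA.
rewrite E econs_q msatM //; split; apply: holds_mono => r w; by rewrite E val_econs.
Qed.

(** By contraction, [B] is replaced by a POR-decidable relation [k] between an argument and one
    bounded witness. *)
Lemma sat_model_induction B (e : nat -> M) : sigma1b B ->
  msat (econs (s_eps M) e) B ->
  (forall x, msat (econs x e) B -> forall b, msat (econs (s_cat x (s_bit M b)) e) B) ->
  forall x, msat (econs x e) B.
Proof.
move=> hB h0 hs x; pose tau i := qrep (e i).
have ee : e = q \o tau by apply/funext => i /=; rewrite qrepK.
have [K [u [hK K1 K2]]] := contract hB.
have [kb hkb ek] : prog_dec (fun r w => K (Std w) (fun i => r i.+1) (r 0)).
  case: hK => A [hA eA]; have [p hp ep] := prog_dec_subword_only hA.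
  by exists p => // r w; rewrite eA.
pose k r w (X Y : str) := kb (econs Y (econs X (val tau r w))) w.
have PBk (s : nat -> fenv) X Y : (forall i, prog_fun (s i)) -> prog_fun X ->
  prog_fun Y ->
    prog_bool (fun r w => k (fun i => s i r w) w (X r w) (Y r w)).
  move=> hs' hX hY; apply: (prog_bool_sub (s := fun i r w =>
    econs (Y r w) (econs (X r w)
    (val tau (fun i => s i r w) w)) i) hkb).
  apply: prog_fun_econs => //; apply: prog_fun_econs => // i.
  exact: (prog_fun_sub (prog_fun_val tau i)).
have kM (X Y : elt) : K M (econs (q X) e) (q Y) <->
    holds (fun r w => k r w (sval X r w) (sval Y r w)).
  rewrite ee econs_q relM //; split; apply: holds_mono => r w; rewrite val_econs /k.
    by move=> h; apply/ek.
  by move/ek.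
have elt_succ (X : elt) b : s_cat (q X : M) (s_bit M b) =
    q (exist _ _ (prog_fun_succ b (svalP X))).
  by rewrite catM; apply/qP; apply: holds_true => r w /=; rewrite cats1.
have step b : exists s : fenv, prog_fun s /\ forall X Y : fenv, prog_fun X ->
  prog_fun Y ->
    holds (fun r w => k r w (X r w) (Y r w) ->
      k r w (rcons (X r w) b) (s (econs (X r w) (econs (Y r w) r)) w)).
  (* A failure of the step: [r 1] is a witness at [r 0], but [r 2] is none at its successor.
     Constants at which every [r 2] fails would contradict [hs]; the other alternative of saturation
     is the desired step function. *)
  pose P (r : nat -> str) w := k (fun i => r i.+3) w (r 0) (r 1) &&
    ~~ k (fun i => r i.+3) w (rcons (r 0) b) (r 2).
  have hP : prog_bool P.
    apply: prog_bool_and; last apply: prog_bool_not;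
      by apply: (PBk (fun i r w => r i.+3)) => [i||]; rewrite ?(prog_fun_succ b) //;
        do ?apply: prog_fun_succ; apply: prog_fun_var.
  case: (holds_herbrand hP) => [[X [Y [hX hY h]]]|[s [hs' h]]]; last first.
    exists s; split=> // X Y hX hY; apply: holds_mono (h X Y hX hY) => r w.
    by rewrite /P /= negb_and negbK => /orP[/negP|].
  have /K1[_ /hs] : K M (econs (q (exist _ X hX)) e) (q (exist _ Y hY)).
    by apply/kM; apply: holds_mono (h _ prog_fun_eps) => r w /andP[].
  move=> /(_ b) /(K2 M sat_model_nice)[y]; rewrite elt_succ -(qrepK y) => /kM hy.
  case: (@holds_False).
  by apply: holds_mono (holds_and hy (h _ (svalP (qrep y)))) =>
    r w /= [hk /andP[_ /negP]].
have [s0 [hs0 S0]] := step false; have [s1 [hs1 S1]] := step true.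
pose s b := if b then s1 else s0.
have Ss b X Y (hX : prog_fun X) (hY : prog_fun Y) : holds (fun r w =>
  k r w (X r w) (Y r w) ->
      k r w (rcons (X r w) b) (s b (econs (X r w) (econs (Y r w) r)) w)).
  by case: b; [exact: S1 | exact: S0].
have [y0] := K2 M sat_model_nice _ h0; rewrite -(qrepK y0) => /kM hy0.
(* Iterates the step function from the witness [y0] at the empty word; each value is truncated to
   the bound [u] at the new prefix. *)
pose W : fenv := fun r w => recn (sval (qrep y0) (fun i => r i.+1) w) (fun b x y =>
  take (size (tm_eval (econs (rcons x b) (val tau (fun i => r i.+1) w)) u))
    (s b (econs x (econs y (fun i => r i.+1))) w)) (r 0).
have W_rcons r X b w : W (econs (rcons X b) r) w =
    take (size (tm_eval (econs (rcons X b) (val tau r w)) u)) (s b (econs X (econs (W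
      (econs X r) w) r)) w).
  by rewrite /W recn_rcons.
have hW : prog_fun W.
  apply: (@prog_fun_rec W (sval (qrep y0)) (fun b r w =>
    take (size (tm_eval (econs (rcons (r 1) b) (val tau (fun i => r i.+2) w)) u))
      (s b (econs (r 1) (econs (r 0) (fun i => r i.+2))) w))
    (fun r w => tm_eval (econs (rcons (r 0) true) (val tau (fun i => r i.+1) w)) u)).
  - exact: (svalP (qrep y0)).
  - move=> b; apply: prog_fun_takesize.
      apply: (prog_fun_tm u (s := fun i r w =>
        econs (rcons (r 1) b) (val tau (fun i => r i.+2) w) i)).
      apply: prog_fun_econs => [|i]; first by apply: prog_fun_succ; apply: prog_fun_var.
      by apply: (prog_fun_sub (s := fun i r w => r i.+2) (prog_fun_val tau i)) => j;
        apply: prog_fun_var.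
    apply: (prog_fun_sub (F := s b) (s := fun i r w =>
      econs (r 1) (econs (r 0) (fun i => r i.+2)) i)).
      by rewrite /s; case: b.
    apply: prog_fun_econs; first exact: prog_fun_var.
    by apply: prog_fun_econs => [|i]; apply: prog_fun_var.
  - apply: (prog_fun_tm u (s := fun i r w =>
      econs (rcons (r 0) true) (val tau (fun i => r i.+1) w) i)).
    apply: prog_fun_econs => [|i]; first by apply: prog_fun_succ; apply: prog_fun_var.
    by apply: (prog_fun_sub (s := fun i r w => r i.+1) (prog_fun_val tau i)) => j;
      apply: prog_fun_var.
  - by [].
  - by move=> r X b w; rewrite W_rcons.
  - move=> r X b w; rewrite W_rcons size_take_min; apply: leq_trans (geq_minl _ _) _.
    by apply: size_tm_eval_mono => -[|i] //=; rewrite !size_rcons.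
pose Q r w X := k r w X (W (econs X r) w).
have hWX X : prog_fun X -> prog_fun (fun r w => W (econs (X r w) r) w).
  move=> hX; apply: (prog_fun_sub (s := fun i r w => econs (X r w) r i) hW).
  by apply: prog_fun_econs => // i; apply: prog_fun_var.
have Q0 : holds (fun r w => Q r w [::]) by exact: hy0.
(* A correct witness already lies within [u], by [K1], so the truncation does not change it. *)
have QS b X : prog_fun X -> holds (fun r w => Q r w (X r w) -> Q r w (rcons (X r w) b)).
  move=> hX; apply: holds_mono (Ss b X _ hX (hWX X hX)) => r w h hQ.
  have := h hQ; rewrite /Q /k W_rcons => hk; rewrite take_oversize //.
  by case/ek/K1: hk => /prec_Std; rewrite teval_Std.
rewrite -(qrepK x); apply: (proj2 (K1 M _ (q (exist _ _ (hWX _ (svalP (qrep x))))) _)).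
apply/kM => /=; set X := sval (qrep x).
have hX : prog_fun X by exact: svalP.
have PQ : prog_bool (fun r w => Q (fun i => r i.+1) w (r 0)).
  apply: (PBk (fun i r w => r i.+1)) => [i||];
    [exact: prog_fun_var | exact: prog_fun_var |].
  by move: hW; congr prog_fun; apply/funext => r; apply/funext => w; congr (W _ w);
    apply/funext => -[].
(* The predecessor of the shortest prefix of [X] at which [Q] fails. Two instances of [QS] at [mu]
   replace an induction over all prefixes; both bits are needed because the one that occurs depends
   on [r] and [w]. *)
pose mu : fenv := fun r w => chop (fpre (fun p => ~~ Q r w p) (X r w)).
have hmu : prog_fun mu.
  apply: prog_fun_chop; apply: (@prog_fun_fpre (fun r p w => ~~ Q r w p)) => //.
  exact: prog_bool_not.
apply: holds_mono (holds_and Q0 (holds_and (QS false mu hmu) (QS true mu hmu))) =>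
  r w [q0 [qf qt]].
apply: contraT => nq; rewrite -/(Q r w (X r w)) in nq.
have hn := fpreP (P := fun p => ~~ Q r w p) (prefix_refl (X r w)) nq.
have hmin := @fpre_min (fun p => ~~ Q r w p) (X r w).
move: hn hmin qf qt; rewrite /mu; case/lastP: (fpre _ _) => [|p b]; first by rewrite q0.
rewrite chop_rcons => hn hmin qf qt.
have qp : Q r w p.
  rewrite -[Q r w p]negbK; apply: hmin; first exact: prefix_rcons.
  by apply/eqP => /(congr1 size) /eqP; rewrite size_rcons ltn_eqF.
by case: b hn {hmin}; rewrite ?qf ?qt.
Qed.

(** Apart from induction, all axioms are subword-only and true in the standard structures, so they
    transfer. *)
Lemma sat_model_is_model : is_model RS1bNIA M.
Proof.
move=> A e hA; case: (hA) => [|b||b||b|b||b|B hB]; last first.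
  rewrite /= -implyE; move=> [h0 hs]; apply: sat_model_induction => //.
    by move: h0; rewrite msat_inst.
  move=> x hx b; have := hs x; rewrite -implyE => /(_ hx);
    rewrite !msat_subst => -[hf ht].
  have E c : (fun i => @teval M (econs x e)
      match i with 0 => Cat (Var 0) (Bit c) | _.+1 => Var i end) =
      econs (s_cat x (s_bit M c)) e by apply/funext => -[|i].
  by case: b; rewrite -E.
all: apply: transfer; first by do ?constructor.
all: by move=> w r; apply: Std_model; constructor.
Qed.

End Saturation.

Lemma representable_POR k (f : k.-tuple str -> oracle -> str) : 0 < k ->
  sigma1b_representable f -> POR f.
Proof.
move=> k0 [G [hG _ prv hf]].
have [K [u [hK K1 K2]]] := contract hG.
have [kb hkb ek] : prog_dec (fun r w => K (Std w) (fun i => r i.+1) (r 0)).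
  case: hK => A [hA eA]; have [p hp ep] := prog_dec_subword_only hA.
  by exists p => // r w; rewrite eA.
(* The entry [z 0] is the value [y] and [z 1] the contracted witness; the constants [r] are the
   arguments. *)
pose U0 : uform := fun r z w => ~~ kb (econs (z 1) (econs (z 0) r)) w.
(* A refutation provides a correct value [tau 0] with witness [tau 1] for all arguments and oracles,
   so [tau 0] computes [f]. *)
have [[tau [ht hr]]|nr] := EM (refuted U0).
  have [c hc] := ht 0; apply: POR_ext (run_POR c k0) => xs w.
  apply/esym/hf; rewrite truth_set_plug -hc.
  have := hr (nth [::] xs) w; rewrite /U0 negbK => /ek /K1[_].
  by [].
have gU0 : good U0.
  split=> //.
    move=> s tau hs ht; apply: prog_bool_not.
    apply: (prog_bool_sub (s := fun i r w =>
      econs (tau 1 r w) (econs (tau 0 r w) (fun i => s i r w)) i) hkb).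
    by do 2 apply: prog_fun_econs => //.
  case: hkb => c hc; have [N hN] := run_finite c; exists N => r r' z w h.
  have := hN (econs (z 1) (econs (z 0) r)) (econs (z 1) (econs (z 0) r')) w.
  rewrite -hc /U0 => E; suff [->] : [:: kb (econs (z 1) (econs (z 0) r)) w] =
      [:: kb (econs (z 1) (econs (z 0) r')) w] by [].
  by apply: E => -[|[|i]] //= lt_i; apply: h; do 2 apply: ltnW.
have hM : is_model RS1bNIA (sat_model gU0) := @sat_model_is_model _ gU0.
(* Variables are interpreted by the Henkin constants themselves. *)
pose tau i : elt := exist _ _ (prog_fun_var i).
have valE r w : val tau r w = r by apply/funext.
have : @msat (sat_model gU0) (cls (eqG gU0) \o tau) (ExUnique G).
  have h (r : nat -> sat_model gU0) : msat r (iter k All (ExUnique G)).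
    exact: (soundness hM prv).
  by apply: ((msat_iter_All (sat_model gU0) k (ExUnique G)).1 h).
move=> /msat_ExUnique[y [hy _]]; rewrite -(qrepK y) econs_q in hy.
have [x] := K2 _ (sat_model_nice gU0) _ hy; rewrite -(qrepK x) => /(relM _ _ _ hK) hx.
case: (@holds_False _ gU0).
(* The pair found in the model is a Herbrand instance of stage 0, whose matrix [U0] denies it. *)
have hn : holds gU0 (fun r w => ~ K (Std w) (econs (sval (qrep y) r w) r) (sval (qrep
  x) r w)).
  exists 0, (fun i => if i is 0 then sval (qrep y) else sval (qrep x)); split.
    by case=> [|i]; apply: svalP.
  by move=> r w /negP hk hK'; apply: hk; apply/ek.
by apply: holds_mono (holds_and hx hn) => r w; rewrite val_econs valE => -[].
Qed.

Theorem theorem3p4 (k : nat) (hk : 0 < k)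
    (f : k.-tuple str -> oracle -> str) :
  sigma1b_representable f <-> POR f.
Proof. by split; [apply: representable_POR | apply: POR_representable]. Qed.
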